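(* Let $k$ be a field (not necessarily algebraically closed). Let $Q$ be the quiver with two vertices $1,2$ and exactly four arrows: two arrows $\alpha,\beta: 1\to 2$ and two arrows $\gamma,\delta: 2\to 1$. Let $r\subseteq kQ$ be the two-sided ideal generated by all paths of length $1$, and let $A = kQ/r^3$. Let $I$ be a two-sided ideal of $A$ contained in the radical of $A$. Then the mutation quiver $Q(s\tau\text{-tilt } A/I)$ has at most two connected components.
   Context: Let $A$ be a finite-dimensional $k$-algebra. $\mathrm{mod}\,A$ denotes finite-dimensional left $A$-modules, identified with representations of the quiver of $A$ (satisfying the relations). $\tau$ is the Auslander-Reiten translation. A module $M$ is $\tau$-rigid if $\mathrm{Hom}_A(M,\tau M)=0$. A module is basic if no two of its nonzero indecomposable summands in a decomposition are isomorphic. $|X|$ is the number of pairwise non-isomorphic indecomposable direct summands of $X$. A $\tau$-rigid pair is a pair $(M,P)$ of basic modules with $M$ $\tau$-rigid, $P$ projective and $\mathrm{Hom}_A(P,M)=0$. It is support $\tau$-tilting if $|M|+|P|=|A|$ and almost complete support $\tau$-tilting if $|M|+|P|=|A|-1$. A pair $(N,R)$ is a summand of $(M,P)$ if $N$ is a summand of $M$ and $R$ is a summand of $P$. Every almost complete support $\tau$-tilting pair is a summand of exactly two distinct (up to isomorphism) support $\tau$-tilting pairs; these two are called mutations of each other. $\mathrm{add}\,M$ is the category of modules all of whose indecomposable summands are summands of $M$, and $\mathrm{Fac}\,M$ is the category of quotients of modules in $\mathrm{add}\,M$. If $T_1=(M_1,P_1)$ and $T_2=(M_2,P_2)$ are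 mutations of each other, then one of $\mathrm{Fac}\,M_1$, $\mathrm{Fac}\,M_2$ is strictly contained in the other; $T_2$ is a left mutation of $T_1$ if $\mathrm{Fac}\,M_2\subset \mathrm{Fac}\,M_1$. The mutation quiver $Q(s\tau\text{-tilt } A)$ has as vertices the isomorphism classes of support $\tau$-tilting pairs over $A$, and an arrow $T_1\to T_2$ exactly when $T_2$ is a left mutation of $T_1$. Connected components are those of the underlying undirected graph. *)

(* Defs.v *)
From HB Require Import structures.
From Stdlib Require Import Relation_Operators.
From mathcomp Require Import all_boot all_order all_algebra all_field.
From mathcomp Require Import finmap monalg.

Set Implicit Arguments.
Unset Strict Implicit.
Unset Printing Implicit Defensive.

Import GRing.Theory.
Local Open Scope ring_scope.

Record quiver := Quiver {
  vert : finType;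
  arr : finType;
  src : arr -> vert;
  tgt : arr -> vert;
  vert_gt0 : (0 < #|vert|)%N
}.

Section Paths.
Variable Q : quiver.

Fixpoint walk (v : vert Q) (s : seq (arr Q)) : bool :=
  if s is a :: s' then (src a == v) && walk (tgt a) s' else true.

Definition walk_end (v : vert Q) (s : seq (arr Q)) : vert Q :=
  foldl (fun _ a => tgt a) v s.

(* The first component is the starting vertex, so that there is one trivial
   path per vertex; the arrows are listed in the order they are traversed. *)
Definition qpath : choiceType := {p : vert Q * seq (arr Q) | walk p.1 p.2}.

Definition psrc (p : qpath) : vert Q := (val p).1.
Definition pseq (p : qpath) : seq (arr Q) := (val p).2.
Definition ptgt (p : qpath) : vert Q := walk_end (psrc p) (pseq p).
Definition plen (p : qpath) : nat := size (pseq p).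

Definition ptriv (v : vert Q) : qpath := exist _ (v, [::]) isT.

Lemma walk_cat v s t : walk v (s ++ t) = walk v s && walk (walk_end v s) t.
Proof. by elim: s v => //= a s IH v; rewrite IH andbA. Qed.

Lemma walk_end_cat v s t : walk_end v (s ++ t) = walk_end (walk_end v s) t.
Proof. exact: foldl_cat. Qed.

(* [pcomp q p] is the path "first p, then q", when p ends where q starts. *)
Definition pcomp (q p : qpath) : option qpath :=
  if ptgt p == psrc q then insub (psrc p, pseq p ++ pseq q) else None.

Lemma pcompE q p : ptgt p = psrc q ->
  exists r, [/\ pcomp q p = Some r, psrc r = psrc p, ptgt r = ptgt q
              & pseq r = pseq p ++ pseq q].
Proof.
move=> e; rewrite /pcomp e eqxx.
have w : walk (psrc p) (pseq p ++ pseq q).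
  rewrite walk_cat; apply/andP; split; first exact: (valP p).
  by rewrite -[walk_end _ _]/(ptgt p) e; exact: (valP q).
exists (exist _ (psrc p, pseq p ++ pseq q) w); split => //; first by rewrite insubT.
by rewrite /ptgt /psrc /pseq /= walk_end_cat -[walk_end (val p).1 _]/(ptgt p) e.
Qed.

Lemma qpath_eq (p q : qpath) : psrc p = psrc q -> pseq p = pseq q -> p = q.
Proof.
move=> e1 e2; apply: val_inj.
by rewrite [val p]surjective_pairing [val q]surjective_pairing; congr pair.
Qed.

End Paths.

Section PathProduct.
Variables (Q : quiver) (k : fieldType) (V : lmodType k).
Variables (b : qpath Q -> V) (m : V -> V -> V).
Hypothesis b_ext : forall F G : V -> V, linear F -> linear G ->
  (forall p, F (b p) = G (b p)) -> F =1 G.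
Hypothesis m_linl : forall g, linear (m^~ g).
Hypothesis m_linr : forall f, linear (m f).
Hypothesis mU : forall q p, m (b q) (b p) = oapp b 0 (pcomp q p).

Lemma path_product0l g : m 0 g = 0.
Proof. by have := m_linl g (-1) 0 0; rewrite !scaleN1r !addNr. Qed.

Lemma path_product0r f : m f 0 = 0.
Proof. by have := m_linr f (-1) 0 0; rewrite !scaleN1r !addNr. Qed.

Lemma path_productDl : left_distributive m +%R.
Proof. by move=> f g h; have := m_linl h 1 f g; rewrite !scale1r. Qed.

Lemma path_productDr : right_distributive m +%R.
Proof. by move=> f g h; have := m_linr f 1 g h; rewrite !scale1r. Qed.

Lemma path_productZl c f g : c *: m f g = m (c *: f) g.
Proof. by have := m_linl g c f 0; rewrite path_product0l !addr0. Qed.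

Lemma path_productZr c f g : c *: m f g = m f (c *: g).
Proof. by have := m_linr f c g 0; rewrite path_product0r !addr0. Qed.

Lemma path_productA : associative m.
Proof.
move=> f g h; move: f.
apply: (b_ext (F := m^~ _) (G := fun f => m (m f g) h)).
- exact: m_linl.
- by move=> c f f'; rewrite !m_linl.
move=> r; move: g.
apply: (b_ext (F := fun g => m _ (m g h)) (G := fun g => m (m _ g) h)).
- by move=> c g g'; rewrite m_linl m_linr.
- by move=> c g g'; rewrite m_linr m_linl.
move=> q; move: h.
apply: (b_ext (F := fun h => m _ (m _ h)) (G := m _)).
- by move=> c h h'; rewrite !m_linr.
- exact: m_linr.
move=> p; rewrite !mU.
have [e1|n1] := eqVneq (ptgt p) (psrc q); have [e2|n2] := eqVneq (ptgt q) (psrc r).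
- have [s [-> s1 s2 s3]] := pcompE e1; have [t [-> t1 t2 t3]] := pcompE e2.
  rewrite /= !mU.
  have [u [-> u1 u2 u3]] := pcompE (etrans s2 e2).
  have [v [-> v1 v2 v3]] := pcompE (etrans e1 (esym t1)).
  congr b; apply: qpath_eq; first by rewrite u1 v1 s1.
  by rewrite u3 v3 s3 t3 catA.
- have [s [-> s1 s2 s3]] := pcompE e1.
  by rewrite /= mU /pcomp s2 (negbTE n2) /= path_product0l.
- have [t [-> t1 t2 t3]] := pcompE e2.
  by rewrite /= mU /pcomp t1 (negbTE n1) /= path_product0r.
- by rewrite /pcomp (negbTE n1) (negbTE n2) /= path_product0l path_product0r.
Qed.

Lemma path_product1l : left_id (\sum_(v : vert Q) b (ptriv v)) m.
Proof.
apply: b_ext; [exact: m_linr | by [] | move=> p].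
rewrite (big_morph (m^~ _) (fun f g => path_productDl f g _) (path_product0l _)).
rewrite (bigD1 (ptgt p)) //= big1 => [|v nv].
  have [r [e r1 r2 r3]] := @pcompE Q (ptriv (ptgt p)) p erefl.
  rewrite addr0 mU e /=.
  by congr b; apply: qpath_eq => //; rewrite r3 cats0.
by rewrite mU /pcomp eq_sym (negbTE nv).
Qed.

Lemma path_product1r : right_id (\sum_(v : vert Q) b (ptriv v)) m.
Proof.
apply: b_ext; [exact: m_linl | by [] | move=> p].
rewrite (big_morph (m _) (fun f g => path_productDr _ f g) (path_product0r _)).
rewrite (bigD1 (psrc p)) //= big1 => [|v nv].
  have [r [e r1 r2 r3]] := @pcompE Q p (ptriv (psrc p)) erefl.
  rewrite addr0 mU e /=.
  by congr b; apply: qpath_eq => //; rewrite r3.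
by rewrite mU /pcomp (negbTE nv).
Qed.

End PathProduct.

Lemma malgUZ (R : nzRingType) (K : choiceType) (c : R) (x : K) :
  << c *g x >> = c *: << x >> :> {malg R[K]}.
Proof. by apply/malgP => y; rewrite mcoeffZ !mcoeffU mulrnAr mulr1. Qed.

Lemma malg_sumU_neq0 (R : nzRingType) (K : choiceType) (I : finType) (h : I -> K) :
  injective h -> (0 < #|I|)%N -> \sum_(i : I) << h i >> != 0 :> {malg R[K]}.
Proof.
move=> hI /card_gt0P[i _]; apply/eqP => /(congr1 (mcoeff (h i))) /eqP.
rewrite raddf_sum mcoeff0 (bigD1 i) //= mcoeffU eqxx big1 => [|j nj].
  by rewrite addr0 oner_eq0.
by rewrite mcoeffU (inj_eq hI) (negbTE nj).
Qed.

Section PathAlgebra.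
Variables (k : fieldType) (Q : quiver).
Local Notation path := (qpath Q).

Definition path_alg : Type := {malg k[path]}.
HB.instance Definition _ := GRing.Lmodule.on path_alg.

Definition pbasis (p : path) : path_alg := << p >>.

Definition malg_lift (V : lmodType k) (phi : path -> V) (f : path_alg) : V :=
  \sum_(p <- msupp f) f@_p *: phi p.

Definition path_mul (f g : path_alg) : path_alg :=
  malg_lift (fun q => malg_lift (fun p => oapp pbasis 0 (pcomp q p)) g) f.

Definition path_one : path_alg := \sum_(v : vert Q) pbasis (ptriv v).

Lemma malg_liftEw (V : lmodType k) (phi : path -> V) f (d : {fset path}) :
  (msupp f `<=` d)%fset -> malg_lift phi f = \sum_(p <- d) f@_p *: phi p.
Proof.
move=> sub; rewrite /malg_lift (big_fset_incl _ sub) // => p _ np.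
by rewrite (mcoeff_outdom np) scale0r.
Qed.

Lemma malg_lift_linear (V : lmodType k) (phi : path -> V) :
  linear (malg_lift phi).
Proof.
move=> c f g.
have s : (msupp (c *: f + g) `<=` msupp f `|` msupp g)%fset.
  apply: (fsubset_trans (msuppD_le _ _)); apply: fsetSU; exact: msuppZ_le.
rewrite (malg_liftEw _ s) (malg_liftEw _ (fsubsetUl (msupp f) (msupp g))).
rewrite (malg_liftEw _ (fsubsetUr (msupp f) (msupp g))).
rewrite scaler_sumr -big_split; apply: eq_bigr => p _ /=.
by rewrite mcoeffD mcoeffZ scalerDl scalerA.
Qed.

Lemma malg_liftU (V : lmodType k) (phi : path -> V) p :
  malg_lift phi (pbasis p) = phi p.
Proof.
rewrite /malg_lift msuppU oner_eq0 big_seq_fset1 mcoeffUU; exact: scale1r.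
Qed.


Lemma pbasisZ c p : << c *g p >> = c *: pbasis p.
Proof. exact: malgUZ. Qed.

Lemma path_alg_ext (F G : path_alg -> path_alg) :
  linear F -> linear G -> (forall p, F (pbasis p) = G (pbasis p)) -> F =1 G.
Proof.
move=> lF lG e f.
pose HF := GRing.isLinear.Build k path_alg path_alg *:%R F lF.
pose HG := GRing.isLinear.Build k path_alg path_alg *:%R G lG.
pose F' : {linear path_alg -> path_alg} := HB.pack F HF.
pose G' : {linear path_alg -> path_alg} := HB.pack G HG.
rewrite (_ : f = \sum_(p <- msupp f) f@_p *: pbasis p); last first.
  by rewrite [LHS]monalgE; apply: eq_bigr => p _; exact: pbasisZ.
rewrite -[F _]/(F' _) -[G _]/(G' _) !linear_sum; apply: eq_bigr => p _.
by rewrite !linearZ /=; congr (_ *: _); exact: e.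
Qed.

Lemma path_mul_linear_l g : linear (path_mul^~ g).
Proof. exact: malg_lift_linear. Qed.

Lemma path_mul_linear_r f : linear (path_mul f).
Proof.
move=> c g h; rewrite /path_mul /malg_lift scaler_sumr -big_split.
apply: eq_bigr => q _ /=; rewrite -/(malg_lift _ _) malg_lift_linear.
by rewrite scalerDr !scalerA mulrC.
Qed.

Lemma path_mulU q p : path_mul (pbasis q) (pbasis p) = oapp pbasis 0 (pcomp q p).
Proof. by rewrite /path_mul !malg_liftU. Qed.

Lemma path_one_neq0 : path_one != 0.
Proof.
apply: malg_sumU_neq0 (vert_gt0 Q) => u v e.
exact: (congr1 (@psrc Q) e).
Qed.

HB.instance Definition _ := GRing.Zmodule_isNzRing.Build path_alg
  (path_productA path_alg_ext path_mul_linear_l path_mul_linear_r path_mulU)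
  (path_product1l path_alg_ext path_mul_linear_l path_mul_linear_r path_mulU)
  (path_product1r path_alg_ext path_mul_linear_l path_mul_linear_r path_mulU)
  (path_productDl path_mul_linear_l) (path_productDr path_mul_linear_r)
  path_one_neq0.

HB.instance Definition _ := GRing.Lmodule_isLalgebra.Build k path_alg
  (path_productZl path_mul_linear_l).
HB.instance Definition _ := GRing.Lalgebra_isAlgebra.Build k path_alg
  (path_productZr path_mul_linear_r).

End PathAlgebra.

Section Ideals.
Variables (k : fieldType) (A : algType k).
Implicit Types I J L S : A -> Prop.

Definition left_ideal L : Prop :=
  [/\ L 0, forall x y, L x -> L y -> L (x + y) & forall a x, L x -> L (a * x)].

Definition two_sided_ideal I : Prop :=
  left_ideal I /\ forall a x, I x -> I (x * a).

Definition ideal_gen S : A -> Prop := fun x =>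
  forall J, two_sided_ideal J -> (forall y, S y -> J y) -> J x.

Definition ideal_mul I J : A -> Prop :=
  ideal_gen (fun z => exists x y, [/\ I x, J y & z = x * y]).

Definition maximal_left_ideal L : Prop :=
  [/\ left_ideal L, ~ L 1 &
    forall L', left_ideal L' -> ~ L' 1 -> (forall x, L x -> L' x) ->
      forall x, L' x -> L x].

Definition radical : A -> Prop := fun x => forall L, maximal_left_ideal L -> L x.

End Ideals.

Definition quotient_map (k : fieldType) (A B : algType k) (I : A -> Prop)
    (p : {lrmorphism A -> B}) : Prop :=
  (forall y, exists x, p x = y) /\ (forall x, p x = 0 <-> I x).

Definition arrow_ideal (k : fieldType) (Q : quiver) : path_alg k Q -> Prop :=
  ideal_gen (fun x => exists p : qpath Q, plen p = 1%N /\ x = pbasis k p).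

Lemma card_bool_gt0 : (0 < #|{: bool}|)%N.
Proof. by rewrite card_bool. Qed.

(* Vertices 1 and 2 are [false] and [true]; [(v, i)] is the i-th of the two
   arrows starting at [v]. *)
Definition double_kronecker : quiver :=
  @Quiver bool (bool * bool)%type fst (fun a => ~~ a.1) card_bool_gt0.

(* The opposite algebra, so that right A-modules are left A^c-modules. *)
Section OppositeAlgebra.
Variables (k : fieldType) (A : falgType k).

HB.instance Definition _ := Vector.on A^c.

HB.instance Definition _ := GRing.Lmodule_isLalgebra.Build k A^c
  (fun c x y => scalerAr c (y : A) (x : A)).
HB.instance Definition _ := GRing.Lalgebra_isAlgebra.Build k A^c
  (fun c x y => scalerAl c (y : A) (x : A)).

End OppositeAlgebra.

Record fdmod (k : fieldType) (A : falgType k) := FdMod {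
  carrier :> vectType k;
  act : A -> carrier -> carrier;
  act_linear_l : forall x, linear (act^~ x);
  act_linear_r : forall a, linear (act a);
  act1 : forall x, act 1 x = x;
  actM : forall a b x, act (a * b) x = act a (act b x)
}.

HB.instance Definition _ (k : fieldType) (A : falgType k) (M : fdmod A) (a : A) :=
  GRing.isLinear.Build k M M *:%R (@act k A M a) (@act_linear_r k A M a).

Section Modules.
Variables (k : fieldType) (A : falgType k).
Implicit Types M N L X Y P : fdmod A.

Definition is_hom M N (f : 'Hom(M, N)) : Prop :=
  forall a x, f (act a x) = act a (f x).

Definition surj M N (f : 'Hom(M, N)) : Prop := limg f = fullv.

Definition iso M N : Prop :=
  exists f : 'Hom(M, N), [/\ is_hom f, lker f = 0%VS & surj f].

Definition hom_trivial M N : Prop := forall f : 'Hom(M, N), is_hom f -> f = 0.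

Definition is_zero M : Prop := \dim {:M} = 0%N.

Lemma regular_linear_l (x : A) : linear ( *%R^~ x).
Proof. by move=> c a b; rewrite mulrDl scalerAl. Qed.

Lemma regular_linear_r (a : A) : linear ( *%R a).
Proof. by move=> c x y; rewrite mulrDr scalerAr. Qed.

Definition regular : fdmod A :=
  @FdMod k A A *%R regular_linear_l regular_linear_r (@mul1r A)
    (fun a b x => esym (mulrA a b x)).

Lemma zero_linear (U V : lmodType k) : linear (fun _ : U => 0 : V).
Proof. by move=> c x y; rewrite scaler0 addr0. Qed.

Lemma zero_act1 (x : 'rV[k]_0) : 0 = x.
Proof. by rewrite [x]thinmx0. Qed.

Definition zero_mod : fdmod A :=
  @FdMod k A 'rV[k]_0 (fun _ _ => 0) (fun _ => @zero_linear _ _)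
    (fun _ => @zero_linear _ _) zero_act1 (fun _ _ _ => erefl).

Section DirectSum.
Variables M N : fdmod A.

Definition dsum_act (a : A) (z : M * N) : M * N := (act a z.1, act a z.2).

Lemma dsum_linear_l z : linear (dsum_act^~ z).
Proof. by move=> c a b; rewrite /dsum_act !act_linear_l. Qed.

Lemma dsum_linear_r a : linear (dsum_act a).
Proof. by move=> c z w; rewrite /dsum_act /= !act_linear_r. Qed.

Lemma dsum_act1 z : dsum_act 1 z = z.
Proof. by rewrite /dsum_act !act1 -surjective_pairing. Qed.

Lemma dsum_actM a b z : dsum_act (a * b) z = dsum_act a (dsum_act b z).
Proof. by rewrite /dsum_act !actM. Qed.

Definition dsum : fdmod A :=
  @FdMod k A (M * N)%type dsum_act dsum_linear_l dsum_linear_r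
    dsum_act1 dsum_actM.

End DirectSum.

Definition summand N M : Prop := exists L, iso M (dsum N L).

Definition indecomposable M : Prop :=
  ~ is_zero M /\ forall X Y, iso M (dsum X Y) -> is_zero X \/ is_zero Y.

Definition decomposition M n (s : 'I_n -> fdmod A) : Prop :=
  (forall i, indecomposable (s i)) /\
  iso M (\big[dsum/zero_mod]_(i < n) s i).

Definition basic M : Prop :=
  forall n (s : 'I_n -> fdmod A), decomposition M s ->
    forall i j, iso (s i) (s j) -> i = j.

(* |M| = n *)
Definition num_summands M (n : nat) : Prop :=
  exists s : 'I_n -> fdmod A,
    [/\ forall i, indecomposable (s i) /\ summand (s i) M,
        forall i j, iso (s i) (s j) -> i = j
      & forall X, indecomposable X -> summand X M -> exists i, iso X (s i)].

Definition projective P : Prop :=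
  forall X Y (g : 'Hom(X, Y)) (f : 'Hom(P, Y)),
    is_hom g -> surj g -> is_hom f ->
    exists h : 'Hom(P, X), is_hom h /\ (g \o h)%VF = f.

(* For surjective [f] this says that [f] is an essential epimorphism; in
   general, that it is so onto its image, i.e. that [lker f] is superfluous. *)
Definition superfluous_kernel M N (f : 'Hom(M, N)) : Prop :=
  forall X (h : 'Hom(X, M)), is_hom h -> limg (f \o h)%VF = limg f -> surj h.

Definition minimal_presentation M P1 P0 (f : 'Hom(P1, P0)) (g : 'Hom(P0, M)) :
    Prop :=
  [/\ projective P1 /\ projective P0, is_hom f /\ is_hom g,
      surj g /\ limg f = lker g
    & superfluous_kernel f /\ superfluous_kernel g].

Definition hom_defect M N (a : A) (f : 'Hom(M, N)) : 'Hom(M, N) :=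
  (f \o linfun (act a))%VF - (linfun (act a) \o f)%VF.

Lemma hom_defectE M N a (f : 'Hom(M, N)) x :
  hom_defect a f x = f (act a x) - act a (f x).
Proof.
by rewrite /hom_defect add_lfunE opp_lfunE !comp_lfunE !lfunE.
Qed.

Lemma hom_defect_linear M N a : linear (@hom_defect M N a).
Proof.
move=> c f g; apply/lfunP => x.
rewrite hom_defectE [RHS]add_lfunE scale_lfunE !hom_defectE.
rewrite !add_lfunE !scale_lfunE.
by rewrite act_linear_r scalerBr opprD addrACA.
Qed.

HB.instance Definition _ M N a :=
  GRing.isLinear.Build k 'Hom(M, N) 'Hom(M, N) *:%R (@hom_defect M N a)
    (@hom_defect_linear M N a).

Definition hom_space M N : {vspace 'Hom(M, N)} :=
  (\bigcap_(a <- vbasis {:A}) lker (linfun (hom_defect a)))%VS.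

Lemma hom_spaceP M N (f : 'Hom(M, N)) : f \in hom_space M N <-> is_hom f.
Proof.
have -> : (f \in hom_space M N) =
    all (fun a => f \in lker (linfun (hom_defect a))) (vbasis {:A}).
  rewrite /hom_space; elim: (tval _) => [|a s IH] /=.
    by rewrite big_nil memvf.
  by rewrite big_cons memv_cap IH.
split => [/allP h a x | h]; last first.
  apply/allP => a _ /=; rewrite memv_ker lfunE /=; apply/eqP/lfunP => x.
  by rewrite hom_defectE zero_lfunE (h a x) subrr.
rewrite (coord_vbasis (memvf a)).
pose l1 := GRing.isLinear.Build k A M *:%R (fun b => act b x) (act_linear_l x).
pose l2 := GRing.isLinear.Build k A N *:%R (fun b => act b (f x)) (act_linear_l (f x)).
pose L1 : {linear A -> M} := HB.pack (fun b : A => act b x) l1.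
pose L2 : {linear A -> N} := HB.pack (fun b : A => act b (f x)) l2.
rewrite -[act _ x]/(L1 _) -[act _ (f x)]/(L2 _) !linear_sum.
apply: eq_bigr => i _; rewrite !linearZ /=; congr (_ *: _).
have := h _ (mem_nth (0 : A) (_ : i < size (vbasis {:A}))%N).
rewrite size_tuple => /(_ (ltn_ord i)) /=.
rewrite memv_ker lfunE /= => /eqP/lfunP/(_ x).
by rewrite hom_defectE lfunE /= => /subr0_eq.
Qed.

End Modules.

Section Transpose.
Variables (k : fieldType) (A : falgType k).

(* [star P] is the right A-module Hom_A(P, A): (h a)(x) = h(x) a. *)
Section Star.
Variable P : fdmod A.
Let H := subvs_of (hom_space P (regular A)).

Definition star_act (a : A^c) (h : H) : H :=
  vsproj _ (amulr (a : A) \o vsval h)%VF.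

Lemma star_act_hom a (h : H) :
  (amulr (a : A) \o vsval h)%VF \in hom_space P (regular A).
Proof.
apply: (hom_spaceP (M := P) (N := regular A) _).2 => b y.
rewrite !comp_lfunE !lfunE /=.
rewrite ((hom_spaceP (M := P) (N := regular A) _).1 (subvsP h)).
exact: esym (mulrA _ _ _).
Qed.

Lemma star_actE a (h : H) x : vsval (star_act a h) x = vsval h x * (a : A).
Proof. by rewrite (vsprojK (star_act_hom a h)) comp_lfunE lfunE. Qed.

Lemma star_eq (h h' : H) : (forall x, vsval h x = vsval h' x) -> h = h'.
Proof. by move=> e; apply: val_inj; apply/lfunP. Qed.

Lemma star_linear_l h : linear (star_act^~ h).
Proof.
move=> c a b; apply: star_eq => x.
rewrite star_actE linearP add_lfunE scale_lfunE !star_actE.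
by rewrite mulrDr scalerAr.
Qed.

Lemma star_linear_r a : linear (star_act a).
Proof.
move=> c h g; apply: star_eq => x.
rewrite star_actE !linearP !add_lfunE !scale_lfunE !star_actE.
by rewrite mulrDl scalerAl.
Qed.

Lemma star_act1 h : star_act 1 h = h.
Proof. by apply: star_eq => x; rewrite star_actE mulr1. Qed.

Lemma star_actM (a b : A^c) h :
  star_act (@GRing.mul A^c a b) h = star_act a (star_act b h).
Proof. by apply: star_eq => x; rewrite !star_actE -mulrA. Qed.

Definition star : fdmod A^c :=
  @FdMod k A^c H star_act star_linear_l star_linear_r star_act1 star_actM.

End Star.

Definition star_map (P1 P0 : fdmod A) (f : 'Hom(P1, P0)) :
    'Hom(star P0, star P1) :=
  linfun (fun h : star P0 => vsproj _ (vsval h \o f)%VF : star P1).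

Lemma star_map_linear (P1 P0 : fdmod A) (f : 'Hom(P1, P0)) :
  linear (fun h : star P0 => vsproj _ (vsval h \o f)%VF : star P1).
Proof.
move=> c g h; rewrite (linearP vsval) comp_lfunDl -comp_lfunZl.
exact: linearP.
Qed.

Lemma star_mapE (P1 P0 : fdmod A) (f : 'Hom(P1, P0)) (h : star P0) x : is_hom f ->
  vsval (star_map f h) x = vsval h (f x).
Proof.
move=> fH.
pose l := GRing.isLinear.Build k (star P0) (star P1) *:%R _ (star_map_linear f).
pose F : {linear star P0 -> star P1} :=
  HB.pack (fun h : star P0 => vsproj _ (vsval h \o f)%VF : star P1) l.
rewrite /star_map -[linfun _]/(linfun F) (lfunE F) /=.
rewrite vsprojK ?comp_lfunE //.
apply: (hom_spaceP (M := P1) (N := regular A) _).2 => a y.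
rewrite !comp_lfunE fH.
by rewrite ((hom_spaceP (M := P0) (N := regular A) _).1 (subvsP h)).
Qed.

(* [dual N] is the left A-module Hom_k(N, k) of a right A-module N. *)
Section Dual.
Variable N : fdmod A^c.
Let D := 'Hom(N, k^o).

Definition dual_act (a : A) (u : D) : D := (u \o linfun (@act k A^c N a))%VF.

Lemma dual_actE a u x : dual_act a u x = u (@act k A^c N a x).
Proof. by rewrite comp_lfunE lfunE. Qed.

Lemma dual_linear_l u : linear (dual_act^~ u).
Proof.
move=> c a b; apply/lfunP => x.
by rewrite add_lfunE scale_lfunE !dual_actE -linearP -act_linear_l.
Qed.

Lemma dual_linear_r a : linear (dual_act a).
Proof.
move=> c u v; apply/lfunP => x.
by rewrite !(add_lfunE, scale_lfunE, dual_actE).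
Qed.

Lemma dual_act1 u : dual_act 1 u = u.
Proof. by apply/lfunP => x; rewrite dual_actE (@act1 k A^c). Qed.

Lemma dual_actM a b u : dual_act (a * b) u = dual_act a (dual_act b u).
Proof.
apply/lfunP => x; rewrite !dual_actE; congr (u _).
exact: (@actM k A^c N b a x).
Qed.

Definition dual : fdmod A :=
  @FdMod k A D dual_act dual_linear_l dual_linear_r dual_act1 dual_actM.

End Dual.

(* T is the transpose of M, i.e. the cokernel of [star_map f]. *)
Definition is_transpose (M : fdmod A) (T : fdmod A^c) : Prop :=
  exists (P1 P0 : fdmod A) (f : 'Hom(P1, P0)) (g : 'Hom(P0, M))
         (c : 'Hom(star P1, T)),
    [/\ minimal_presentation f g, is_hom c, surj c
      & lker c = limg (star_map f)].

Definition is_tau (M N : fdmod A) : Prop :=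
  exists T : fdmod A^c, is_transpose M T /\ iso N (dual T).

End Transpose.

Section TauTilting.
Variables (k : fieldType) (A : falgType k).

Definition tau_rigid (M : fdmod A) : Prop :=
  exists N, is_tau M N /\ hom_trivial M N.

Record mod_pair := ModPair { pmod : fdmod A; pproj : fdmod A }.
Implicit Types T U : mod_pair.

Definition pair_iso T U : Prop :=
  iso (pmod T) (pmod U) /\ iso (pproj T) (pproj U).

Definition pair_summand U T : Prop :=
  summand (pmod U) (pmod T) /\ summand (pproj U) (pproj T).

Definition tau_rigid_pair T : Prop :=
  [/\ basic (pmod T) /\ basic (pproj T), tau_rigid (pmod T),
      projective (pproj T) & hom_trivial (pproj T) (pmod T)].

Definition support_tau_tilting T : Prop :=
  tau_rigid_pair T /\
  exists m p n, [/\ num_summands (pmod T) m, num_summands (pproj T) p,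
    num_summands (regular A) n & m + p = n]%N.

Definition almost_complete T : Prop :=
  tau_rigid_pair T /\
  exists m p n, [/\ num_summands (pmod T) m, num_summands (pproj T) p,
    num_summands (regular A) n & (m + p).+1 = n]%N.

Definition mutation T1 T2 : Prop :=
  [/\ support_tau_tilting T1, support_tau_tilting T2, ~ pair_iso T1 T2
    & exists U, [/\ almost_complete U, pair_summand U T1 & pair_summand U T2]].

Definition in_add (M N : fdmod A) : Prop :=
  forall X, indecomposable X -> summand X N -> summand X M.

Definition in_Fac (M X : fdmod A) : Prop :=
  exists (N : fdmod A) (f : 'Hom(N, X)), [/\ in_add M N, is_hom f & surj f].

Definition left_mutation T1 T2 : Prop :=
  [/\ mutation T1 T2,
      forall X, in_Fac (pmod T2) X -> in_Fac (pmod T1) X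
    & ~ (forall X, in_Fac (pmod T1) X -> in_Fac (pmod T2) X)].

(* The vertices of the mutation quiver are the isomorphism classes of support
   tau-tilting pairs; here they are given by representatives, with isomorphic
   pairs identified in [connected]. *)
Definition sttilt := {T : mod_pair | support_tau_tilting T}.

Definition mutation_arrow (S1 S2 : sttilt) : Prop :=
  left_mutation (proj1_sig S1) (proj1_sig S2).

Definition connected : sttilt -> sttilt -> Prop :=
  clos_refl_sym_trans sttilt (fun S1 S2 : sttilt =>
    pair_iso (proj1_sig S1) (proj1_sig S2) \/ mutation_arrow S1 S2).

Definition at_most_components (n : nat) : Prop :=
  forall T : 'I_n.+1 -> sttilt, exists i j, i <> j /\ connected (T i) (T j).

End TauTilting.

(* Main.v *)
Require Import Defs.
From HB Require Import structures.
From Stdlib Require Import Classical FunctionalExtensionality Relation_Operators.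
From mathcomp Require Import all_boot all_order all_algebra all_field.
From mathcomp Require Import finmap monalg zify.

Set Implicit Arguments.
Unset Strict Implicit.
Unset Printing Implicit Defensive.

Import GRing.Theory.
Local Open Scope ring_scope.

(** Let [i] and [~~ i] be the two vertices, [P_i] and [P_(~~ i)] the indecomposable
    projectives.  As the cube of the radical vanishes, the paths between distinct
    vertices have length one and those from a vertex to itself have length at most
    two.  Hence the homomorphisms between the two projectives in one direction are
    the span [V] of at most two arrows, and endomorphisms of the projectives act on
    [V] through their residues in [k] ([corner_mulr], [corner_mull]).

    A module [M] has no nonzero homomorphism to its translate if and only if every
    homomorphism [P1 -> M] extends along the minimal presentation [P1 -> P0] of [M]
    ([tau_rigidP]).  It follows that [P1] and [P0] have no common summand
    ([tau_data_neq]), so a nonprojective [M] with two summands is the cokernel of a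
    map between copies of [P_(~~ i)] and of [P_i], that is of a matrix over [V].

    Suppose that [V] has dimension two.  The matrix is then a pencil [f], a
    representation of the Kronecker quiver, and the extension property says that
    every pencil [h] of the same size is of the form [s f + f t]: the pencil is rigid
    ([prigid_of_tau_data], [cok_tau_rigid]).  A rigid pencil is one-to-one or onto
    ([prigid_full]) and is not square unless empty ([prigid_square]), so reflection
    functors reduce it or its transpose to a one-to-one pencil; hence it is a sum of
    copies of two consecutive preprojective pencils [L m], [L m.+1], or the transpose
    of such a sum ([prigid_trichotomy]).  The corresponding pairs form two chains of left
    mutations, one descending from [(B, 0)] ([L_linked]) and one descending to
    [(0, B)], past the pair of a simple and a projective module ([K_linked]).

    If [V] has dimension at most one, row reduction shows that [M] has [P_i] as a
    summand, so that it is a left mutation of [(B, 0)] ([degenerate_linked]).  The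
    pairs with one summand in each part are neighbours of [(0, B)]
    ([linked_hub_proj]).  So every pair is in the component of [(B, 0)] or of
    [(0, B)] ([support_linked]).  Indecomposable summands are identified throughout
    by the Krull-Schmidt property, from Fitting's lemma ([fitting]). *)

(** * Homomorphisms of modules *)

Section Homs.
Variables (k : fieldType) (A : falgType k).
Implicit Types M N L X Y Z P : fdmod A.

Definition mhom M N (f : M -> N) : Prop :=
  {morph f : x y / x + y} /\ forall a x, f (act a x) = act a (f x).

Lemma act0 M a : act a (0 : M) = 0.
Proof. exact: (raddf0 (act a)). Qed.

Lemma actD M a (x y : M) : act a (x + y) = act a x + act a y.
Proof. exact: (raddfD (act a)). Qed.

Lemma actN M a (x : M) : act a (- x) = - act a x.
Proof. exact: (raddfN (act a)). Qed.

Lemma actB M a (x y : M) : act a (x - y) = act a x - act a y.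
Proof. exact: (raddfB (act a)). Qed.

Lemma actZr M a c (x : M) : act a (c *: x) = c *: act a x.
Proof. by have := act_linear_r a c x 0; rewrite act0 !addr0. Qed.

Lemma act_sumr M a I (r : seq I) (p : pred I) (F : I -> M) :
  act a (\sum_(i <- r | p i) F i) = \sum_(i <- r | p i) act a (F i).
Proof. exact: (raddf_sum (act a)). Qed.

Lemma actDl M a b (x : M) : act (a + b) x = act a x + act b x.
Proof. by have := @act_linear_l _ _ M x 1 a b; rewrite !scale1r. Qed.

Lemma act0l M (x : M) : act 0 x = 0.
Proof. by apply: (@addIr _ (act 0 x)); rewrite -actDl !add0r. Qed.

Lemma actZl M c a (x : M) : act (c *: a) x = c *: act a x.
Proof. by have := @act_linear_l _ _ M x c a 0; rewrite act0l !addr0. Qed.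

Lemma actNl M a (x : M) : act (- a) x = - act a x.
Proof. by rewrite -scaleN1r actZl scaleN1r. Qed.

Lemma actBl M a b (x : M) : act (a - b) x = act a x - act b x.
Proof. by rewrite actDl actNl. Qed.

Lemma act_suml M I (r : seq I) (p : pred I) (F : I -> A) (x : M) :
  act (\sum_(i <- r | p i) F i) x = \sum_(i <- r | p i) act (F i) x.
Proof. exact: (big_morph (fun a => act a x) (fun a b => actDl a b x) (act0l x)). Qed.

Section MhomTheory.
Variables (M N : fdmod A) (f : M -> N).
Hypothesis fH : mhom f.

Lemma mhomD x y : f (x + y) = f x + f y. Proof. exact: fH.1. Qed.
Lemma mhom_act a x : f (act a x) = act a (f x). Proof. exact: fH.2. Qed.
Lemma mhom0 : f 0 = 0. Proof. by rewrite -(act0l 0) mhom_act act0l. Qed.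
Lemma mhomZ c x : f (c *: x) = c *: f x.
Proof. by rewrite -{1}(act1 x) -actZl mhom_act actZl act1. Qed.
Lemma mhomN x : f (- x) = - f x. Proof. by rewrite -scaleN1r mhomZ scaleN1r. Qed.
Lemma mhomB x y : f (x - y) = f x - f y. Proof. by rewrite mhomD mhomN. Qed.
Lemma mhom_sum I (r : seq I) (p : pred I) (F : I -> M) :
  f (\sum_(i <- r | p i) F i) = \sum_(i <- r | p i) f (F i).
Proof. by apply: (big_morph f mhomD mhom0). Qed.

Lemma mhom_linear : linear f.
Proof. by move=> c x y; rewrite mhomD mhomZ. Qed.

End MhomTheory.

Lemma mhom_id M : mhom (fun x : M => x). Proof. by split. Qed.

Lemma mhom_comp M N L (f : M -> N) (g : N -> L) :
  mhom f -> mhom g -> mhom (fun x => g (f x)).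
Proof. by move=> [f1 f2] [g1 g2]; split=> [x y|a x] /=; rewrite ?f1 ?f2 ?g1 ?g2. Qed.

Lemma mhom_zero M N : mhom (fun _ : M => 0 : N).
Proof. by split=> [x y|a x] /=; rewrite ?addr0 ?act0. Qed.

Lemma mhom_add M N (f g : M -> N) : mhom f -> mhom g -> mhom (fun x => f x + g x).
Proof.
by move=> fH gH; split=> [x y|a x] /=; rewrite ?(mhomD fH, mhomD gH, mhom_act fH, mhom_act gH) ?actD // addrACA.
Qed.

Lemma mhom_scale M N (f : M -> N) c : mhom f -> mhom (fun x => c *: f x).
Proof. by move=> fH; split=> [x y|a x] /=; rewrite ?(mhomD fH, mhom_act fH) ?actZr ?scalerDr. Qed.

Lemma mhom_opp M N (f : M -> N) : mhom f -> mhom (fun x => - f x).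
Proof.
move=> fH; split=> [x y|a x] /=; first by rewrite (mhomD fH) opprD.
by rewrite (mhom_act fH) -!scaleN1r actZr.
Qed.

Lemma mhom_big M N I (r : seq I) (f : I -> M -> N) :
  (forall i, mhom (f i)) -> mhom (fun x => \sum_(i <- r) f i x).
Proof.
move=> fH; split=> [x y|a x] /=.
  by rewrite -big_split; apply: eq_bigr => i _; rewrite (mhomD (fH i)).
by rewrite act_sumr; apply: eq_bigr => i _; rewrite (mhom_act (fH i)).
Qed.

Lemma mhom_inv M N (f : M -> N) g : mhom f -> cancel f g -> cancel g f -> mhom g.
Proof.
move=> fH fK gK; split=> [x y|a x] /=; apply: (can_inj fK);
  by rewrite ?(mhomD fH, mhom_act fH) !gK.
Qed.

(** Homomorphisms are handled as bare functions; this is the passage to the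
    bundled linear maps in which [iso], [projective], etc. are phrased. *)
Lemma linear_lfun (U V : vectType k) (f : U -> V) :
  linear f -> exists F : 'Hom(U, V), forall x, F x = f x.
Proof.
move=> fL; pose fl : {linear U -> V} := HB.pack f (GRing.isLinear.Build k U V *:%R f fL).
by exists (linfun fl) => x; rewrite (lfunE fl).
Qed.

Lemma mhom_lfun M N (f : M -> N) :
  mhom f -> exists F : 'Hom(M, N), is_hom F /\ forall x, F x = f x.
Proof.
move=> fH; have [F FE] := linear_lfun (mhom_linear fH).
by exists F; split=> // a x; rewrite !FE (mhom_act fH).
Qed.

Lemma is_hom_mhom M N (F : 'Hom(M, N)) : is_hom F -> mhom F.
Proof. by move=> FH; split=> // x y; rewrite linearD. Qed.

Lemma surjP M N (F : 'Hom(M, N)) : surj F <-> forall y, exists x, F x = y.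
Proof.
split=> [FS y|FS].
  have : y \in limg F by rewrite FS memvf.
  by case/memv_imgP => x _ ->; exists x.
apply/eqP; rewrite eqEsubv subvf; apply/subvP => y _.
by have [x <-] := FS y; rewrite memv_img // memvf.
Qed.

Lemma isoP M N : iso M N <->
  exists f g, [/\ @mhom M N f, mhom g, cancel f g & cancel g f].
Proof.
split=> [[F [FH /eqP F0 FS]]|[f [g [fH gH fK gK]]]].
  have fK := lker0_lfunK F0; have gK : cancel (F^-1)%VF F.
    by move=> y; have [x <-] := (surjP F).1 FS y; rewrite fK.
  by exists F, (F^-1)%VF; split=> //;
    [apply: is_hom_mhom | apply: (mhom_inv (is_hom_mhom FH))].
have [F [FH FE]] := mhom_lfun fH; exists F; split=> //.
  by apply/eqP/lker0P => x y; rewrite !FE => /(can_inj fK).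
by apply/surjP => y; exists (g y); rewrite FE gK.
Qed.

Lemma iso_of M N (f : M -> N) g : mhom f -> cancel f g -> cancel g f -> iso M N.
Proof. by move=> fH fK gK; apply/isoP; exists f, g; split=> //; exact: mhom_inv fK gK. Qed.

Lemma iso_refl M : iso M M.
Proof. exact: (iso_of (mhom_id M) (g := id)). Qed.

Lemma iso_sym M N : iso M N -> iso N M.
Proof. by case/isoP => f [g [fH gH fK gK]]; exact: (iso_of gH gK fK). Qed.

Lemma iso_trans M N L : iso M N -> iso N L -> iso M L.
Proof.
case/isoP => f [g [fH gH fK gK]] /isoP[f' [g' [fH' gH' fK' gK']]].
by apply: (iso_of (mhom_comp fH fH') (g := fun z => g (g' z))) => x; rewrite ?(fK', gK, fK, gK').
Qed.

Lemma iso_dim M N : iso M N -> \dim {:M} = \dim {:N}.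
Proof.
case=> F [_ F0 FS]; rewrite -FS limg_dim_eq // F0; exact: capv0.
Qed.

Lemma is_zeroP M : is_zero M <-> forall x : M, x = 0.
Proof.
rewrite /is_zero; split=> [/eqP|M0].
  by rewrite dimv_eq0 => /eqP M0 x; apply/eqP; rewrite -memv0 -M0 memvf.
apply/eqP; rewrite dimv_eq0 -subv0; apply/subvP => x _; by rewrite (M0 x) mem0v.
Qed.

Lemma is_zero_iso M N : iso M N -> is_zero M -> is_zero N.
Proof. by move=> /iso_dim e; rewrite /is_zero -e. Qed.

Lemma zero_iso M : is_zero M -> iso M (zero_mod A).
Proof.
move/is_zeroP => M0.
apply: (iso_of (f := fun _ => 0) (g := fun _ => 0)); first exact: mhom_zero.
  by move=> x; rewrite (M0 x).
by move=> x; rewrite [x]thinmx0.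
Qed.

Lemma zero_mod_zero : is_zero (zero_mod A).
Proof. by apply/is_zeroP => x; rewrite [x]thinmx0. Qed.

(** ** Direct sums and retracts *)

Lemma mhom_fst M N : @mhom (dsum M N) M fst. Proof. by split. Qed.
Lemma mhom_snd M N : @mhom (dsum M N) N snd. Proof. by split. Qed.
Lemma mhom_inl M N : @mhom M (dsum M N) (fun x => (x, 0)).
Proof.
split=> [x y|a x]; apply/eqP; rewrite -pair_eqE /= ?addr0 !eqxx //.
by rewrite act0 eqxx.
Qed.
Lemma mhom_inr M N : @mhom N (dsum M N) (fun x => (0, x)).
Proof.
split=> [x y|a x]; apply/eqP; rewrite -pair_eqE /= ?addr0 !eqxx //.
by rewrite act0 eqxx.
Qed.
Lemma mhom_pair L M N (f : L -> M) (g : L -> N) :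
  mhom f -> mhom g -> @mhom L (dsum M N) (fun x => (f x, g x)).
Proof.
move=> fH gH; split=> [x y|a x] /=; first by rewrite (mhomD fH) (mhomD gH).
by rewrite (mhom_act fH) (mhom_act gH).
Qed.

Lemma dsum_pairE M N (z : dsum M N) : z = (z.1, 0) + (0, z.2) :> dsum M N.
Proof. by case: z => x y; apply/eqP; rewrite -pair_eqE /= addr0 add0r !eqxx. Qed.

Lemma dsum_iso M M' N N' : iso M M' -> iso N N' -> iso (dsum M N) (dsum M' N').
Proof.
case/isoP => f [g [fH gH fK gK]] /isoP[f' [g' [fH' gH' fK' gK']]].
apply: (iso_of (f := fun z : dsum M N => (f z.1, f' z.2) : dsum M' N')
               (g := fun z : dsum M' N' => (g z.1, g' z.2) : dsum M N)).
- by apply: mhom_pair; [apply: (mhom_comp (@mhom_fst M N)) | apply: (mhom_comp (@mhom_snd M N))].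
- by case=> x y /=; rewrite fK fK'.
- by case=> x y /=; rewrite gK gK'.
Qed.

Lemma dsumC M N : iso (dsum M N) (dsum N M).
Proof.
apply: (iso_of (f := fun z : dsum M N => (z.2, z.1) : dsum N M)
               (g := fun z : dsum N M => (z.2, z.1) : dsum M N)) => [|[]|[]] //.
Qed.

Lemma dsum0r M N : is_zero N -> iso (dsum M N) M.
Proof.
move/is_zeroP => N0; apply: (iso_of (@mhom_fst M N) (g := (fun x => (x, 0)) : M -> dsum M N)) => //.
by case=> x y /=; rewrite (N0 y).
Qed.

Lemma dim_dsum M N : \dim {:dsum M N} = (\dim {:M} + \dim {:N})%N.
Proof. by rewrite !dimvf. Qed.

Definition retract Z M : Prop :=
  exists (i : Z -> M) (r : M -> Z), [/\ mhom i, mhom r & cancel i r].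

Lemma retract_refl M : retract M M. Proof. by exists id, id. Qed.

Lemma retract_trans X Y Z : retract X Y -> retract Y Z -> retract X Z.
Proof.
move=> [i [r [iH rH K]]] [i' [r' [iH' rH' K']]].
exists (fun x => i' (i x)), (fun x => r (r' x)).
by split; [exact: mhom_comp iH iH' | exact: mhom_comp rH' rH | move=> x; rewrite K' K].
Qed.

Lemma iso_retract M N : iso M N -> retract M N.
Proof. by case/isoP => f [g [fH gH fK gK]]; exists f, g. Qed.

Lemma retract_dsuml M N : retract M (dsum M N).
Proof. by exists (fun x => (x, 0) : dsum M N), fst; split=> //; exact: mhom_inl. Qed.

Lemma retract_dsumr M N : retract N (dsum M N).
Proof. by exists (fun x => (0, x) : dsum M N), snd; split=> //; exact: mhom_inr. Qed.

Lemma summand_retract N M : summand N M -> retract N M.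
Proof.
by case=> L /iso_sym /iso_retract; apply: retract_trans; exact: retract_dsuml.
Qed.

Lemma retract_zero Z M : retract Z M -> is_zero M -> is_zero Z.
Proof.
case=> i [r [iH rH K]] /is_zeroP M0; apply/is_zeroP => x.
by rewrite -(K x) (M0 (i x)) (mhom0 rH).
Qed.

(** ** Submodules, cokernels and free modules *)

Section Submod.
Variables (M : fdmod A) (U : {vspace M}).
Hypothesis hU : forall a x, x \in U -> act a x \in U.

Let sact (a : A) (x : subvs_of U) : subvs_of U := vsproj U (act a (vsval x)).

Lemma sactE a x : vsval (sact a x) = act a (vsval x).
Proof. by rewrite vsprojK // hU // subvsP. Qed.

Lemma sact_linear_l x : linear (sact^~ x).
Proof.
by move=> c a b; apply: subvs_inj; rewrite vsval_is_linear !sactE act_linear_l.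
Qed.

Lemma sact_linear_r a : linear (sact a).
Proof.
move=> c x y; apply: subvs_inj.
by rewrite vsval_is_linear !sactE vsval_is_linear act_linear_r.
Qed.

Lemma sact1 x : sact 1 x = x.
Proof. by apply: subvs_inj; rewrite sactE act1. Qed.

Lemma sactM a b x : sact (a * b) x = sact a (sact b x).
Proof. by apply: subvs_inj; rewrite !sactE actM. Qed.

Definition submod : fdmod A :=
  @FdMod k A (subvs_of U) sact sact_linear_l sact_linear_r sact1 sactM.

Lemma submod_val : @mhom submod M vsval.
Proof. by split=> [x y|a x]; [rewrite linearD | rewrite /= sactE]. Qed.

End Submod.

Section Quotmod.
Variables (M : fdmod A) (U : {vspace M}).
Hypothesis hU : forall a x, x \in U -> act a x \in U.

Let q : 'End(M) := (\1 - projv U)%VF.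
Let W := limg q.

Let qE x : q x = x - projv U x.
Proof. by rewrite add_lfunE opp_lfunE id_lfunE. Qed.

Let q_ker x : x \in U -> q x = 0.
Proof. by move=> xU; rewrite qE projv_id // subrr. Qed.

Let q_eq x y : x - y \in U -> q x = q y.
Proof. by move/q_ker; rewrite linearB => /eqP; rewrite subr_eq0 => /eqP. Qed.

Let q_in x : q x \in W. Proof. exact: memv_img (memvf _). Qed.

Let q_sub x : q x - x \in U.
Proof. by rewrite qE addrAC subrr sub0r memvN memv_proj. Qed.

Let qq x : q (q x) = q x. Proof. exact/q_eq/q_sub. Qed.

Let q_act a x : q (act a (q x)) = q (act a x).
Proof. by apply: q_eq; rewrite -actB hU // q_sub. Qed.

Let q_val (x : subvs_of W) : q (vsval x) = vsval x.
Proof. by have /memv_imgP[y _ ->] := subvsP x; rewrite qq. Qed.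

Let qact (a : A) (x : subvs_of W) : subvs_of W := vsproj W (q (act a (vsval x))).

Lemma qactE a x : vsval (qact a x) = q (act a (vsval x)).
Proof. by rewrite vsprojK // q_in. Qed.

Lemma qact_linear_l x : linear (qact^~ x).
Proof.
move=> c a b; apply: subvs_inj.
by rewrite vsval_is_linear !qactE act_linear_l linearP.
Qed.

Lemma qact_linear_r a : linear (qact a).
Proof.
move=> c x y; apply: subvs_inj.
by rewrite vsval_is_linear !qactE vsval_is_linear act_linear_r linearP.
Qed.

Lemma qact1 x : qact 1 x = x.
Proof. by apply: subvs_inj; rewrite qactE act1 q_val. Qed.

Lemma qactM a b x : qact (a * b) x = qact a (qact b x).
Proof. by apply: subvs_inj; rewrite !qactE q_act actM. Qed.

Definition quotmod : fdmod A :=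
  @FdMod k A (subvs_of W) qact qact_linear_l qact_linear_r qact1 qactM.

Definition quotproj (x : M) : quotmod := vsproj W (q x).

Lemma quotproj_mhom : mhom quotproj.
Proof.
split=> [x y|a x]; apply: subvs_inj; first by rewrite /quotproj !linearD.
by rewrite qactE !vsprojK ?q_in // q_act.
Qed.

Lemma quotproj_surj y : exists x, quotproj x = y.
Proof. by exists (vsval y); apply: subvs_inj; rewrite vsprojK ?q_in // q_val. Qed.

Lemma quotproj_ker x : quotproj x = 0 <-> x \in U.
Proof.
split=> [/(congr1 vsval)|xU]; last by rewrite /quotproj q_ker // linear0.
rewrite vsprojK ?q_in // => q0; have := q_sub x.
by rewrite q0 sub0r memvN.
Qed.

End Quotmod.

Lemma coker_exists M N (f : M -> N) : mhom f ->
  exists (C : fdmod A) (c : N -> C), [/\ mhom c, forall y, exists x, c x = y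
    & forall x, c x = 0 <-> exists z, x = f z].
Proof.
move=> /mhom_lfun [F [FH FE]].
have hU : forall a x, x \in limg F -> act a x \in limg F.
  by move=> a x /memv_imgP[y _ ->]; rewrite -FH memv_img ?memvf.
exists (quotmod hU), (quotproj hU); split.
- exact: quotproj_mhom.
- exact: quotproj_surj.
- move=> x; rewrite quotproj_ker; split=> [/memv_imgP[z _ ->]|[z ->]].
    by exists z; rewrite FE.
  by rewrite -FE memv_img ?memvf.
Qed.

Lemma factor_surj M N L (c : M -> N) (d : M -> L) : mhom c -> mhom d ->
  (forall y, exists x, c x = y) -> (forall x, c x = 0 -> d x = 0) ->
  exists u : N -> L, mhom u /\ forall x, u (c x) = d x.
Proof.
move=> cH dH cS cd; have [F [FH FE]] := mhom_lfun cH.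
have FK y : c ((F^-1)%VF y) = y.
  by rewrite -FE limg_lfunVK // (surjP F).2 ?memvf // => z;
    have [x <-] := cS z; exists x.
have uE x : d ((F^-1)%VF (c x)) = d x.
  by apply/eqP; rewrite -subr_eq0 -(mhomB dH) cd // (mhomB cH) FK subrr.
exists (fun y => d ((F^-1)%VF y)); split=> //; split=> [x y|a x].
  by rewrite -(mhomD dH) linearD.
by rewrite -(mhom_act dH) -[in LHS](FK x) -(mhom_act cH) uE.
Qed.

Section FreeModule.
Variable n : nat.

Definition free_act (a : A) (x : {ffun 'I_n -> A}) : {ffun 'I_n -> A} :=
  [ffun q => a * x q].

Lemma free_linear_l x : linear (free_act^~ x).
Proof. by move=> c a b; apply/ffunP => q; rewrite !ffunE mulrDl scalerAl. Qed.
Lemma free_linear_r a : linear (free_act a).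
Proof. by move=> c x y; apply/ffunP => q; rewrite !ffunE mulrDr scalerAr. Qed.
Lemma free_act1 x : free_act 1 x = x.
Proof. by apply/ffunP => q; rewrite !ffunE mul1r. Qed.
Lemma free_actM a b x : free_act (a * b) x = free_act a (free_act b x).
Proof. by apply/ffunP => q; rewrite !ffunE mulrA. Qed.

Definition free_mod : fdmod A :=
  @FdMod k A {ffun 'I_n -> A} free_act free_linear_l free_linear_r free_act1 free_actM.

Definition free_map M (x : 'I_n -> M) (c : free_mod) : M := \sum_q act (c q) (x q).

Lemma free_map_mhom M (x : 'I_n -> M) : mhom (free_map x).
Proof.
split=> [c d|a c]; rewrite /free_map.
  by rewrite -big_split; apply: eq_bigr => q _; rewrite /= ffunE actDl.
by rewrite act_sumr; apply: eq_bigr => q _; rewrite /= ffunE actM.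
Qed.

End FreeModule.
End Homs.

(** * Krull-Schmidt theory *)

Section KrullSchmidt.
Variables (k : fieldType) (A : falgType k).
Implicit Types M N L X Y Z P : fdmod A.

Lemma mhom_bij M N (f : M -> N) : mhom f -> injective f ->
  (forall y, exists x, f x = y) -> bijective f.
Proof.
move=> /mhom_lfun [F [FH FE]] fI fS.
have F0 : lker F == 0%VS by apply/lker0P => x y; rewrite !FE => /fI.
exists (F^-1)%VF => [x|y]; first by rewrite -FE lker0_lfunK.
by have [x <-] := fS y; rewrite -!FE lker0_lfunK.
Qed.

Lemma mhom_injP M N (f : M -> N) : mhom f ->
  (forall x, f x = 0 -> x = 0) -> injective f.
Proof.
move=> fH f0 x y e; apply/eqP; rewrite -subr_eq0; apply/eqP/f0.
by rewrite (mhomB fH) e subrr.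
Qed.

Lemma bij_iso M N (f : M -> N) : mhom f -> bijective f -> iso M N.
Proof. by move=> fH [g fK gK]; exact: (iso_of fH fK gK). Qed.

Lemma endo_inj_bij M (f : M -> M) : mhom f -> injective f -> bijective f.
Proof.
move=> fH fI; apply: mhom_bij => // y.
have [F [FH FE]] := mhom_lfun fH.
have F0 : lker F == 0%VS by apply/lker0P => x z; rewrite !FE => /fI.
by exists ((F^-1)%VF y); rewrite -FE lker0_lfunVK.
Qed.

Lemma retract_iso_dsum Z M : retract Z M -> exists L, iso M (dsum Z L).
Proof.
case=> i [r [iH rH K]]; have [R [RH RE]] := mhom_lfun rH.
have hU a x : x \in lker R -> act a x \in lker R.
  by rewrite !memv_ker !RE (mhom_act rH) => /eqP ->; rewrite act0.
exists (submod hU); apply: iso_sym.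
pose f (z : dsum Z (submod hU)) : M := i z.1 + vsval z.2.
have fH : mhom f.
  apply: mhom_add; first exact: mhom_comp (@mhom_fst _ _ _ _) iH.
  exact: mhom_comp (@mhom_snd _ _ _ _) (submod_val hU).
have r0 (w : submod hU) : r (vsval w) = 0.
  by have := subvsP w; rewrite memv_ker RE => /eqP.
apply: (bij_iso fH); apply: mhom_bij => //.
  apply: (mhom_injP fH) => -[z w] /= e.
  have z0 : z = 0 by rewrite -(K z) -[i z](addrK (vsval w)) [i z + _]e sub0r (mhomN rH) r0 oppr0.
  move: e; rewrite /f /= z0 (mhom0 iH) add0r => w0.
  by congr pair; apply: subvs_inj.
move=> y; have h : y - i (r y) \in lker R.
  by rewrite memv_ker RE (mhomB rH) K subrr.
by exists (r y, Subvs h); rewrite /f /= addrC subrK.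
Qed.

Lemma retract_summand Z M : retract Z M -> summand Z M.
Proof. exact: retract_iso_dsum. Qed.

Lemma retract_of_bij Z N (a : Z -> N) (b : N -> Z) : mhom a -> mhom b ->
  bijective (fun z => b (a z)) -> retract Z N.
Proof.
move=> aH bH [w wK Kw]; exists a, (fun x => w (b x)); split=> //.
exact: mhom_comp bH (mhom_inv (mhom_comp aH bH) wK Kw).
Qed.

Lemma indecomposable_iso X Y : iso X Y -> indecomposable X -> indecomposable Y.
Proof.
move=> e [X0 Xi]; split=> [Y0|U V e']; first exact: X0 (is_zero_iso (iso_sym e) Y0).
exact: Xi (iso_trans e e').
Qed.

Lemma retract_indecomposable X Z : indecomposable X -> ~ is_zero Z ->
  retract Z X -> iso Z X.
Proof.
move=> [_ Xi] Z0 /retract_iso_dsum[L e]; case: (Xi _ _ e) => // L0.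
exact: iso_sym (iso_trans e (dsum0r _ L0)).
Qed.

(** Fitting's lemma: the images of the powers of [u] become stationary, and then
    kernel and image of that power are complementary submodules. *)
Lemma fitting Z (u : Z -> Z) : indecomposable Z -> mhom u ->
  bijective u \/ exists n, forall z, iter n u z = 0.
Proof.
move=> [Z0 Zi] uH; have [F [FH FE]] := mhom_lfun uH.
pose V n := iter n (fun W => (F @: W)%VS) fullv.
have VP n y : reflect (exists x, y = iter n u x) (y \in V n).
  apply: (iffP idP) => [|[x ->]].
    elim: n y => [|n IH] y /= => [_|]; first by exists y.
    by case/memv_imgP => w /IH[x ->] ->; exists x; rewrite FE.
  elim: n x => [|n IH] x /=; first exact: memvf.
  by rewrite -FE memv_img.
have Vsub n : (V n.+1 <= V n)%VS.
  by apply/subvP => y /VP[x ->]; rewrite iterSr; apply/VP; exists (u x).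
have [n Vn] : exists n, V n.+1 = V n.
  apply: NNPP => h.
  have bound n : (\dim (V n) + n <= \dim {:Z})%N.
    elim: n => [|n IH]; first by rewrite addn0.
    apply: leq_trans IH; rewrite addnS ltn_add2r ltn_neqAle dimvS // andbT.
    by apply/negP => e; apply: h; exists n; apply/eqP; rewrite eqEdim Vsub (eqP e) leqnn.
  by have := leq_trans (leq_addl _ _) (bound (\dim {:Z}).+1); rewrite ltnn.
have Vst m : V (m + n)%N = V n.
  elim: m => // m IH; rewrite addSn -[LHS]/(F @: V (m + n)%N)%VS IH; exact: Vn.
pose N := n.+1.
have GH : mhom (iter N u).
  elim: N => [|m IH]; first exact: mhom_id.
  exact: (mhom_comp IH uH).
have [G [GHo GE]] := mhom_lfun GH.
have im2 x : exists z, iter N u x = iter N u (iter N u z).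
  have : iter N u x \in V (N + N)%N.
    by rewrite {2}/N addnS -addSn Vst -[V n](Vst 1); apply/VP; exists x.
  by case/VP => z; rewrite iterD => ->; exists z.
have GimE : (G @: limg G)%VS = limg G.
  apply/eqP; rewrite eqEsubv limgS ?subvf //=; apply/subvP => y /memv_imgP[x _ ->].
  have [z] := im2 x; rewrite GE => ->.
  by rewrite -!GE memv_img // memv_img // memvf.
have cap0 : (limg G :&: lker G = 0)%VS.
  apply/eqP; rewrite -dimv_eq0.
  by have := limg_ker_dim G (limg G); rewrite GimE => /eqP; rewrite -[X in _ == X]add0n eqn_add2r.
have hK a x : x \in lker G -> act a x \in lker G.
  by rewrite !memv_ker !GE (mhom_act GH) => /eqP ->; rewrite act0.
have hI a x : x \in limg G -> act a x \in limg G.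
  by case/memv_imgP => y _ ->; rewrite -GHo memv_img // memvf.
pose f (z : dsum (submod hK) (submod hI)) : Z := vsval z.1 + vsval z.2.
have fH : mhom f.
  apply: mhom_add; first exact: mhom_comp (@mhom_fst _ _ _ _) (submod_val hK).
  exact: mhom_comp (@mhom_snd _ _ _ _) (submod_val hI).
have e : iso Z (dsum (submod hK) (submod hI)).
  apply: iso_sym; apply: (bij_iso fH); apply: mhom_bij => //.
    apply: (mhom_injP fH) => -[a b] /eqP; rewrite /f /= addr_eq0 => /eqP e.
    have : vsval b \in (limg G :&: lker G)%VS.
      by rewrite memv_cap subvsP -[vsval b]opprK -e memvN subvsP.
    rewrite cap0 memv0 => /eqP b0; move: e; rewrite b0 oppr0 => a0.
    by congr pair; apply: subvs_inj.
  move=> y; have [z ez] := im2 y.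
  have hy : y - iter N u z \in lker G by rewrite memv_ker GE (mhomB GH) ez subrr.
  have hz : iter N u z \in limg G by rewrite -GE memv_img // memvf.
  by exists (Subvs hy, Subvs hz); rewrite /f /= subrK.
case: (Zi _ _ e) => /is_zeroP h; [left | right].
  apply: endo_inj_bij => //; apply: (mhom_injP uH) => x ux.
  have hx : x \in lker G.
    rewrite memv_ker GE /N iterSr ux; elim: (n) => //= m IH.
    by move: IH => /eqP ->; rewrite (mhom0 uH).
  exact: (congr1 vsval (h (Subvs hx))).
exists N => z; have hz : iter N u z \in limg G by rewrite -GE memv_img // memvf.
exact: (congr1 vsval (h (Subvs hz))).
Qed.

Lemma local_endo Z (p q : Z -> Z) : indecomposable Z -> mhom p -> mhom q ->
  (forall z, p z + q z = z) -> bijective p \/ bijective q.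
Proof.
move=> Zi pH qH pq; case: (fitting Zi pH) => [|[n p0]]; [by left | right].
apply: endo_inj_bij => //; apply: (mhom_injP qH) => z qz.
have pz : p z = z by have := pq z; rewrite qz addr0.
by rewrite -(p0 z); elim: n {p0} => //= n <-.
Qed.

(** The endomorphism ring of an indecomposable module is local, so one term of a
    decomposition of the identity is invertible. *)
Lemma local_endo_sum Z n (u : 'I_n -> Z -> Z) : indecomposable Z ->
  (forall i, mhom (u i)) -> (forall z, \sum_i u i z = z) -> exists i, bijective (u i).
Proof.
move=> Zi uH uS.
suff h : forall n (u : 'I_n -> Z -> Z) v, (forall i, mhom (u i)) -> mhom v ->
    bijective v -> (forall z, \sum_i u i z = v z) -> exists i, bijective (u i).
  by apply: (h n u id) => //; exists id.
move=> {n u uH uS} n; elim: n => [|n IH] u v uH vH vB uS.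
  case: Zi => Z0 _; case: Z0; apply/is_zeroP => x; apply: (bij_inj vB).
  by rewrite -!uS !big_ord0.
case: (vB) => w vK wK; have wH := mhom_inv vH vK wK.
have rH : mhom (fun z => \sum_(i < n) u (lift ord0 i) z) by exact: mhom_big.
case: (@local_endo Z (fun z => w (u ord0 z)) (fun z => w (\sum_(i < n) u (lift ord0 i) z)) Zi).
- exact: mhom_comp wH.
- exact: mhom_comp wH.
- by move=> z; rewrite -(mhomD wH) -[RHS]vK -uS big_ord_recl.
- move=> b; exists ord0; apply: (eq_bij (bij_comp vB b)) => z /=; exact: wK.
- move=> b; have [] := IH _ (fun z => \sum_(i < n) u (lift ord0 i) z) (fun i => uH (lift ord0 i)) rH.
  + by apply: (eq_bij (bij_comp vB b)) => z /=; exact: wK.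
  + by [].
  + by move=> i ib; exists (lift ord0 i).
Qed.

Lemma retract_dsum Z M N : indecomposable Z -> retract Z (dsum M N) ->
  retract Z M \/ retract Z N.
Proof.
move=> Zi [i [r [iH rH K]]].
have i1 : mhom (fun z => (i z).1) by exact: mhom_comp iH (@mhom_fst _ _ _ _).
have i2 : mhom (fun z => (i z).2) by exact: mhom_comp iH (@mhom_snd _ _ _ _).
have r1 : mhom (fun x : M => r (x, 0)) by exact: mhom_comp (@mhom_inl _ _ _ _) rH.
have r2 : mhom (fun x : N => r (0, x)) by exact: mhom_comp (@mhom_inr _ _ _ _) rH.
case: (local_endo Zi (mhom_comp i1 r1) (mhom_comp i2 r2)) => [z|b|b].
- by rewrite -(mhomD rH) -dsum_pairE K.
- by left; exact: (retract_of_bij i1 r1 b).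
- by right; exact: (retract_of_bij i2 r2 b).
Qed.

Definition bigsum n (s : 'I_n -> fdmod A) : fdmod A := \big[@dsum k A/zero_mod A]_(i < n) s i.

Lemma bigsum_recl n (s : 'I_n.+1 -> fdmod A) :
  bigsum s = dsum (s ord0) (bigsum (fun i => s (lift ord0 i))).
Proof. exact: big_ord_recl. Qed.

Lemma bigsum0 (s : 'I_0 -> fdmod A) : bigsum s = zero_mod A.
Proof. exact: big_ord0. Qed.

Lemma retract_bigsum Z n (s : 'I_n -> fdmod A) : indecomposable Z ->
  retract Z (bigsum s) -> exists i, retract Z (s i).
Proof.
move=> Zi; elim: n s => [|n IH] s.
  by rewrite bigsum0 => /retract_zero /(_ (@zero_mod_zero _ _)) /Zi.1.
rewrite bigsum_recl => /(retract_dsum Zi)[|/IH[i]]; first by exists ord0.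
by exists (lift ord0 i).
Qed.

Lemma bigsum_retract n (s : 'I_n -> fdmod A) i : retract (s i) (bigsum s).
Proof.
elim: n s i => [|n IH] s i; first by case: i.
rewrite bigsum_recl; case: (unliftP ord0 i) => [j ->|->]; last exact: retract_dsuml.
exact: retract_trans (IH (fun i => s (lift ord0 i)) j) (retract_dsumr _ _).
Qed.

Lemma dim_bigsum n (s : 'I_n -> fdmod A) : \dim {:bigsum s} = (\sum_i \dim {:s i})%N.
Proof.
elim: n s => [|n IH] s; first by rewrite bigsum0 big_ord0 (@zero_mod_zero k A).
by rewrite bigsum_recl dim_dsum IH big_ord_recl.
Qed.

Lemma dim_gt0 M : ~ is_zero M -> (0 < \dim {:M})%N.
Proof. by move=> h; rewrite lt0n; apply/eqP. Qed.

Lemma indecomposable_retract M : ~ is_zero M ->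
  exists X, indecomposable X /\ retract X M.
Proof.
move: {2}(\dim _) (leqnn (\dim {:M})) => d; elim: d M => [|d IH] M le M0.
  by move: (dim_gt0 M0); rewrite ltnNge le.
case: (classic (indecomposable M)) => Mi; first by exists M; split=> //; exact: retract_refl.
have [X [Y [e X0 Y0]]] : exists X Y, [/\ iso M (dsum X Y), ~ is_zero X & ~ is_zero Y].
  apply: NNPP => h; apply: Mi; split=> // X Y e.
  case: (classic (is_zero X)) => X0; first by left.
  case: (classic (is_zero Y)) => Y0; first by right.
  by case: h; exists X, Y.
have [|Z [Zi ZX]] := IH X _ X0.
  rewrite -ltnS; apply: leq_trans le; rewrite (iso_dim e) dim_dsum.
  by rewrite -[X in (X < _)%N]addn0 ltn_add2l dim_gt0.
exists Z; split=> //; apply: retract_trans ZX _.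
exact: retract_trans (retract_dsuml X Y) (iso_retract (iso_sym e)).
Qed.

Lemma decomposition_exists M : exists n (s : 'I_n -> fdmod A), decomposition M s.
Proof.
move: {2}(\dim _) (leqnn (\dim {:M})) => d; elim: d M => [|d IH] M le.
  exists 0%N, (fun _ => M); split=> [[]//|].
  rewrite -/(bigsum _) bigsum0; apply: zero_iso; apply/eqP; by rewrite -leqn0.
case: (classic (is_zero M)) => M0; first by apply: IH; rewrite M0.
have [X [Xi /retract_iso_dsum[L e]]] := indecomposable_retract M0.
have [|n [s [si es]]] := IH L.
  rewrite -ltnS; apply: leq_trans le; rewrite (iso_dim e) dim_dsum.
  by rewrite -[X in (X < _)%N]add0n ltn_add2r dim_gt0 //; exact: Xi.1.
exists n.+1, (fun i => oapp s X (unlift ord0 i)); split=> [i|].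
  by case: (unlift _ _) => [j|] //=.
rewrite -/(bigsum _) bigsum_recl unlift_none /=.
apply: iso_trans e _; apply: dsum_iso; first exact: iso_refl.
apply: iso_trans es _; rewrite /bigsum.
have -> : \big[@dsum k A/zero_mod A]_(i < n) oapp s X (unlift ord0 (lift ord0 i)) =
          \big[@dsum k A/zero_mod A]_(i < n) s i.
  by apply: eq_bigr => i _; rewrite liftK.
exact: iso_refl.
Qed.

Lemma bigsum_ind (Phi : fdmod A -> Prop) n (s : 'I_n -> fdmod A) :
  Phi (zero_mod A) -> (forall M N, Phi M -> Phi N -> Phi (dsum M N)) ->
  (forall i, Phi (s i)) -> Phi (bigsum s).
Proof. by move=> h0 hD hs; rewrite /bigsum; elim/big_ind: _ => // i _. Qed.

Lemma add_ind (Phi : fdmod A -> Prop) N :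
  (forall X Y, iso X Y -> Phi X -> Phi Y) -> Phi (zero_mod A) ->
  (forall X Y, Phi X -> Phi Y -> Phi (dsum X Y)) ->
  (forall Z, indecomposable Z -> retract Z N -> Phi Z) -> Phi N.
Proof.
move=> hi h0 hD hZ; have [n [s [si e]]] := decomposition_exists N.
apply: hi (iso_sym e) _; apply: bigsum_ind => // i; apply: hZ => //.
exact: retract_trans (bigsum_retract s i) (iso_retract (iso_sym e)).
Qed.

(** If another decomposition repeated a class, this one would inject into it
    missing a term, and the dimensions would disagree. *)
Lemma decomposition_basic M n (s : 'I_n -> fdmod A) : decomposition M s ->
  (forall i j, iso (s i) (s j) -> i = j) -> basic M.
Proof.
move=> [si e] sI n' s' [si' e'] i j ij; apply: NNPP => nij.
have matched l : exists l', iso (s l) (s' l') /\ l' <> j.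
  have /(retract_bigsum (si l))[l' /(retract_indecomposable (si' l') (si l).1) h] :
      retract (s l) (bigsum s').
    apply: retract_trans (bigsum_retract s l) _.
    exact: iso_retract (iso_trans (iso_sym e) e').
  case: (l' =P j) => [lj|]; last by exists l'.
  exists i; split=> //; apply: iso_trans h _; rewrite lj; exact: iso_sym.
have [phi hphi] := fin_all_exists matched.
have phiI : injective phi.
  move=> a b ab; apply: sI; apply: iso_trans (hphi a).1 _; rewrite ab.
  exact: iso_sym (hphi b).1.
have : (\dim {:M} < \dim {:M})%N.
  rewrite {1}(iso_dim e) dim_bigsum (iso_dim e') dim_bigsum.
  rewrite (bigD1 j) //= -[X in (X < _)%N]add0n -addSn.
  apply: leq_add; first by rewrite dim_gt0 //; exact: (si' j).1.
  under eq_bigr => l _ do rewrite (iso_dim (hphi l).1).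
  rewrite -(big_imset (h := phi) (fun l => \dim {:s' l}) (in2W phiI)) /=.
  rewrite big_mkcond [X in (_ <= X)%N]big_mkcond /=; apply: leq_sum => l _.
  case: ifP => // /imsetP[a _ ->]; case: eqP => // ea; by case: (hphi a).2.
by rewrite ltnn.
Qed.

Lemma decomposition_num M n (s : 'I_n -> fdmod A) : decomposition M s ->
  (forall i j, iso (s i) (s j) -> i = j) -> num_summands M n.
Proof.
move=> [si e] sI; exists s; split=> // [i|X Xi /summand_retract XM].
  split=> //; apply: retract_summand.
  exact: retract_trans (bigsum_retract s i) (iso_retract (iso_sym e)).
have [i ri] := retract_bigsum Xi (retract_trans XM (iso_retract e)).
by exists i; apply: retract_indecomposable (Xi.1) ri; exact: si.
Qed.

Lemma num_summands_le M n n' : num_summands M n -> num_summands M n' -> (n <= n')%N.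
Proof.
move=> [s [hs sI _]] [s' [_ _ h']].
have [phi hphi] := fin_all_exists (fun i => h' (s i) (hs i).1 (hs i).2).
rewrite -[n]card_ord -[n']card_ord; apply: (leq_card phi) => a b ab.
by apply: sI; apply: iso_trans (hphi a) _; rewrite ab; exact: iso_sym.
Qed.

Lemma num_summands_uniq M n n' : num_summands M n -> num_summands M n' -> n = n'.
Proof. by move=> h h'; apply/eqP; rewrite eqn_leq !(@num_summands_le M). Qed.

Lemma basic_decomposition M n : basic M -> num_summands M n ->
  exists s : 'I_n -> fdmod A, decomposition M s /\ forall i j, iso (s i) (s j) -> i = j.
Proof.
move=> Mb Mn; have [n' [s ds]] := decomposition_exists M.
have sI := Mb _ _ ds.
by rewrite (num_summands_uniq Mn (decomposition_num ds sI)); exists s.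
Qed.

End KrullSchmidt.

(** * The translate and lifting along presentations *)

Section Projective.
Variables (k : fieldType) (A : falgType k).
Implicit Types M N L X Y Z P : fdmod A.

Lemma projectiveP P : projective P <->
  forall X Y (g : X -> Y) (f : P -> Y), mhom g -> (forall y, exists x, g x = y) ->
    mhom f -> exists h : P -> X, mhom h /\ forall x, g (h x) = f x.
Proof.
split=> [Pp X Y g f gH gS fH|h X Y g f gH gS fH].
  have [G [GH GE]] := mhom_lfun gH; have [F [FH FE]] := mhom_lfun fH.
  have GS : surj G by apply/surjP => y; have [x <-] := gS y; exists x; rewrite GE.
  have [H [HH HE]] := Pp X Y G F GH GS FH; exists H; split; first exact: is_hom_mhom.
  by move=> x; rewrite -GE -FE -HE comp_lfunE.
have [u [uH uE]] := h X Y g f (is_hom_mhom gH) ((surjP g).1 gS) (is_hom_mhom fH).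
have [U [UH UE]] := mhom_lfun uH; exists U; split=> //.
by apply/lfunP => x; rewrite comp_lfunE UE uE.
Qed.

Lemma projective_retract P Q : projective P -> retract Q P -> projective Q.
Proof.
move/projectiveP => Pp [i [r [iH rH K]]]; apply/projectiveP => X Y g f gH gS fH.
have [h [hH hE]] := Pp X Y g _ gH gS (mhom_comp rH fH).
by exists (fun x => h (i x)); split=> [|x]; [exact: mhom_comp iH hH | rewrite hE K].
Qed.

Lemma projective_zero P : is_zero P -> projective P.
Proof.
move=> /is_zeroP P0; apply/projectiveP => X Y g f gH gS fH.
exists (fun _ => 0); split=> [|x]; first exact: mhom_zero.
by rewrite (P0 x) (mhom0 gH) (mhom0 fH).
Qed.

Lemma regular_gen M (m : M) : mhom (fun a : regular A => act a m).
Proof. by split=> [a b|a b]; rewrite ?actDl ?actM. Qed.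

Lemma projective_regular : projective (regular A).
Proof.
apply/projectiveP => X Y g f gH gS fH; have [x gx] := gS (f 1).
exists (fun a => act a x); split=> [|a]; first exact: regular_gen.
rewrite (mhom_act gH) gx -(mhom_act fH); congr f; exact: mulr1.
Qed.

Lemma projective_free_mod n : projective (free_mod A n).
Proof.
apply/projectiveP => X Y g f gH gS fH.
pose d (q : 'I_n) : free_mod A n := [ffun r => (r == q)%:R].
have [z zE] := fin_all_exists (fun q => gS (f (d q))).
exists (free_map z); split; first exact: free_map_mhom.
move=> c; rewrite /free_map (mhom_sum gH).
under eq_bigr => q _ do rewrite (mhom_act gH) zE -(mhom_act fH).
rewrite -(mhom_sum fH); congr f; apply/ffunP => q; rewrite sum_ffunE (bigD1 q) //=.
rewrite !ffunE eqxx mulr1 big1 ?addr0 // => r; rewrite !ffunE eq_sym => /negbTE ->.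
by rewrite mulr0.
Qed.

Lemma star_mhom P (s : star P) : @mhom k A P (regular A) (vsval s).
Proof.
apply: is_hom_mhom.
exact: ((hom_spaceP (M := P) (N := regular A) _).1 (subvsP s)).
Qed.

Lemma star_valE P (s : star P) (a : A) x :
  vsval (@act k A^c (star P) a s) x = vsval s x * a.
Proof. exact: star_actE. Qed.

Lemma star_of P (h : P -> regular A) : mhom h ->
  exists s : star P, forall x, vsval s x = h x.
Proof.
move=> /mhom_lfun[H [HH HE]].
by exists (Subvs ((hom_spaceP (M := P) (N := regular A) H).2 HH)).
Qed.

(** A section of a map from a free module onto [P] has such coordinates. *)
Lemma dual_basis P : projective P -> exists n (h : 'I_n -> star P) (p : 'I_n -> P),
  forall x, x = \sum_l act (vsval (h l) x : A) (p l).
Proof.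
move=> /projectiveP Pp; pose n := \dim {:P}; pose p (l : 'I_n) := (vbasis {:P})`_l.
have pS x : exists c, free_map p c = x.
  exists [ffun l => coord (vbasis {:P}) l x *: 1] => /=.
  rewrite [RHS](coord_vbasis (memvf x)); apply: eq_bigr => l _.
  by rewrite ffunE actZl act1.
have [h [hH hE]] := Pp _ _ _ _ (free_map_mhom p) pS (mhom_id P).
have hl (l : 'I_n) : @mhom _ _ P (regular A) (fun x => (h x : {ffun 'I_n -> A}) l).
  by split=> [x y|a x]; rewrite ?(mhomD hH) ?(mhom_act hH) ffunE.
have [s sE] := fin_all_exists (fun l => star_of (hl l)).
exists n, s, p => x; rewrite -{1}[x]hE; apply: eq_bigr => l _; by rewrite sE.
Qed.

End Projective.

Lemma linfun_linear (k : fieldType) (U V : vectType k) (f : U -> V) :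
  linear f -> linfun f =1 f.
Proof.
move=> fL; pose fl : {linear U -> V} := HB.pack f (GRing.isLinear.Build k U V *:%R f fL).
exact: (lfunE fl).
Qed.

Lemma separating_functional (k : fieldType) (V : vectType k) (U : {vspace V}) v :
  v \notin U -> exists psi : 'Hom(V, k^o), (forall u, u \in U -> psi u = 0) /\ psi v != 0.
Proof.
move=> vU; pose r x := x - projv U x.
have rv : r v != 0.
  by apply: contra vU; rewrite subr_eq0 => /eqP ->; exact: memv_proj.
have [i ri] : exists i, coord (vbasis {:V}) i (r v) != 0.
  apply/existsP; rewrite -negb_forall; apply: contra rv => /forallP h.
  rewrite (coord_vbasis (memvf (r v))) big1 // => i _.
  by have /eqP -> := h i; rewrite scale0r.
have L : linear (fun x => coord (vbasis {:V}) i (r x) : k^o).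
  move=> c x y.
  have -> : r (c *: x + y) = c *: r x + r y.
    by rewrite /r linearP scalerBr opprD addrACA.
  by rewrite linearP.
exists (linfun (fun x => coord (vbasis {:V}) i (r x) : k^o)); split.
  by move=> u uU; rewrite (linfun_linear L) /r projv_id // subrr linear0.
by rewrite (linfun_linear L).
Qed.

Section TauCriterion.
Variables (k : fieldType) (A : falgType k) (M P1 P0 : fdmod A).
Variables (f : 'Hom(P1, P0)) (T : fdmod A^c) (c : 'Hom(star P1, T)).
Hypotheses (P1p : projective P1) (P0p : projective P0) (fH : is_hom f).
Hypotheses (cH : is_hom c) (cS : surj c) (cK : lker c = limg (star_map f)).

Definition lifts_along : Prop := forall w : P1 -> M, mhom w ->
  exists u : P0 -> M, mhom u /\ forall x, w x = u (f x).

Let R P (s : star P) (m : M) : 'Hom(P, M) := linfun (fun x => act (vsval s x : A) m).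

Let RE P (s : star P) (m : M) x : R s m x = act (vsval s x : A) m.
Proof.
rewrite linfun_linear // => a y z.
by rewrite linearP act_linear_l.
Qed.

Let R_mhom P (s : star P) (m : M) : mhom (fun x => act (vsval s x : A) m).
Proof. exact: mhom_comp (star_mhom s) (regular_gen m). Qed.

Let cs_ker (s0 : star P0) : c (star_map f s0) = 0.
Proof. by apply/eqP; rewrite -memv_ker cK memv_img ?memvf. Qed.

(** Dually to the evaluation pairing, a homomorphism from [M] to the translate is
    a functional on the homomorphisms from [P1] to [M] that kills those which
    extend along [f]; here is one from a functional [psi]. *)
Lemma lifts_of_hom_trivial : hom_trivial M (dual T) -> lifts_along.
Proof.
move=> triv w wH; have [W [WH WE]] := mhom_lfun wH.
pose comp_f (U : 'Hom(P0, M)) : 'Hom(P1, M) := (U \o f)%VF.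
have compL : linear comp_f.
  by move=> a U V; rewrite /comp_f comp_lfunDl comp_lfunZl.
pose C := linfun comp_f; have CE := linfun_linear compL.
case: (boolP (W \in (C @: hom_space P0 M)%VS)) => [/memv_imgP[U /hom_spaceP UH e]|].
  exists U; split; first exact: is_hom_mhom.
  by move=> x; rewrite -WE e [C U]CE comp_lfunE.
move=> /separating_functional[psi [psi0 psiW]].
have RDl P (a : k) (s s' : star P) m : R (a *: s + s') m = a *: R s m + R s' m.
  apply/lfunP => x; rewrite add_lfunE scale_lfunE !RE vsval_is_linear.
  by rewrite add_lfunE scale_lfunE actDl actZl.
have RDr P (s : star P) (m m' : M) : R s (m + m') = R s m + R s m'.
  by apply/lfunP => x; rewrite add_lfunE !RE actD.
have R0 (s0 : star P0) m : psi (R (star_map f s0) m) = 0.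
  apply: psi0; apply/memv_imgP; exists (R s0 m).
    apply/hom_spaceP => a x; rewrite !RE; exact: (mhom_act (R_mhom s0 m)).
  by apply/lfunP => x; rewrite [C _]CE comp_lfunE !RE star_mapE.
pose phi (m : M) : dual T := linfun (fun t => psi (R ((c^-1)%VF t) m)).
have phiL m : linear (fun t => psi (R ((c^-1)%VF t) m)).
  by move=> a t t'; rewrite linearP RDl linearP.
have phiE m s : phi m (c s) = psi (R s m).
  rewrite (linfun_linear (phiL m)); set s' := (c^-1)%VF (c s).
  have : s' - s \in lker c.
    rewrite memv_ker linearB subr_eq0; apply/eqP; apply: limg_lfunVK.
    by rewrite memv_img ?memvf.
  rewrite cK => /memv_imgP[s0 _ e].
  have -> : s' = 1 *: star_map f s0 + s by rewrite -e scale1r subrK.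
  by rewrite RDl linearD linearZ /= R0 scaler0 add0r.
have phi_eq m (u : dual T) : (forall s, phi m (c s) = u (c s)) -> phi m = u.
  by move=> e; apply/lfunP => t; have [s <-] := (surjP c).1 cS t.
have phiH : mhom phi.
  split=> [m m'|a m]; apply: phi_eq => s.
    by rewrite add_lfunE !phiE RDr linearD.
  rewrite phiE; have -> : act a (phi m) (c s) = phi m (c (act (a : A^c) s)).
    by rewrite [LHS]dual_actE cH.
  rewrite phiE; congr (psi _); apply/lfunP => x.
  by rewrite !RE star_valE actM.
have [Phi [PhiH PhiE]] := mhom_lfun phiH.
have psiR s m : psi (R s m) = 0.
  by rewrite -phiE -PhiE (triv _ PhiH) !zero_lfunE.
have [n [h [p hp]]] := dual_basis P1p.
case/eqP: psiW; have -> : W = \sum_l R (h l) (w (p l)).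
  apply/lfunP => x; rewrite sum_lfunE WE {1}[x]hp (mhom_sum wH).
  by apply: eq_bigr => l _; rewrite RE (mhom_act wH).
by rewrite linear_sum big1 // => l _; exact: psiR.
Qed.

(** Conversely, the homomorphisms [x |-> s x m] extend along [f]; expanded in a
    dual basis, the extension rewrites the value at [c s] of a homomorphism to the
    translate in terms of its values on the image of [star_map f], which are 0. *)
Lemma hom_trivial_of_lifts : lifts_along -> hom_trivial M (dual T).
Proof.
move=> lifts Phi PhiH; have phiH := is_hom_mhom PhiH.
apply/lfunP => m; rewrite zero_lfunE; apply/lfunP => t; rewrite [RHS]zero_lfunE.
have [s <-] := (surjP c).1 cS t.
have [u [uH uE]] := lifts _ (R_mhom s m).
have [n [h [p hp]]] := dual_basis P1p; have [n0 [h0 [p0 hp0]]] := dual_basis P0p.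
have sE (s' : star P1) : s' = \sum_l @act k A^c (star P1) (vsval s' (p l)) (h l).
  apply: subvs_inj; apply/lfunP => x.
  rewrite {1}[x]hp (mhom_sum (star_mhom s')) raddf_sum sum_lfunE.
  apply: eq_bigr => l _; rewrite (mhom_act (star_mhom s')); by rewrite star_valE.
have phiT (a : A) m' t' : Phi m' (@act k A^c T a t') = Phi (act a m') t'.
  by rewrite (mhom_act phiH); exact: esym (dual_actE _ _ _).
have E (s' : star P1) m' :
    Phi m' (c s') = \sum_l Phi (act (vsval s' (p l) : A) m') (c (h l)).
  rewrite {1}[s']sE (mhom_sum (is_hom_mhom cH)) raddf_sum; apply: eq_bigr => l _.
  rewrite (mhom_act (is_hom_mhom cH)); exact: phiT.
rewrite E.
have -> : \sum_l Phi (act (vsval s (p l) : A) m) (c (h l)) =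
    \sum_q \sum_l Phi (act (vsval (star_map f (h0 q)) (p l) : A) (u (p0 q))) (c (h l)).
  rewrite exchange_big; apply: eq_bigr => l _ /=; rewrite uE.
  rewrite -sum_lfunE -linear_sum; congr (Phi _ _).
  rewrite [f (p l)]hp0 (mhom_sum uH); apply: eq_bigr => q _.
  by rewrite (mhom_act uH) star_mapE // -hp0.
by rewrite big1 // => q _; rewrite -E cs_ker linear0.
Qed.

End TauCriterion.

Section TauRigid.
Variables (k : fieldType) (A : falgType k).
Implicit Types M N P : fdmod A.

(** A homomorphism from [M] to its translate is an obstruction to extending
    homomorphisms along the minimal presentation of [M]. *)
Lemma tau_rigidP M : tau_rigid M <->
  exists (P1 P0 : fdmod A) (f : 'Hom(P1, P0)) (g : 'Hom(P0, M)),
    minimal_presentation f g /\ lifts_along M f.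
Proof.
split=> [[N [[T [[P1 [P0 [f [g [c [mp cH cS cK]]]]]] NT]] triv]]|].
  exists P1, P0, f, g; split=> //; case: mp => [[P1p P0p] [fH gH] _ _].
  apply: (lifts_of_hom_trivial P1p fH cH cS cK) => Phi /is_hom_mhom phiH.
  case/isoP: NT => i [j [iH jH _ jK]].
  have [J [JH JE]] := mhom_lfun (mhom_comp phiH jH).
  apply/lfunP => m; rewrite zero_lfunE -[Phi m]jK -JE (triv _ JH) zero_lfunE.
  exact: mhom0 iH.
move=> [P1 [P0 [f [g [mp lifts]]]]]; case: (mp) => [[P1p P0p] [fH gH] _ _].
have sfH : mhom (star_map f).
  apply: is_hom_mhom => a h; apply: star_eq => x.
  by rewrite star_mapE // !star_valE star_mapE.
have [T [c [/mhom_lfun[C [CH CE]] cS cK]]] := coker_exists sfH.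
have CS : surj C by apply/surjP => y; have [x <-] := cS y; exists x; rewrite CE.
have CK : lker C = limg (star_map f).
  apply/vspaceP => x; rewrite memv_ker CE; apply/eqP/memv_imgP => [/cK[z ->]|[z _ ->]].
    by exists z; rewrite ?memvf.
  by apply/cK; exists z.
exists (dual T); split; last exact: hom_trivial_of_lifts CS CK lifts.
by exists T; split; [exists P1, P0, f, g, C | exact: iso_refl].
Qed.

End TauRigid.

(** * The algebras at hand *)

(** What is used of a quotient of the path algebra modulo [r ^ 3]: the images of
    the trivial paths and of the arrows, [arrow (v, m)] being the [m]-th arrow out
    of [v], and the characters [chi v] by which the algebra acts on the two simple
    modules.  The arrows and their products of length two may satisfy any
    further relations, so the structure covers all the quotients at once. *)
Record dk_structure (k : fieldType) (B : falgType k) := DkStructure {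
  idem : bool -> B;
  arrow : bool * bool -> B;
  chi : bool -> B -> k;
  idemM : forall v w, idem v * idem w = if v == w then idem v else 0;
  idem_sum : idem false + idem true = 1;
  arrow_tgt : forall a, idem (~~ a.1) * arrow a = arrow a;
  arrow_src : forall a, arrow a * idem a.1 = arrow a;
  arrow3 : forall a b c, arrow a * (arrow b * arrow c) = 0;
  dk_span : forall x, exists (c : bool -> k) (d : bool * bool -> k)
      (g : (bool * bool) * (bool * bool) -> k),
    x = \sum_v c v *: idem v + \sum_a d a *: arrow a
      + \sum_p g p *: (arrow p.1 * arrow p.2);
  chi_linear : forall v c x y, chi v (c *: x + y) = c * chi v x + chi v y;
  chiM : forall v x y, chi v (x * y) = chi v x * chi v y;
  chi_idem : forall v w, chi v (idem w) = (v == w)%:R;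
  chi_arrow : forall v a, chi v (arrow a) = 0
}.

Lemma pcomp_none (Q : quiver) (q p : qpath Q) : ptgt p <> psrc q -> Defs.pcomp q p = None.
Proof. by move/eqP/negbTE => e; rewrite /Defs.pcomp e. Qed.

Section PathQuotient.
Variables (k : fieldType).
Local Notation Q := double_kronecker.
Local Notation PA := (path_alg k Q).
Local Notation pt := (@ptriv Q).

(** Locked, as is [aug] below, because an attempt to decide by computation whether
    two basis vectors are equal diverges. *)
Definition pb : qpath Q -> PA := locked (@pbasis k Q).

Lemma pbE p : pb p = pbasis k p. Proof. by rewrite /pb -lock. Qed.

Lemma pbasisM (q p r : qpath Q) : ptgt p = psrc q -> psrc r = psrc p ->
  pseq r = pseq p ++ pseq q -> pb q * pb p = pb r.
Proof.
move=> e r1 r2; rewrite !pbE -[_ * _]/(path_mul _ _) path_mulU.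
have [r' [-> s1 _ s3]] := pcompE e; congr pbasis.
by apply: qpath_eq; rewrite ?s1 ?s3 ?r1 ?r2.
Qed.

Lemma pbasisM0 (q p : qpath Q) : ptgt p <> psrc q -> pb q * pb p = 0.
Proof.
by move=> e; rewrite !pbE -[_ * _]/(path_mul _ _) path_mulU pcomp_none.
Qed.

Lemma walk_arrow (a : arr Q) : walk (src a) [:: a].
Proof. by rewrite /= eqxx. Qed.

Definition parrow (a : arr Q) : qpath Q := exist _ (src a, [:: a]) (walk_arrow a).

Definition aug : bool -> PA -> k := locked (fun v => mcoeff (pt v)).

Lemma augE v f : aug v f = mcoeff (pt v) f. Proof. by rewrite /aug -lock. Qed.

Lemma aug_linear v c f g : aug v (c *: f + g) = c * aug v f + aug v g.
Proof. by rewrite !augE mcoeffD mcoeffZ. Qed.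

Lemma aug0 v : aug v 0 = 0. Proof. by rewrite augE mcoeff0. Qed.

Lemma aug_pb v p : aug v (pb p) = (p == pt v)%:R.
Proof. by rewrite pbE augE mcoeffU. Qed.

Lemma augD v f g : aug v (f + g) = aug v f + aug v g.
Proof. by rewrite !augE mcoeffD. Qed.

Lemma ptriv_eq (p : qpath Q) v : (p == pt v) = (psrc p == v) && nilp (pseq p).
Proof.
apply/eqP/andP => [->|[/eqP e /nilP n]]; first by rewrite eqxx.
by apply: qpath_eq.
Qed.

Lemma path_alg_ext_scalar (F G : PA -> k) :
  (forall c f g, F (c *: f + g) = c * F f + F g) ->
  (forall c f g, G (c *: f + g) = c * G f + G g) ->
  (forall p, F (pb p) = G (pb p)) -> F =1 G.
Proof.
move=> FL GL e f.
have : F f *: (1 : PA) = G f *: 1.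
  apply: (@path_alg_ext k Q (fun f => F f *: (1 : PA)) (fun f => G f *: (1 : PA))).
  - by move=> c x y; rewrite FL scalerDl scalerA.
  - by move=> c x y; rewrite GL scalerDl scalerA.
  - by move=> p; rewrite -pbE e.
move/eqP; rewrite -subr_eq0 -scalerBl scaler_eq0 oner_eq0 orbF subr_eq0.
by move/eqP.
Qed.

Lemma augM v f g : aug v (f * g) = aug v f * aug v g.
Proof.
move: f; apply: path_alg_ext_scalar => [c f f'|c f f'|q].
- by rewrite mulrDl -scalerAl aug_linear.
- by rewrite aug_linear mulrDl mulrA.
move: g; apply: path_alg_ext_scalar => [c g g'|c g g'|p].
- by rewrite mulrDr -scalerAr aug_linear.
- by rewrite aug_linear mulrDr mulrCA.
have -> : aug v (pb q) * aug v (pb p)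
    = ((psrc q == v) && nilp (pseq q) && ((psrc p == v) && nilp (pseq p)))%:R.
  by rewrite -mulnb natrM -!ptriv_eq; congr (_ * _); exact: aug_pb.
case: (ptgt p =P psrc q) => [e|ne].
  have [r [_ r1 _ r3]] := pcompE e; have -> := pbasisM e r1 r3.
  rewrite aug_pb ptriv_eq r1 r3 /nilp size_cat addn_eq0.
  congr (_%:R); move: e; rewrite /ptgt; case: (pseq p) => [|a s] /=; last by rewrite !andbF.
  by move=> ->; case: (psrc q == v); rewrite /= ?andbT ?andbF.
have -> := pbasisM0 ne; rewrite aug0.
move: ne; rewrite /ptgt; case: (pseq p) => [|a s] /=; last by rewrite !andbF.
move=> ne; case: (psrc q =P v) => [qv|//]; case: (psrc p =P v) => [pv|]; last by rewrite andbF.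
by case: ne; rewrite qv pv.
Qed.

Lemma one_pb : 1 = pb (pt true) + pb (pt false) :> PA.
Proof.
rewrite !pbE; exact: (@big_bool PA 0 +%R (fun v => pbasis k (pt v))).
Qed.

Lemma aug1 v : aug v 1 = 1.
Proof.
have -> := one_pb; rewrite augD.
have -> : aug v (pb (pt true)) = (true == v)%:R by rewrite aug_pb ptriv_eq andbT.
have -> : aug v (pb (pt false)) = (false == v)%:R by rewrite aug_pb ptriv_eq andbT.
by case: v; rewrite /= ?addr0 ?add0r.
Qed.

Lemma aug_arrow_ideal v f : arrow_ideal f -> aug v f = 0.
Proof.
move=> /(_ (fun f => aug v f = 0)); apply=> [|y [p [lp ->]]].
  split; [split|] => [|x y x0 y0|a x x0|a x x0].
  - exact: aug0.
  - by rewrite -[x]scale1r aug_linear x0 y0 mulr0 addr0.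
  - by rewrite augM x0 mulr0.
  - by rewrite augM x0 mul0r.
by rewrite -pbE aug_pb ptriv_eq /nilp -/(plen p) lp andbF.
Qed.

Let r := @arrow_ideal k Q.
Let r3 := ideal_mul r (ideal_mul r r).

Lemma aug_r3 v f : r3 f -> aug v f = 0.
Proof.
move=> /(_ (fun f => aug v f = 0)); apply=> [|z [x [y [rx _ ->]]]]; last by rewrite augM (aug_arrow_ideal v rx) mul0r.
split; [split|] => [|x y x0 y0|a x x0|a x x0].
- exact: aug0.
- by rewrite -[x]scale1r aug_linear x0 y0 mulr0 addr0.
- by rewrite augM x0 mulr0.
- by rewrite augM x0 mul0r.
Qed.

Lemma arrow_in_r a : r (pb (parrow a)).
Proof. by move=> J _; apply; exists (parrow a); rewrite pbE. Qed.

(** Such a path is the product of two arrows and of a path that starts with an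
    arrow. *)
Lemma long_path_r3 p : (2 < plen p)%N -> r3 (pb p).
Proof.
case: p => -[v [|a [|b [|c s]]]] w //= _.
case/and4P: (w) => /eqP /= ea /eqP eb /eqP ec ws.
have wcs : walk (src c) (c :: s) by rewrite /= eqxx.
pose q : qpath Q := exist _ (src c, c :: s) wcs.
pose t : qpath Q := exist _ (tgt c, s) ws.
have wab : walk (src a) [:: a; b] by rewrite /= -eb !eqxx.
have e1 : pb q * (pb (parrow b) * pb (parrow a)) = pb (exist _ (v, [:: a, b, c & s]) w).
  rewrite (@pbasisM (parrow b) (parrow a) (exist _ (src a, [:: a; b]) wab)) //.
  exact: pbasisM.
rewrite -e1 => J _; apply; exists (pb q), (pb (parrow b) * pb (parrow a)); split=> //.
  have <- : pb t * pb (parrow c) = pb q by exact: pbasisM.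
  move=> J' hJ hS; case: (hJ) => -[_ _ hM] _; apply: hM; exact: arrow_in_r hJ hS.
move=> J' _; apply; exists (pb (parrow b)), (pb (parrow a)).
by split=> //; exact: arrow_in_r.
Qed.

Variables (A : falgType k) (pA : {lrmorphism PA -> A}).
Hypothesis hA : quotient_map r3 pA.
Variables (I : A -> Prop) (B : falgType k) (pB : {lrmorphism A -> B}).
Hypotheses (hrad : forall x, I x -> @radical k A x) (hB : quotient_map I pB).

Let p (f : PA) : B := pB (pA f).

Let pAB f g : pA (f - g) = pA f - pA g. Proof. exact: raddfB. Qed.
Let pAD f g : pA (f + g) = pA f + pA g. Proof. exact: raddfD. Qed.
Let pAM f g : pA (f * g) = pA f * pA g. Proof. exact: rmorphM. Qed.
Let pAZ c f : pA (c *: f) = c *: pA f. Proof. exact: linearZ. Qed.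
Let pA1 : pA 1 = 1. Proof. exact: rmorph1. Qed.
Let pA0 : pA 0 = 0. Proof. exact: raddf0. Qed.

(** The elements of augmentation 0 at [v] form a maximal left ideal, of codimension
    one, which contains the radical and hence the kernel of [pB]. *)
Lemma aug_ker v f : p f = 0 -> aug v f = 0.
Proof.
move=> /hB.2 /hrad rf.
pose L x := exists f, pA f = x /\ aug v f = 0.
have [|g [e g0]] := rf L; last first.
  have : pA (g - f) = 0 by rewrite pAB e subrr.
  move/hA.2/(aug_r3 v); rewrite -scaleN1r addrC aug_linear g0 addr0 mulN1r.
  by move/eqP; rewrite oppr_eq0 => /eqP.
have Laff : left_ideal L.
  split=> [|x y [f1 [<- f0]] [f2 [<- f3]]|a x [f1 [<- f0]]].
  - by exists 0; rewrite pA0 aug0.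
  - exists (f1 + f2); rewrite pAD; split=> //.
    by rewrite -[f1]scale1r aug_linear f0 f3 mulr0 addr0.
  - have [b <-] := hA.1 a; exists (b * f1); rewrite pAM; split=> //.
    by rewrite augM f0 mulr0.
split=> // [[g [e g0]]|L' [L'0 L'D L'M] L'1 LL' x L'x].
  have : pA (1 - g) = 0 by rewrite pAB pA1 e subrr.
  move/hA.2/(aug_r3 v); rewrite -[- g]scaleN1r addrC aug_linear g0 mulr0 add0r aug1.
  by move/eqP; rewrite oner_eq0.
have [g eg] := hA.1 x; have [g0|gn0] := eqVneq (aug v g) 0; first by exists g.
case: L'1; have Lx : L (aug v g *: 1 - x).
  exists (aug v g *: 1 - g); rewrite pAB pAZ pA1 eg; split=> //.
  by rewrite -[- g]scaleN1r addrC aug_linear -[_ *: 1]addr0 aug_linear aug1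
             aug0 addr0 mulr1 mulN1r addNr.
have := L'D _ _ (LL' _ Lx) L'x; rewrite subrK => /(L'M ((aug v g)^-1)%:A).
by rewrite -scalerAl mul1r scalerA mulVf // scale1r.
Qed.

Lemma dk_structure_quotient : inhabited (dk_structure B).
Proof.
have pS y : exists f, p f == y.
  by have [x <-] := hB.1 y; have [f <-] := hA.1 x; exists f.
pose lift y := xchoose (pS y); have liftK y : p (lift y) = y by exact/eqP/(xchooseP (pS y)).
have pL c f g : p (c *: f + g) = c *: p f + p g by rewrite /p pAD pAZ linearP.
have pM f g : p (f * g) = p f * p g by rewrite /p pAM rmorphM.
have p0 : p 0 = 0 by rewrite /p pA0 raddf0.
have aug_eq v f g : p f = p g -> aug v f = aug v g.
  move=> e; have /(aug_ker v) : p (-1 *: g + f) = 0 by rewrite pL e scaleN1r addNr.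
  by rewrite aug_linear mulN1r => /eqP; rewrite addrC subr_eq0 => /eqP.
pose e v := p (pb (pt v)); pose ar a := p (pb (parrow a)).
have three a b c : ar a * (ar b * ar c) = 0.
  rewrite /ar -!pM; suff h : r3 (pb (parrow a) * (pb (parrow b) * pb (parrow c))).
    by rewrite /p (hA.2 _).2 // raddf0.
  move=> J _; apply; exists (pb (parrow a)), (pb (parrow b) * pb (parrow c)).
  split=> //; first exact: arrow_in_r.
  move=> J' _; apply; exists (pb (parrow b)), (pb (parrow c)).
  by split=> //; exact: arrow_in_r.
apply: inhabits; apply: (@DkStructure k B e ar (fun v y => aug v (lift y))).
- move=> v w; rewrite /e -pM; case: eqP => [<-|ne].
    by rewrite (@pbasisM _ _ (pt v)).
  by rewrite pbasisM0 // => h; apply: ne.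
- by rewrite /e -[p _]scale1r -pL scale1r addrC -one_pb /p pA1 rmorph1.
- by move=> a; rewrite /e /ar -pM (@pbasisM _ _ (parrow a)).
- by move=> a; rewrite /e /ar -pM (@pbasisM _ _ (parrow a)).
- exact: three.
- pose spanned y := exists (c : bool -> k) (d : bool * bool -> k)
      (g : (bool * bool) * (bool * bool) -> k),
    y = \sum_v c v *: e v + \sum_a d a *: ar a
      + \sum_q g q *: (ar q.1 * ar q.2).
  have spannedL c x y : spanned x -> spanned y -> spanned (c *: x + y).
    move=> [c1 [d1 [g1 ->]]] [c2 [d2 [g2 ->]]].
    exists (fun v => c * c1 v + c2 v), (fun a => c * d1 a + d2 a),
           (fun q => c * g1 q + g2 q).
    have lin (T : finType) (h1 h2 : T -> k) (F : T -> B) :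
        \sum_t (c * h1 t + h2 t) *: F t = c *: (\sum_t h1 t *: F t) + \sum_t h2 t *: F t.
      rewrite scaler_sumr -big_split; apply: eq_bigr => t _.
      by rewrite scalerDl scalerA.
    rewrite !lin !scalerDr addrACA; congr (_ + _); exact: addrACA.
  have spanned0 : spanned 0.
    exists (fun _ => 0), (fun _ => 0), (fun _ => 0).
    by rewrite !big1 ?addr0 // => *; rewrite scale0r.
  have single (T : finType) (t : T) (F : T -> B) : \sum_s (s == t)%:R *: F s = F t.
    rewrite (bigD1 t) //= eqxx scale1r big1 ?addr0 // => s /negbTE ->.
    by rewrite scale0r.
  have zeros (T : finType) (F : T -> B) : \sum_s 0 *: F s = 0.
    by rewrite big1 // => s _; rewrite scale0r.
  have spanned_pb q : spanned (p (pb q)).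
    case: (ltnP 2 (plen q)) => [/long_path_r3 /hA.2 h|].
      by rewrite /p h raddf0.
    case: q => -[v [|a [|b [|c s]]]] w //= _.
    + exists (fun u => (u == v)%:R), (fun _ => 0), (fun _ => 0).
      rewrite single !zeros !addr0; congr (p (pb _)); exact: qpath_eq.
    + exists (fun _ => 0), (fun b => (b == a)%:R), (fun _ => 0).
      rewrite single !zeros add0r addr0; congr (p (pb _)).
      by case/andP: (w) => /eqP ea _; apply: qpath_eq.
    + exists (fun _ => 0), (fun _ => 0), (fun q => (q == (b, a))%:R).
      rewrite single !zeros !add0r /ar -pM; congr p; apply/esym.
      by case/and3P: (w) => /eqP ea /eqP eb _; apply: pbasisM.
  move=> y; rewrite -[y]liftK -/(spanned _); move: (lift y) => f.
  rewrite [f]monalgE.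
  elim/big_rec: _ => [|q g _ IH]; first by rewrite p0.
  by rewrite (pbasisZ (f@_q) q) -pbE pL; apply: spannedL.
- move=> v c x y; rewrite -aug_linear; apply: aug_eq.
  by rewrite pL !liftK.
- by move=> v x y; rewrite -augM; apply: aug_eq; rewrite pM !liftK.
- move=> v w; rewrite (aug_eq _ _ (pb (pt w))) ?liftK // aug_pb ptriv_eq.
  by rewrite andbT eq_sym.
- move=> v a; rewrite (aug_eq _ _ (pb (parrow a))) ?liftK // aug_pb ptriv_eq.
  by rewrite andbF.
Qed.

End PathQuotient.

(** * Modules over a radical-cube-zero algebra on two vertices *)

Section Structure.
Variables (k : fieldType) (B : falgType k) (D : dk_structure B).
Local Notation e := (idem D).
Local Notation ar := (arrow D).
Local Notation chi := (chi D).

Lemma chiD v x y : chi v (x + y) = chi v x + chi v y.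
Proof. by rewrite -[x]scale1r chi_linear mul1r scale1r. Qed.

Lemma chi0 v : chi v 0 = 0.
Proof. by apply: (@addIr _ (chi v 0)); rewrite -chiD !add0r. Qed.

Lemma chiZ v c x : chi v (c *: x) = c * chi v x.
Proof. by rewrite -[c *: x]addr0 chi_linear chi0 addr0. Qed.

Lemma chiB v x y : chi v (x - y) = chi v x - chi v y.
Proof. by rewrite -scaleN1r addrC chi_linear mulN1r addrC. Qed.

Lemma chi_sum v I (r : seq I) (p : pred I) (F : I -> B) :
  chi v (\sum_(i <- r | p i) F i) = \sum_(i <- r | p i) chi v (F i).
Proof. exact: (big_morph (chi v) (chiD v) (chi0 v)). Qed.

Lemma idem2 v : e v * e v = e v.
Proof. by rewrite idemM eqxx. Qed.

Lemma idem_neq v w : v != w -> e v * e w = 0.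
Proof. by rewrite idemM => /negbTE ->. Qed.

Lemma chi1 v : chi v 1 = 1.
Proof. by rewrite -(idem_sum D) chiD !chi_idem; case: v; rewrite ?addr0 ?add0r. Qed.

(** The span of the arrows and their products, by [rad_ind]. *)
Definition rad (x : B) : Prop := forall v, chi v x = 0.

Lemma rad_arrow a : rad (ar a). Proof. by move=> v; rewrite chi_arrow. Qed.
Lemma radMl x y : rad y -> rad (x * y).
Proof. by move=> h v; rewrite chiM h mulr0. Qed.
Lemma radMr x y : rad x -> rad (x * y).
Proof. by move=> h v; rewrite chiM h mul0r. Qed.

Lemma rad_ind (Phi : B -> Prop) : Phi 0 ->
  (forall c x y, Phi x -> Phi y -> Phi (c *: x + y)) ->
  (forall a, Phi (ar a)) -> (forall a b, Phi (ar a * ar b)) ->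
  forall x, rad x -> Phi x.
Proof.
move=> h0 hL h1 h2 x; have [c [d [g ->]]] := dk_span D x => rx.
have c0 v : c v = 0.
  have := rx v; rewrite !chiD !chi_sum [X in _ + X + _]big1 => [|a _]; last first.
    by rewrite chiZ chi_arrow mulr0.
  rewrite [X in _ + X]big1 => [|q _]; last by rewrite chiZ chiM chi_arrow mul0r mulr0.
  rewrite !addr0 (bigD1 v) //= chiZ chi_idem eqxx mulr1 big1 ?addr0 // => w nw.
  by rewrite chiZ chi_idem eq_sym (negbTE nw) mulr0.
have hD y z : Phi y -> Phi z -> Phi (y + z) by move=> hy hz; rewrite -[y]scale1r; exact: hL.
have hZ s y : Phi y -> Phi (s *: y) by move=> hy; rewrite -[_ *: _]addr0; exact: hL.
rewrite big1 ?add0r => [|v _]; last by rewrite c0 scale0r.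
apply: (hD).
  by elim/big_ind: _ => [//|y z|i _]; [exact: hD | exact: hZ (h1 i)].
by elim/big_ind: _ => [//|y z|i _]; [exact: hD | exact: hZ (h2 _ _)].
Qed.

(** By bilinearity it is enough to multiply three arrows. *)
Lemma rad3 x y z : rad x -> rad y -> rad z -> x * (y * z) = 0.
Proof.
have L1 a b t : rad t -> ar a * (ar b * t) = 0.
  move: t; apply: rad_ind => [|c u w hu hw|c|c d].
  - by rewrite !mulr0.
  - by rewrite !mulrDr -!scalerAr hu hw scaler0 addr0.
  - exact: arrow3.
  - by rewrite !mulrA -(mulrA (ar a)) arrow3 mul0r.
have L2 a t u : rad t -> rad u -> ar a * (t * u) = 0.
  move=> ht hu; move: t ht; apply: rad_ind => [|c s w hs hw|c|c d].
  - by rewrite mul0r mulr0.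
  - by rewrite mulrDl -scalerAl mulrDr -scalerAr hs hw scaler0 addr0.
  - exact: L1.
  - by rewrite mulrA arrow3 mul0r.
move=> hx hy hz; move: x hx; apply: rad_ind => [|c s w hs hw|c|c d].
- by rewrite mul0r.
- by rewrite mulrDl -scalerAl hs hw scaler0 addr0.
- exact: L2.
- by rewrite -mulrA L2 //; [exact: rad_arrow | exact: radMr].
Qed.

Definition corner v w (x : B) : Prop := e v * x = x /\ x * e w = x.

Lemma corner_idem v : corner v v (e v).
Proof. by split; exact: idem2. Qed.

Lemma cornerE v w x : corner v w (e v * x * e w).
Proof. by split; rewrite ?mulrA ?idem2 // -mulrA idem2. Qed.

Lemma corner_lin v w c x y : corner v w x -> corner v w y -> corner v w (c *: x + y).
Proof.
move=> [x1 x2] [y1 y2].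
by split; rewrite ?mulrDr ?mulrDl -?scalerAr -?scalerAl ?x1 ?y1 ?x2 ?y2.
Qed.

Lemma corner0 v w : corner v w 0. Proof. by split; rewrite ?mulr0 ?mul0r. Qed.

Lemma arrow_corner a : corner (~~ a.1) a.1 (ar a).
Proof. by split; [exact: arrow_tgt | exact: arrow_src]. Qed.

Lemma corner_rad i x : corner (~~ i) i x -> rad x.
Proof.
move=> [x1 x2] v; rewrite -x1 -x2 !chiM !chi_idem.
by case: v i {x1 x2} => [] []; rewrite /= ?mulr0 ?mul0r.
Qed.

Lemma corner_split i y : corner i i y ->
  exists w, [/\ y = chi i y *: e i + w, rad w & corner i i w].
Proof.
move=> [y1 y2]; exists (y - chi i y *: e i); split; first by rewrite addrC subrK.
  move=> v; rewrite chiB chiZ chi_idem; case: eqP => [->|/eqP nv].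
    by rewrite mulr1 subrr.
  by rewrite -y1 chiM chi_idem (negbTE nv) mul0r mulr0 subrr.
rewrite addrC -scaleNr; apply: corner_lin; [exact: corner_idem | by split].
Qed.

(** A path of positive length from a vertex to itself has length two, so its product
    with an element of the radical has length at least three. *)
Lemma rad_corner0 i x w : rad x -> rad w -> corner i i w -> x * w = 0 /\ w * x = 0.
Proof.
move=> rx rw [w1 w2].
have e0 a : e i * (ar a * e i) = 0.
  have [ai|nai] := eqVneq i a.1; last first.
    by rewrite -(arrow_src D a) -mulrA (@idem_neq a.1 i) 1?eq_sym // !mulr0.
  by rewrite -(arrow_tgt D a) !mulrA idem_neq ?mul0r // ai; case: (a.1).
suff h t : rad t -> x * (e i * t * e i) = 0 /\ e i * t * e i * x = 0.
  by have := h w rw; rewrite w1 w2.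
move: t; apply: rad_ind => [|c u s [h1 h2] [h3 h4]|a|a b].
- by rewrite mulr0 mul0r mulr0 mul0r.
- rewrite mulrDr mulrDl -scalerAr -scalerAl mulrDr mulrDl -scalerAr -scalerAl.
  by rewrite h1 h2 h3 h4 scaler0 addr0.
- by rewrite -mulrA e0 mulr0 mul0r.
- split.
    rewrite -!mulrA mulrA; apply: rad3; [exact: radMr | exact: rad_arrow |].
    apply: radMr; exact: rad_arrow.
  rewrite -!mulrA (_ : ar a * _ = 0) ?mulr0 //.
  by apply: rad3; [exact: rad_arrow .. | exact: radMl].
Qed.

(** As maps between the indecomposable projectives at the two vertices, the elements
    of [corner (~~ i) i] form a vector space on which the endomorphisms of both
    projectives act through their residues in [k]. *)
Lemma corner_mulr i x y : corner (~~ i) i x -> corner i i y -> x * y = chi i y *: x.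
Proof.
move=> hx hy; have [w [ew rw cw]] := corner_split hy.
rewrite {1}ew mulrDr -scalerAr hx.2.
by have [-> _] := rad_corner0 (corner_rad hx) rw cw; rewrite addr0.
Qed.

Lemma corner_mull i x y : corner (~~ i) i x -> corner (~~ i) (~~ i) y ->
  y * x = chi (~~ i) y *: x.
Proof.
move=> hx hy; have [w [ew rw cw]] := corner_split hy.
rewrite {1}ew mulrDl -scalerAl hx.1.
by have [_ ->] := rad_corner0 (corner_rad hx) rw cw; rewrite addr0.
Qed.

Lemma corner_span i x : corner (~~ i) i x ->
  exists c1 c2, x = c1 *: ar (i, false) + c2 *: ar (i, true).
Proof.
move=> hx; suff h t : rad t -> exists c1 c2,
    e (~~ i) * t * e i = c1 *: ar (i, false) + c2 *: ar (i, true).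
  by have := h x (corner_rad hx); rewrite hx.1 hx.2.
have z : exists c1 c2, 0 = c1 *: ar (i, false) + c2 *: ar (i, true) :> B.
  by exists 0, 0; rewrite !scale0r addr0.
have src0 a : a.1 != i -> ar a * e i = 0.
  by move=> ai; rewrite -(arrow_src D a) -mulrA idem_neq // mulr0.
have tgt0 v a : v != ~~ a.1 -> e v * ar a = 0.
  by move=> ai; rewrite -(arrow_tgt D a) mulrA idem_neq // mul0r.
move: t; apply: rad_ind => [|c u s [c1 [c2 h]] [c3 [c4 h']]|[v m]|a b].
- by rewrite mulr0 mul0r.
- exists (c * c1 + c3), (c * c2 + c4); rewrite mulrDr mulrDl -scalerAr -scalerAl h h'.
  by rewrite !scalerDl scalerDr !scalerA addrACA.
- have [vi|nvi] := eqVneq v i; last by rewrite -mulrA src0 // mulr0.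
  have /= t := arrow_tgt D (v, m); have /= s := arrow_src D (v, m).
  rewrite -vi t s.
  by case: (m); [exists 0, 1 | exists 1, 0]; rewrite scale0r scale1r ?addr0 ?add0r.
- have [bi|nbi] := eqVneq b.1 i; last by rewrite -!mulrA src0 // !mulr0.
  have [ai|nai] := eqVneq (~~ i) (~~ a.1); last by rewrite mulrA tgt0 // !mul0r.
  rewrite -(arrow_src D a) -!mulrA [e _ * (ar b * _)]mulrA tgt0 ?mul0r ?mulr0 //.
  by rewrite -(inj_eq negb_inj) -ai bi; case: (i).
Qed.

(** ** The radical of a module *)

Section RadicalOfModule.
Implicit Types M N P X Y Z : fdmod B.

(** Membership in the product of the radical with [M]. *)
Inductive inJ M : M -> Prop :=
| inJ0 : inJ 0
| inJS b x y : rad b -> inJ y -> inJ (act b x + y).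

Lemma inJ_act M b (x : M) : rad b -> inJ (act b x).
Proof. by move=> rb; rewrite -[act b x]addr0; apply: inJS => //; exact: inJ0. Qed.

Lemma inJD M (x y : M) : inJ x -> inJ y -> inJ (x + y).
Proof.
by move=> h hy; elim: h => [|b x' y' rb _ IH]; rewrite ?add0r // -addrA; apply: inJS.
Qed.

Lemma inJM M a (x : M) : inJ x -> inJ (act a x).
Proof.
elim=> [|b x' y rb _ IH]; first by rewrite act0; exact: inJ0.
by rewrite actD -actM; apply: inJS => //; exact: radMl.
Qed.

Lemma inJ_sum M I (r : seq I) (F : I -> M) :
  (forall i, inJ (F i)) -> inJ (\sum_(i <- r) F i).
Proof.
move=> h; elim/big_ind: _ => // [|x y]; [exact: inJ0 | exact: inJD].
Qed.

Lemma inJ_mhom M N (f : M -> N) x : mhom f -> inJ x -> inJ (f x).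
Proof.
move=> fH; elim=> [|b x' y rb _ IH]; first by rewrite (mhom0 fH); exact: inJ0.
by rewrite (mhomD fH) (mhom_act fH); apply: inJS.
Qed.

Lemma rad_inJ2 M b c (x : M) : rad b -> rad c -> inJ x -> act b (act c x) = 0.
Proof.
move=> rb rc; elim=> [|b' x' y rb' _ IH]; first by rewrite !act0.
by rewrite !actD IH addr0 -!actM -mulrA rad3 // act0l.
Qed.

(** Such an [f] maps the submodule [rad ^ n M] into [rad ^ n.+1 M]. *)
Lemma endo_inJ_nilp M (f : M -> M) : mhom f -> (forall x, inJ (f x)) ->
  forall x, f (f (f x)) = 0.
Proof.
move=> fH fJ x; have A b y : rad b -> inJ y -> act b (f y) = 0.
  move=> rb; elim=> [|b' x' z rb' _ IH]; first by rewrite (mhom0 fH) act0.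
  by rewrite (mhomD fH) actD IH addr0 (mhom_act fH) rad_inJ2.
elim: (fJ x) => [|b x' y rb _ IH]; first by rewrite !(mhom0 fH).
by rewrite !(mhomD fH) IH addr0 !(mhom_act fH) A.
Qed.

Lemma nakayama M (S : M -> Prop) : S 0 -> (forall x y, S x -> S y -> S (x + y)) ->
  (forall a x, S x -> S (act a x)) ->
  (forall x, exists s y, [/\ S s, inJ y & x = s + y]) -> forall x, S x.
Proof.
move=> S0 SD SM h.
have N1 y : inJ y -> exists s y', [/\ S s, y = s + y' & forall b, rad b -> act b y' = 0].
  elim=> [|b x z rb _ [s [z' [Ss ez z'0]]]].
    by exists 0, 0; split=> // [|b _]; rewrite ?addr0 ?act0.
  have [s' [w [Ss' Jw ->]]] := h x.
  exists (act b s' + s), (act b w + z'); split; first by apply: SD => //; exact: SM.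
    by rewrite ez actD addrACA.
  by move=> c rc; rewrite actD z'0 // addr0 rad_inJ2.
have N2 y : inJ y -> S y.
  elim=> [//|b x z rb _ Sz]; apply: (SD) => //.
  have [s [w [Ss /N1[s' [w' [Ss' -> w'0]]] ->]]] := h x.
  by rewrite addrA actD (w'0 b rb) addr0; apply: SM; exact: SD.
by move=> x; have [s [y [Ss /N2 Sy ->]]] := h x; exact: SD.
Qed.

(** The projection onto a direct summand acts modulo the radical as some scalar [c];
    minus that scalar it is nilpotent, by [endo_inJ_nilp], which forces one of the
    two summands to vanish according as [c] is 1 or not. *)
Lemma scalar_mod_rad_indecomposable M : ~ is_zero M ->
  (forall f : M -> M, mhom f -> exists c, forall x, inJ (f x - c *: x)) ->
  indecomposable M.
Proof.
move=> M0 sc; split=> // X Y XY.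
case/isoP: XY => f [g [fH gH fK gK]].
have gX : mhom (fun x : X => g (x, 0)) by exact: mhom_comp (@mhom_inl _ _ _ _) gH.
have fX : mhom (fun z => (f z).1) by exact: mhom_comp fH (@mhom_fst _ _ _ _).
have gY : mhom (fun x : Y => g (0, x)) by exact: mhom_comp (@mhom_inr _ _ _ _) gH.
have [c cJ] := sc _ (mhom_comp fX gX).
have pH : mhom (fun z => g ((f z).1, 0) - c *: z).
  by apply: mhom_add; [exact: mhom_comp gX | apply: mhom_opp; apply: mhom_scale; exact: mhom_id].
have nil := endo_inJ_nilp pH cJ.
have pX (x : X) d : g ((f (d *: g (x, 0))).1, 0) - c *: (d *: g (x, 0)) = ((1 - c) * d) *: g (x, 0).
  have gXZ : g (d *: x, 0) = d *: g (x, 0) := mhomZ gX d x.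
  by rewrite (mhomZ fH) gK /= gXZ scalerA mulrBl scalerBl mul1r.
have pY (y : Y) d : g ((f (d *: g (0, y))).1, 0) - c *: (d *: g (0, y)) = (- c * d) *: g (0, y).
  by rewrite (mhomZ fH) gK /= scaler0 (mhom0 gX) sub0r scalerA mulNr scaleNr.
have [c1|nc1] := eqVneq c 1; [right | left]; apply/is_zeroP => x.
  have := nil (g (0, x)); rewrite -[g (0, x)]scale1r !pY c1 -(mhomZ gH).
  move/(congr1 (fun z => (f z).2)); rewrite gK (mhom0 fH) /= => /eqP.
  by rewrite scaler_eq0 !mulf_eq0 oppr_eq0 oner_eq0 /= => /eqP.
have := nil (g (x, 0)); rewrite -[g (x, 0)]scale1r !pX -(mhomZ gH).
move/(congr1 (fun z => (f z).1)); rewrite gK (mhom0 fH) /= => /eqP.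
by rewrite scaler_eq0 !mulf_eq0 oner_eq0 subr_eq0 eq_sym (negbTE nc1) /= => /eqP.
Qed.

End RadicalOfModule.
End Structure.

(** * Presentations *)

Section Presentations.
Variables (k : fieldType) (B : falgType k) (D : dk_structure B).
Local Notation e := (idem D).
Local Notation chi := (chi D).
Local Notation inJ := (inJ D).
Local Notation rad := (rad D).
Implicit Types M N P X Y Z : fdmod B.

Definition gen_family n (v : 'I_n -> bool) M (x : 'I_n -> M) : Prop :=
  (forall q, act (e (v q)) (x q) = x q) /\
  forall y, exists c : 'I_n -> B, y = \sum_q act (c q) (x q).

(** [M] is the cokernel of the map between sums of indecomposable projectives
    given by right multiplication with the matrix [F]; the [x q] are the images
    of the idempotents that generate the target. *)
Definition presented n m (v : 'I_n -> bool) (F : 'I_m -> 'I_n -> B) M (x : 'I_n -> M) :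
    Prop :=
  [/\ gen_family v x,
      forall l, \sum_q act (F l q) (x q) = 0
    & forall c : 'I_n -> B, \sum_q act (c q) (x q) = 0 ->
        exists d : 'I_m -> B, forall q, c q * e (v q) = \sum_l d l * F l q * e (v q)].

Definition free_on n (v : 'I_n -> bool) M (x : 'I_n -> M) : Prop :=
  presented v (fun (_ : 'I_0) _ => 0) x.

Lemma sum_delta n M (z : 'I_n -> M) q : \sum_r act ((r == q)%:R : B) (z r) = z q.
Proof.
rewrite (bigD1 q) //= eqxx act1 big1 ?addr0 // => r /negbTE ->.
by rewrite act0l.
Qed.

(** The factor [1 - e (v q)] imposes that the generators are fixed by their
    idempotents. *)
Lemma presented_exists n m (v : 'I_n -> bool) (F : 'I_m -> 'I_n -> B) :
  exists M (x : 'I_n -> M), presented v F x.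
Proof.
pose h (z : dsum (free_mod B n) (free_mod B m)) : free_mod B n :=
  [ffun q => z.1 q * (1 - e (v q)) + \sum_l z.2 l * F l q].
have hH : mhom h.
  split=> [y z|a z]; apply/ffunP => q; rewrite !ffunE /= ?ffunE.
    rewrite mulrDl addrACA -big_split; congr (_ + _); apply: eq_bigr => l _.
    by rewrite ffunE mulrDl.
  rewrite [RHS]mulrDr mulrA mulr_sumr; congr (_ + _); apply: eq_bigr => l _.
  by rewrite ffunE mulrA.
have [C [c [cH cS cK]]] := coker_exists hH.
pose delta (q : 'I_n) : free_mod B n := [ffun r => (r == q)%:R].
have cE (z : 'I_n -> B) : \sum_q act (z q) (c (delta q)) = c [ffun q => z q].
  transitivity (c (\sum_q act (z q) (delta q))).
    by rewrite (mhom_sum cH); apply: eq_bigr => q _; rewrite (mhom_act cH).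
  congr c; apply/ffunP => q; rewrite sum_ffunE ffunE (bigD1 q) //= !ffunE eqxx mulr1.
  by rewrite big1 ?addr0 // => r; rewrite !ffunE eq_sym => /negbTE ->; rewrite mulr0.
exists C, (fun q => c (delta q)); split; first split.
- move=> q; rewrite -(mhom_act cH); apply/eqP; rewrite -subr_eq0 -(mhomB cH); apply/eqP/cK.
  exists (- delta q, 0); apply/ffunP => r; rewrite !ffunE big1 => [|l _]; last first.
    by rewrite ffunE mul0r.
  rewrite addr0; case: eqP => [->|_]; last by rewrite !mulr0 oppr0 mul0r addr0.
  by rewrite mulr1 mulN1r opprB.
- move=> y; have [z <-] := cS y; exists (fun q => z q).
  by rewrite cE; congr c; apply/ffunP => q; rewrite ffunE.
- move=> l; rewrite cE; apply/cK; exists (0, [ffun l' => (l' == l)%:R]).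
  apply/ffunP => q; rewrite !ffunE mul0r add0r (bigD1 l) //= ffunE eqxx mul1r.
  by rewrite big1 ?addr0 // => l' /negbTE; rewrite ffunE => ->; rewrite mul0r.
- move=> z; rewrite cE => /cK[[z1 z2] /ffunP h']; exists (fun l => z2 l) => q.
  have := h' q; rewrite !ffunE /= => ->.
  rewrite mulrDl -mulrA mulrBl mul1r idem2 subrr mulr0 add0r mulr_suml.
  by apply: eq_bigr => l _.
Qed.

Section Maps.
Variables (n m : nat) (v : 'I_n -> bool) (F : 'I_m -> 'I_n -> B) (M : fdmod B) (x : 'I_n -> M).
Hypothesis Mp : presented v F x.

Lemma presented_gen : gen_family v x. Proof. by case: Mp. Qed.

Lemma presented_univ N (z : 'I_n -> N) : (forall q, act (e (v q)) (z q) = z q) ->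
  (forall l, \sum_q act (F l q) (z q) = 0) ->
  exists u : M -> N, mhom u /\ forall q, u (x q) = z q.
Proof.
move=> ze zF; case: Mp => -[xe xg] xF xK.
have xS y : exists c, free_map x c = y.
  have [c ->] := xg y; exists [ffun q => c q]; apply: eq_bigr => q _; by rewrite ffunE.
have [|u [uH uE]] := factor_surj (free_map_mhom x) (free_map_mhom z) xS.
  move=> c /xK[d hd]; rewrite /free_map.
  under eq_bigr => q _ do rewrite -(ze q) -actM hd act_suml.
  rewrite exchange_big big1 // => l _ /=.
  under eq_bigr => q _ do rewrite -mulrA actM actM ze.
  by rewrite -act_sumr zF act0.
exists u; split=> // q.
have E N' (w : 'I_n -> N') : free_map w [ffun r => (r == q)%:R] = w q.
  rewrite /free_map; under eq_bigr => r _ do rewrite ffunE; exact: sum_delta.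
by rewrite -(E _ x) uE E.
Qed.

Lemma gen_eq N (f g : M -> N) : mhom f -> mhom g ->
  (forall q, f (x q) = g (x q)) -> f =1 g.
Proof.
move=> fH gH fg y; have [c ->] := presented_gen.2 y.
rewrite (mhom_sum fH) (mhom_sum gH); apply: eq_bigr => q _.
by rewrite (mhom_act fH) (mhom_act gH) fg.
Qed.

Lemma presented_transport N (f : M -> N) : mhom f -> bijective f ->
  presented v F (fun q => f (x q)).
Proof.
move=> fH [g fK gK]; case: Mp => -[xe xg] xF xK.
have fS (c : 'I_n -> B) : \sum_q act (c q) (f (x q)) = f (\sum_q act (c q) (x q)).
  by rewrite (mhom_sum fH); apply: eq_bigr => q _; rewrite (mhom_act fH).
split; first split.
- by move=> q; rewrite -(mhom_act fH) xe.
- by move=> y; have [c gy] := xg (g y); exists c; rewrite fS -gy gK.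
- by move=> l; rewrite fS xF (mhom0 fH).
- by move=> c; rewrite fS -(mhom0 fH) => /(can_inj fK); exact: xK.
Qed.

Lemma presented_zero : n = 0%N -> is_zero M.
Proof.
move=> n0; apply/is_zeroP => y; have [c ->] := presented_gen.2 y.
by rewrite big1 // => -[q qn]; exfalso; rewrite n0 in qn.
Qed.

Lemma inJ_coef y : inJ y -> exists c : 'I_n -> B, (forall q, rad (c q)) /\
  y = \sum_q act (c q) (x q).
Proof.
elim=> [|b y' z rb _ [c [rc ->]]].
  by exists (fun _ => 0); split=> [q w|]; rewrite ?chi0 // big1 // => q _; rewrite act0l.
have [c' ->] := presented_gen.2 y'; exists (fun q => b * c' q + c q); split.
  by move=> q w; rewrite chiD chiM rb mul0r add0r rc.
by rewrite act_sumr -big_split; apply: eq_bigr => q _; rewrite actDl actM.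
Qed.

Lemma coef_inJ (c : 'I_n -> B) : (forall q, chi (v q) (c q) = 0) ->
  inJ (\sum_q act (c q) (x q)).
Proof.
move=> c0; apply: inJ_sum => q; rewrite -presented_gen.1 -actM; apply: inJ_act => w.
by rewrite chiM chi_idem; case: eqP => [->|_]; rewrite ?c0 ?mul0r ?mulr0.
Qed.

(** The generators stay independent modulo the radical if the relations are in it. *)
Lemma presented_inJ (c : 'I_n -> B) : (forall l q, rad (F l q)) ->
  inJ (\sum_q act (c q) (x q)) -> forall q, chi (v q) (c q) = 0.
Proof.
move=> rF /inJ_coef[c' [rc' ec]] q; case: Mp => _ _ xK.
have [|d hd] := xK (fun q => c q - c' q).
  rewrite -[RHS](subrr (\sum_q act (c q) (x q))) {2}ec -sumrB.
  by apply: eq_bigr => r _; rewrite actBl.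
have := congr1 (chi (v q)) (hd q).
rewrite chiM chi_idem eqxx mulr1 chiB rc' subr0 => ->.
by rewrite chi_sum big1 // => l _; rewrite !chiM rF mulr0 mul0r.
Qed.

End Maps.

Lemma presented_iso n m (v : 'I_n -> bool) (F : 'I_m -> 'I_n -> B) M N
    (x : 'I_n -> M) (y : 'I_n -> N) : presented v F x -> presented v F y -> iso M N.
Proof.
move=> Mp Np; have [f [fH fE]] := presented_univ Mp (presented_gen Np).1 (let: And3 _ h _ := Np in h).
have [g [gH gE]] := presented_univ Np (presented_gen Mp).1 (let: And3 _ h _ := Mp in h).
apply: (iso_of fH (g := g)).
  by apply: (gen_eq Mp (mhom_comp fH gH) (mhom_id M)) => q; rewrite fE gE.
by apply: (gen_eq Np (mhom_comp gH fH) (mhom_id N)) => q; rewrite gE fE.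
Qed.

Lemma free_univ n (v : 'I_n -> bool) M (x : 'I_n -> M) N (z : 'I_n -> N) :
  free_on v x -> (forall q, act (e (v q)) (z q) = z q) ->
  exists u : M -> N, mhom u /\ forall q, u (x q) = z q.
Proof. by move=> Mf ze; apply: (presented_univ Mf ze) => -[]. Qed.

Lemma free_inJ n (v : 'I_n -> bool) M (x : 'I_n -> M) (c : 'I_n -> B) : free_on v x ->
  inJ (\sum_q act (c q) (x q)) -> forall q, chi (v q) (c q) = 0.
Proof. by move=> Mf; apply: (presented_inJ Mf) => -[]. Qed.

Lemma free_projective n (v : 'I_n -> bool) P (x : 'I_n -> P) : free_on v x -> projective P.
Proof.
move=> Pf; apply/projectiveP => X Y g f gH gS fH.
have [z zE] := fin_all_exists (fun q => gS (f (x q))).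
have [|h [hH hE]] := @free_univ _ _ _ _ _ (fun q => act (e (v q)) (z q)) Pf.
  by move=> q; rewrite -actM idem2.
exists h; split=> //; apply: (gen_eq Pf (mhom_comp hH gH) fH) => q.
by rewrite hE (mhom_act gH) zE -(mhom_act fH) (presented_gen Pf).1.
Qed.

Lemma gen_family_exists M : exists n (v : 'I_n -> bool) (x : 'I_n -> M), gen_family v x.
Proof.
pose n := \dim {:M}; pose b (l : 'I_n) := (vbasis {:M})`_l.
exists (n + n)%N, (fun q => if split q is inl _ then false else true),
  (fun q => match split q with inl l => act (e false) (b l) | inr l => act (e true) (b l) end).
split=> [q|y]; first by case: (split q) => l; rewrite -actM idem2.
exists (fun q => match split q with inl l | inr l => coord (vbasis {:M}) l y *: 1 end).
rewrite big_split_ord /= -big_split /= {1}[y](coord_vbasis (memvf y)).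
apply: eq_bigr => l _.
rewrite (unsplitK (inl l : 'I_n + 'I_n)) (unsplitK (inr l : 'I_n + 'I_n)).
by rewrite -actD -actDl idem_sum act1 actZl act1.
Qed.

(** A generator that occurs in a relation with an invertible coefficient is
    superfluous. *)
Lemma gen_family_minimal M n (v : 'I_n -> bool) (x : 'I_n -> M) : gen_family v x ->
  exists n' (v' : 'I_n' -> bool) (x' : 'I_n' -> M), gen_family v' x' /\
    forall c : 'I_n' -> B, \sum_q act (c q) (x' q) = 0 -> forall q, chi (v' q) (c q) = 0.
Proof.
elim: n v x => [|n IH] v x xg; first by exists 0%N, v, x; split=> // c _ [].
case: (classic (exists c : 'I_n.+1 -> B, \sum_q act (c q) (x q) = 0 /\
    exists q, chi (v q) (c q) != 0)) => [[c [c0 [q0 cq0]]]|h]; last first.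
  exists n.+1, v, x; split=> // c c0 q; apply/eqP; apply: NNPP => nz.
  by case: h; exists c; split=> //; exists q; apply/negP.
set i := v q0 in cq0; set lam := chi i (c q0) in cq0.
have [w [ew rw cw]] := corner_split (cornerE D i i (c q0)).
have {}ew : e i * c q0 * e i = lam *: e i + w.
  by rewrite {1}ew !chiM chi_idem eqxx mul1r mulr1.
have ww : w * w = 0 by have [] := rad_corner0 rw rw cw.
pose u := lam^-1 *: e i - (lam^-1 * lam^-1) *: w.
have uE : u * (e i * c q0 * e i) = e i.
  rewrite ew /u mulrBl !mulrDr -!scalerAl -!scalerAr ww idem2 cw.1 cw.2.
  by rewrite !scaler0 addr0 !scalerA mulVf // scale1r -mulrA mulVf // mulr1 addrK.
have xq0 : x q0 = - \sum_(q < n) act (u * e i * c (lift q0 q)) (x (lift q0 q)).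
  apply/eqP; rewrite -addr_eq0 -[X in X + _]xg.1 -/i -{1}uE; apply/eqP.
  rewrite !mulrA -(mulrA _ (e i)) actM -/i -[act (e i) (x q0)]/(act (e (v q0)) (x q0)) xg.1.
  transitivity (act (u * e i) (\sum_q act (c q) (x q))); last by rewrite c0 act0.
  rewrite (bigD1_ord q0) //= actD act_sumr -actM; congr (_ + _); first by rewrite mulrA.
  by apply: eq_bigr => q _; rewrite actM.
apply: (IH (fun q => v (lift q0 q)) (fun q => x (lift q0 q))).
split=> [q|y]; first exact: xg.1.
have [d ->] := xg.2 y.
exists (fun q => d (lift q0 q) - d q0 * (u * e i * c (lift q0 q))).
rewrite (bigD1_ord q0) //= xq0 actN act_sumr -sumrN -big_split.
by apply: eq_bigr => q _; rewrite /= -actM actBl addrC.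
Qed.

End Presentations.

(** * [tau]-rigid modules in coordinates *)

Section TauRigidPresentations.
Variables (k : fieldType) (B : falgType k) (D : dk_structure B).
Local Notation e := (idem D).
Local Notation chi := (chi D).
Local Notation inJ := (inJ D).
Local Notation rad := (rad D).
Local Notation free_on := (free_on D).
Local Notation presented := (presented D).
Implicit Types M N P X Y Z : fdmod B.

(** Over a minimal generating family the free cover of [P] has its kernel in the
    radical; as it splits, the projection onto the kernel is an idempotent
    endomorphism into the radical, hence zero. *)
Lemma projective_free P : projective P ->
  exists n (v : 'I_n -> bool) (x : 'I_n -> P), free_on v x.
Proof.
move=> /projectiveP Pp; have [n0 [v0 [x0 xg0]]] := gen_family_exists D P.
have [n [v [x [xg xr]]]] := gen_family_minimal xg0.
have [F [z Ff]] := presented_exists D v (fun (_ : 'I_0) _ => 0).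
have [pi [piH piE]] := free_univ Ff xg.1.
have piS c : pi (\sum_q act (c q) (z q)) = \sum_q act (c q) (x q).
  by rewrite (mhom_sum piH); apply: eq_bigr => q _; rewrite (mhom_act piH) piE.
have pi_surj y : exists w, pi w = y.
  by have [c ->] := xg.2 y; exists (\sum_q act (c q) (z q)).
have [s [sH sE]] := Pp _ _ pi (fun y => y) piH pi_surj (mhom_id P).
have kH : mhom (fun w => w - s (pi w)).
  by apply: mhom_add; [exact: mhom_id | apply: mhom_opp; exact: mhom_comp piH sH].
have kJ w : inJ (w - s (pi w)).
  have [c ew] := (presented_gen Ff).2 (w - s (pi w)); rewrite ew.
  by apply: (coef_inJ Ff); apply: xr; rewrite -piS -ew (mhomB piH) sE subrr.
have k0 w : s (pi w) = w.
  have idk y : pi (y - s (pi y)) = 0 by rewrite (mhomB piH) sE subrr.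
  have ks y : y - s (pi y) - s (pi (y - s (pi y))) = y - s (pi y).
    by rewrite idk (mhom0 sH) subr0.
  by have /eqP := endo_inJ_nilp kH kJ w; rewrite /= !ks subr_eq0 => /eqP.
exists n, v, (fun q => pi (z q)); apply: (presented_transport Ff piH).
by exists s.
Qed.

Lemma superfluous_inJ n (v : 'I_n -> bool) P (x : 'I_n -> P) N (f : 'Hom(P, N)) y :
  free_on v x -> is_hom f -> superfluous_kernel f -> f y = 0 -> inJ y.
Proof.
move=> Pf fH fs fy; have [c ey] := (presented_gen Pf).2 y.
rewrite ey; apply: (coef_inJ Pf) => q0; apply: NNPP => cq0.
set i := v q0 in cq0; set lam := chi i (c q0) in cq0.
have [w [ew rw cw]] := corner_split (cornerE D i i (c q0)).
have {}ew : e i * c q0 * e i = lam *: e i + w.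
  by rewrite {1}ew !chiM chi_idem eqxx mul1r mulr1.
(* If [y] involved the generator [x q0] with an invertible coefficient, the other
   generators and a radical multiple of [x q0] would span a proper submodule with
   the same image under [f]. *)
have xe := (presented_gen Pf).1.
pose z q := if q == q0 then act w (x q0) else x q.
have [|h [hH hE]] := @free_univ _ _ D _ _ _ _ _ z Pf.
  move=> q; rewrite /z; case: eqP => [->|_]; last exact: xe.
  by rewrite -actM cw.1.
have [H [HH HE]] := mhom_lfun hH; have fM := is_hom_mhom fH.
have hq0 : h (x q0) = act w (x q0) by rewrite hE /z eqxx.
have hq q : q != q0 -> h (x q) = x q by move=> /negbTE nq; rewrite hE /z nq.
pose T := \sum_(q | q != q0) act (e i * c q) (x q) + x q0.
have key : lam *: x q0 + h T = act (e i) y.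
  rewrite /T (mhomD hH) hq0 (mhom_sum hH) ey act_sumr [RHS](bigD1 q0) //= addrCA [LHS]addrC.
  congr (_ + _); last first.
    by apply: eq_bigr => q nq; rewrite (mhom_act hH) hq // actM.
  have -> : lam *: x q0 = act (lam *: e i) (x q0) by rewrite actZl xe.
  by rewrite -actDl -ew actM xe actM.
have Hs : surj H.
  apply: (fs _ H HH); apply/vspaceP => u; apply/idP/idP.
    case/memv_imgP => t _ ->; rewrite comp_lfunE; exact: memv_img (memvf _).
  case/memv_imgP => t _ ->; have [d ->] := (presented_gen Pf).2 t.
  rewrite (mhom_sum fM); apply: memv_suml => q _.
  have [tq etq] : exists tq, f (x q) = f (h tq).
    have [->|nq] := eqVneq q q0; last by exists (x q); rewrite hq.
    exists (- lam^-1 *: T); rewrite (mhomZ hH) (mhomZ fM).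
    have : f (lam *: x q0 + h T) = 0 by rewrite key (mhom_act fM) fy act0.
    rewrite (mhomD fM) (mhomZ fM) => /eqP; rewrite addr_eq0 => /eqP E.
    rewrite scaleNr -scalerN -E scalerA mulVf ?scale1r //.
    by apply/eqP => l0; apply: cq0; rewrite -/lam l0.
  by rewrite (mhom_act fM) etq -(mhom_act fM) -(mhom_act hH) -HE -comp_lfunE memv_img ?memvf.
have [t ht] := (surjP H).1 Hs (x q0).
have [d ed] := (presented_gen Pf).2 t.
have : inJ (\sum_q act (if q == q0 then 1 - d q * w else - d q) (x q)).
  rewrite (_ : \sum_q _ = 0); first exact: inJ0.
  rewrite (bigD1 q0) //= eqxx actBl act1 -addrA; apply/eqP; rewrite addr_eq0; apply/eqP.
  rewrite -[LHS]ht HE ed (mhom_sum hH) (bigD1 q0) //= opprD opprK.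
  rewrite (mhom_act hH) hq0 actM; congr (_ + _).
  rewrite -sumrN; apply: eq_bigr => q nq.
  by rewrite (negbTE nq) actNl (mhom_act hH) hq // opprK.
move/(free_inJ Pf)/(_ q0).
rewrite eqxx chiB chi1 chiM rw mulr0 subr0 => /eqP; by rewrite oner_eq0.
Qed.

(** The image of [h] and the kernel of [f] together span [P]; as the kernel is in the
    radical, Nakayama's lemma shows that [h] is onto. *)
Lemma inJ_superfluous P N (f : 'Hom(P, N)) : is_hom f ->
  (forall y, f y = 0 -> inJ y) -> superfluous_kernel f.
Proof.
move=> fH fJ X h hH e1; have hM := is_hom_mhom hH; apply/surjP.
apply: (nakayama (D := D)).
- by exists 0; rewrite linear0.
- by move=> _ _ [x <-] [y <-]; exists (x + y); rewrite linearD.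
- by move=> a _ [x <-]; exists (act a x); rewrite hH.
move=> y; have : f y \in limg f by rewrite memv_img ?memvf.
rewrite -e1 => /memv_imgP[t _]; rewrite comp_lfunE => ft.
exists (h t), (y - h t); split; first by exists t.
  by apply: fJ; rewrite (mhomB (is_hom_mhom fH)) ft subrr.
by rewrite addrC subrK.
Qed.

(** The defining data of a [tau]-rigid module in coordinates: a minimal
    presentation by a radical matrix [F], along which every tuple of the right
    vertices in [M] can be solved for. *)
Definition tau_data n0 (v0 : 'I_n0 -> bool) n1 (v1 : 'I_n1 -> bool)
    (F : 'I_n1 -> 'I_n0 -> B) M (x : 'I_n0 -> M) : Prop :=
  [/\ presented v0 F x,
      forall l q, corner D (v1 l) (v0 q) (F l q) /\ rad (F l q),
      forall d : 'I_n1 -> B, (forall q, \sum_l d l * F l q = 0) ->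
        forall l, chi (v1 l) (d l) = 0
    & forall z : 'I_n1 -> M, (forall l, act (e (v1 l)) (z l) = z l) ->
        exists u : 'I_n0 -> M, (forall q, act (e (v0 q)) (u q) = u q) /\
          forall l, z l = \sum_q act (F l q) (u q)].

Lemma tau_rigid_of_data n0 (v0 : 'I_n0 -> bool) n1 (v1 : 'I_n1 -> bool)
    (F : 'I_n1 -> 'I_n0 -> B) M (x : 'I_n0 -> M) : tau_data v0 v1 F x -> tau_rigid M.
Proof.
case=> Mp Fc Fmin Flift; apply/tau_rigidP.
have [P0 [x0 Pf0]] := presented_exists D v0 (fun (_ : 'I_0) _ => 0).
have [P1 [y0 Pf1]] := presented_exists D v1 (fun (_ : 'I_0) _ => 0).
have [|f [fH fE]] := @free_univ _ _ D _ _ _ _ _ (fun l => \sum_q act (F l q) (x0 q)) Pf1.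
  move=> l; rewrite act_sumr; apply: eq_bigr => q _.
  by rewrite -actM (Fc l q).1.1.
have [g [gH gE]] := free_univ Pf0 (presented_gen Mp).1.
have [G [GH GE]] := mhom_lfun gH; have [f' [FH FE]] := mhom_lfun fH.
case: (Mp) => -[xe xg] xF xK.
have fS (d : 'I_n1 -> B) : f (\sum_l act (d l) (y0 l)) = \sum_q act (\sum_l d l * F l q) (x0 q).
  rewrite (mhom_sum fH); under eq_bigr => l _ do rewrite (mhom_act fH) fE act_sumr.
  rewrite exchange_big; apply: eq_bigr => q _ /=; rewrite act_suml.
  by apply: eq_bigr => l _; rewrite actM.
have gS (c : 'I_n0 -> B) : g (\sum_q act (c q) (x0 q)) = \sum_q act (c q) (x q).
  by rewrite (mhom_sum gH); apply: eq_bigr => q _; rewrite (mhom_act gH) gE.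
have gf0 t : g (f t) = 0.
  apply: (gen_eq Pf1 (mhom_comp fH gH) (mhom_zero _ _)) => l.
  by rewrite fE gS xF.
have kerg y : g y = 0 -> exists t, y = f t.
  have [c ->] := (presented_gen Pf0).2 y; rewrite gS => /xK[d hd].
  exists (\sum_l act (d l) (y0 l)); rewrite fS; apply: eq_bigr => q _.
  rewrite -[x0 q in LHS](presented_gen Pf0).1 -actM hd; congr act.
  by apply: eq_bigr => l _; rewrite -mulrA (Fc l q).1.2.
exists P1, P0, f', G; split; first split.
- by split; [exact: free_projective Pf1 | exact: free_projective Pf0].
- by [].
- split.
    apply/surjP => y; have [c ->] := xg y; exists (\sum_q act (c q) (x0 q)).
    by rewrite GE gS.
  apply/vspaceP => y; rewrite memv_ker GE; apply/memv_imgP/eqP => [[t _ ->]|/kerg[t ->]].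
    by rewrite FE gf0.
  by exists t; rewrite ?memvf ?FE.
- split; apply: inJ_superfluous => // y.
    rewrite FE; have [d ->] := (presented_gen Pf1).2 y; rewrite fS => h.
    apply: (coef_inJ Pf1); apply: Fmin => q; case: Pf0 => _ _ /(_ _ h) [d' /(_ q)].
    rewrite big_ord0 mulr_suml => E; rewrite -[RHS]E; apply: eq_bigr => l _.
    by rewrite -mulrA (Fc l q).1.2.
  rewrite GE => /kerg[t ->]; have [d ->] := (presented_gen Pf1).2 t.
  rewrite fS; apply: (coef_inJ Pf0) => q; rewrite chi_sum big1 // => l _.
  by rewrite chiM (Fc l q).2 mulr0.
move=> w wH; have [|u [ue uz]] := Flift (fun l => w (y0 l)).
  by move=> l; rewrite -(mhom_act wH) (presented_gen Pf1).1.
have [U [UH UE]] := free_univ Pf0 ue; exists U; split=> // t; rewrite FE.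
apply: (gen_eq Pf1 wH (mhom_comp fH UH)) => l.
rewrite uz fE (mhom_sum UH); apply: eq_bigr => q _.
by rewrite (mhom_act UH) UE.
Qed.

Lemma tau_rigid_data M : tau_rigid M ->
  exists n0 (v0 : 'I_n0 -> bool) n1 (v1 : 'I_n1 -> bool) F (x : 'I_n0 -> M),
    tau_data v0 v1 F x.
Proof.
case/tau_rigidP => P1 [P0 [f [g [[[P1p P0p] [fH gH] [gS fg] [fs gs]] lifts]]]].
have [n0 [v0 [x0 Pf0]]] := projective_free P0p.
have [n1 [v1 [y0 Pf1]]] := projective_free P1p.
have fM := is_hom_mhom fH; have gM := is_hom_mhom gH.
have [C hC] := fin_all_exists (fun l => (presented_gen Pf0).2 (f (y0 l))).
pose F l q := e (v1 l) * C l q * e (v0 q).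
have Fc l q : corner D (v1 l) (v0 q) (F l q) by exact: cornerE.
have fE l : f (y0 l) = \sum_q act (F l q) (x0 q).
  rewrite -[in LHS](presented_gen Pf1).1 (mhom_act fM) hC act_sumr.
  by apply: eq_bigr => q _; rewrite -{1}(presented_gen Pf0).1 -!actM.
have gf t : g (f t) = 0.
  by apply/eqP; rewrite -memv_ker -fg memv_img ?memvf.
have fS (d : 'I_n1 -> B) : f (\sum_l act (d l) (y0 l)) = \sum_q act (\sum_l d l * F l q) (x0 q).
  rewrite (mhom_sum fM); under eq_bigr => l _ do rewrite (mhom_act fM) fE act_sumr.
  rewrite exchange_big; apply: eq_bigr => q _ /=; rewrite act_suml.
  by apply: eq_bigr => l _; rewrite actM.
have gS' (c : 'I_n0 -> B) : g (\sum_q act (c q) (x0 q)) = \sum_q act (c q) (g (x0 q)).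
  by rewrite (mhom_sum gM); apply: eq_bigr => q _; rewrite (mhom_act gM).
have no0 (n : nat) (v : 'I_n -> bool) P (z : 'I_n -> P) : free_on v z ->
    forall c : 'I_n -> B, \sum_q act (c q) (z q) = 0 -> forall q, c q * e (v q) = 0.
  by case=> _ _ h c /h[d hd] q; rewrite hd big_ord0.
exists n0, v0, n1, v1, F, (fun q => g (x0 q)); split.
- split; first split.
  + by move=> q; rewrite -(mhom_act gM) (presented_gen Pf0).1.
  + move=> y; have [t <-] := (surjP g).1 gS y.
    by have [c ->] := (presented_gen Pf0).2 t; exists c; rewrite gS'.
  + by move=> l; rewrite -gS' -fE gf.
  + move=> c; rewrite -gS' => h.
    have : \sum_q act (c q) (x0 q) \in lker g by rewrite memv_ker h.
    rewrite -fg => /memv_imgP[t _]; have [d ->] := (presented_gen Pf1).2 t.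
    rewrite fS => E; exists d => q; apply/eqP; rewrite -subr_eq0 -mulr_suml -mulrBl; apply/eqP.
    apply: (no0 _ _ _ _ Pf0 (fun q => c q - \sum_l d l * F l q)).
    under eq_bigr => r _ do rewrite actBl.
    by rewrite sumrB E subrr.
- move=> l q; split=> // w; have : inJ (f (y0 l)) by apply: superfluous_inJ Pf0 gH gs (gf _).
  rewrite fE => /(free_inJ Pf0)/(_ q) h.
  rewrite -(Fc l q).2 chiM chi_idem; case: eqP => [->|_]; by rewrite ?h ?mul0r ?mulr0.
- move=> d h l; have : inJ (\sum_l act (d l) (y0 l)).
    apply: superfluous_inJ Pf1 fH fs _; rewrite fS big1 // => q _.
    by rewrite h act0l.
  by move/(free_inJ Pf1)/(_ l).
- move=> z ze; have [w [wH wE]] := free_univ Pf1 ze.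
  have [u [uH uE]] := lifts w wH; exists (fun q => u (x0 q)); split=> [q|l].
    by rewrite -(mhom_act uH) (presented_gen Pf0).1.
  rewrite -wE uE fE (mhom_sum uH); apply: eq_bigr => q _.
  by rewrite (mhom_act uH).
Qed.

(** Sign coherence: a common vertex would let a generator be solved for inside
    the radical. *)
Lemma tau_data_neq n0 (v0 : 'I_n0 -> bool) n1 (v1 : 'I_n1 -> bool)
    (F : 'I_n1 -> 'I_n0 -> B) M (x : 'I_n0 -> M) : tau_data v0 v1 F x ->
  forall l q, v1 l = ~~ v0 q.
Proof.
case=> Mp Fc _ Flift l q; have [vlq|] := eqVneq (v1 l) (v0 q); last first.
  by case: (v1 l) (v0 q) => [] [].
have [|u [_ uz]] := Flift (fun l' => if l' == l then x q else 0).
  move=> l'; case: eqP => [->|_]; last exact: act0.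
  by rewrite vlq (presented_gen Mp).1.
have : inJ (\sum_r act ((r == q)%:R : B) (x r)).
  rewrite sum_delta; move: (uz l); rewrite eqxx => ->.
  by apply: inJ_sum => r; apply: inJ_act; exact: (Fc l r).2.
move/(presented_inJ Mp (fun l q => (Fc l q).2)) => /(_ q).
by rewrite eqxx chi1 => /eqP; rewrite oner_eq0.
Qed.

Lemma free_tau_rigid n (v : 'I_n -> bool) M (x : 'I_n -> M) : free_on v x -> tau_rigid M.
Proof.
move=> Mf; apply: (@tau_rigid_of_data _ v 0 (fun _ => true) (fun _ _ => 0) _ x).
split=> //; [by case | by move=> d _ [] |].
move=> z _; exists (fun _ => 0); split=> [q|[]//]; exact: act0.
Qed.

End TauRigidPresentations.

(** * Rigid matrix pencils *)

Section Pencils.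
Variable k : fieldType.

(** A pencil is a representation of the Kronecker quiver, its two matrices acting on
    row vectors; [b] and [a] are the dimensions of its source and of its target. *)
Definition phom b a b' a' (f1 f2 : 'M[k]_(b, a)) (g1 g2 : 'M[k]_(b', a'))
    (s : 'M[k]_(b, b')) (t : 'M[k]_(a, a')) : Prop :=
  f1 *m t = s *m g1 /\ f2 *m t = s *m g2.

(** The extensions of one pencil by the other are the cokernel of the map
    [(s, t) |-> s g + f t], whose kernel is [phom] up to the sign of [t]. *)
Definition pext b a b' a' (f1 f2 : 'M[k]_(b, a)) (g1 g2 : 'M[k]_(b', a')) : Prop :=
  forall h1 h2 : 'M[k]_(b, a'), exists (s : 'M[k]_(b, b')) (t : 'M[k]_(a, a')),
    h1 = s *m g1 + f1 *m t /\ h2 = s *m g2 + f2 *m t.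

Definition prigid b a (f1 f2 : 'M[k]_(b, a)) : Prop := pext f1 f2 f1 f2.

Definition row_inj b a (f1 f2 : 'M[k]_(b, a)) : Prop :=
  forall n (u : 'M[k]_(n, b)), u *m f1 = 0 -> u *m f2 = 0 -> u = 0.

Lemma pext_tr b a b' a' (f1 f2 : 'M[k]_(b, a)) (g1 g2 : 'M[k]_(b', a')) :
  pext f1 f2 g1 g2 -> pext g1^T g2^T f1^T f2^T.
Proof.
move=> h h1 h2; have [s [t [e1 e2]]] := h h1^T h2^T; exists t^T, s^T.
by split; rewrite -[LHS]trmxK ?e1 ?e2 linearD /= !trmx_mul addrC.
Qed.

Lemma phom_tr b a b' a' (f1 f2 : 'M[k]_(b, a)) (g1 g2 : 'M[k]_(b', a')) s t :
  phom f1 f2 g1 g2 s t -> phom g1^T g2^T f1^T f2^T t^T s^T.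
Proof. by move=> [e1 e2]; split; rewrite -!trmx_mul ?e1 ?e2. Qed.

(** The pencil [f], read as a map from two copies of the source to the target, is
    onto with kernel the pencil [g]: the sequence formed by [row_mx (- g2) g1] and
    [col_mx f1 f2] is split exact, with contraction [G1 G2 F1 F2].  This is the
    reflection functor for Kronecker modules. *)
Definition reflection b a d (f1 f2 : 'M[k]_(b, a)) (g1 g2 : 'M[k]_(d, b)) : Prop :=
  exists (G1 G2 : 'M[k]_(b, d)) (F1 F2 : 'M[k]_(a, b)),
  [/\ g1 *m f2 = g2 *m f1, g1 *m G2 - g2 *m G1 = 1%:M, F1 *m f1 + F2 *m f2 = 1%:M &
    [/\ f1 *m F1 - G1 *m g2 = 1%:M, G1 *m g1 + f1 *m F2 = 0,
        f2 *m F1 - G2 *m g2 = 0 & G2 *m g1 + f2 *m F2 = 1%:M]].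

Section Reflection.
Variables (b a d : nat) (f1 f2 : 'M[k]_(b, a)) (g1 g2 : 'M[k]_(d, b)).
Hypothesis R : reflection f1 f2 g1 g2.

Lemma refl_comm : g1 *m f2 = g2 *m f1.
Proof. by case: R => [? [? [? [? [h _ _ _]]]]]. Qed.

Lemma refl_ker n (u1 u2 : 'M[k]_(n, b)) : u1 *m f1 + u2 *m f2 = 0 ->
  exists v, u1 = - (v *m g2) /\ u2 = v *m g1.
Proof.
case: R => [G1 [G2 [F1 [F2 [_ _ _ [e1 e2 e3 e4]]]]]] h.
move/eqP: h; rewrite addr_eq0 => /eqP h.
move/eqP: e3; rewrite subr_eq0 => /eqP e3; move/eqP: e2; rewrite addr_eq0 => /eqP e2.
exists (u1 *m G1 + u2 *m G2); split.
  have E : u1 *m f1 *m F1 = - (u2 *m G2 *m g2) by rewrite h mulNmx -!mulmxA e3.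
  by rewrite -[LHS]mulmx1 -e1 mulmxBr mulmxDl !mulmxA E opprD addrC.
have E : u2 *m f2 *m F2 = u1 *m G1 *m g1.
  by rewrite -[u2 *m f2]opprK -h mulNmx -!mulmxA e2 mulmxN.
by rewrite -[LHS]mulmx1 -e4 mulmxDr mulmxDl !mulmxA E addrC.
Qed.

Lemma refl_coker n (x1 x2 : 'M[k]_(b, n)) : g1 *m x2 = g2 *m x1 ->
  exists t, x1 = f1 *m t /\ x2 = f2 *m t.
Proof.
case: R => [G1 [G2 [F1 [F2 [_ _ _ [e1 e2 e3 e4]]]]]] h.
move/eqP: e3; rewrite subr_eq0 => /eqP e3; move/eqP: e2; rewrite addr_eq0 => /eqP e2.
exists (F1 *m x1 + F2 *m x2); rewrite !mulmxDr !mulmxA; split.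
  have E : f1 *m F2 *m x2 = - (G1 *m g2 *m x1).
    by rewrite -[f1 *m F2]opprK -e2 mulNmx -!mulmxA h.
  by rewrite E -mulmxBl e1 mul1mx.
have E : f2 *m F1 *m x1 = G2 *m g1 *m x2 by rewrite e3 -!mulmxA h.
by rewrite E -mulmxDl e4 mul1mx.
Qed.

Lemma refl_split : exists F1 F2 : 'M[k]_(a, b), F1 *m f1 + F2 *m f2 = 1%:M.
Proof. by case: R => [? [? [F1 [F2 [_ _ h _]]]]]; exists F1, F2. Qed.

Lemma refl_row_inj : row_inj g1 g2.
Proof.
case: R => [G1 [G2 [_ [_ [_ h _ _]]]]] n u u1 u2.
by rewrite -[u]mulmx1 -h mulmxBr !mulmxA u1 u2 !mul0mx subrr.
Qed.

Lemma refl_eq n (t t' : 'M[k]_(a, n)) : f1 *m t = f1 *m t' -> f2 *m t = f2 *m t' -> t = t'.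
Proof.
have [F1 [F2 h]] := refl_split => e1 e2.
by rewrite -[t]mul1mx -h mulmxDl -!mulmxA e1 e2 !mulmxA -mulmxDl h mul1mx.
Qed.

(** On the targets these two morphisms are jointly onto, by [refl_split]; in a chain
    of reflections they make each module a quotient of two copies of the one
    before. *)
Lemma refl_phom1 : phom g1 g2 f1 f2 g1 f1.
Proof. by split; rewrite ?refl_comm. Qed.
Lemma refl_phom2 : phom g1 g2 f1 f2 g2 f2.
Proof. by split; rewrite ?refl_comm. Qed.

End Reflection.

Section ReflectionPairs.
Variables (b a d : nat) (f1 f2 : 'M[k]_(b, a)) (g1 g2 : 'M[k]_(d, b)).
Variables (b' a' d' : nat) (f1' f2' : 'M[k]_(b', a')) (g1' g2' : 'M[k]_(d', b')).
Hypotheses (R : reflection f1 f2 g1 g2) (R' : reflection f1' f2' g1' g2').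

Lemma refl_phom s t : phom g1 g2 g1' g2' s t -> exists t', phom f1 f2 f1' f2' t t'.
Proof.
move=> [e1 e2]; have [|t' [h1 h2]] := refl_coker R (x1 := t *m f1') (x2 := t *m f2').
  by rewrite !mulmxA e1 e2 -!mulmxA (refl_comm R').
by exists t'.
Qed.

Lemma unrefl_phom s t : phom f1 f2 f1' f2' s t -> exists s', phom g1 g2 g1' g2' s' s.
Proof.
move=> [e1 e2]; have [|v [h1 h2]] := refl_ker R' (u1 := - (g2 *m s)) (u2 := g1 *m s).
  by rewrite mulNmx -!mulmxA -e1 -e2 !mulmxA (refl_comm R) addNr.
by exists v; split=> //; apply: oppr_inj.
Qed.

Lemma refl_phom0 : (forall s t, phom g1 g2 g1' g2' s t -> t = 0) ->
  forall s t, phom f1 f2 f1' f2' s t -> s = 0 /\ t = 0.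
Proof.
move=> h s t st; have [s' /h s0] := unrefl_phom st; split=> //.
by case: st => e1 e2; apply: (refl_eq R); rewrite mulmx0 ?e1 ?e2 s0 mul0mx.
Qed.

Lemma pext_refl : pext f1 f2 f1' f2' -> pext g1 g2 g1' g2'.
Proof.
move=> E h1 h2; pose y := h1 *m f2' - h2 *m f1'.
case: (R) => [G1 [G2 [_ [_ [_ hG _ _]]]]].
have [s [t [e1 e2]]] := E (G1 *m y) (G2 *m y).
have ey : y = g1 *m s *m f2' - g2 *m s *m f1'.
  rewrite -[LHS]mul1mx -hG mulmxBl -!mulmxA e1 e2 !mulmxDr opprD addrACA.
  by rewrite !mulmxA (refl_comm R) subrr addr0.
have [|v [h h']] := refl_ker R' (u1 := g2 *m s - h2) (u2 := h1 - g1 *m s).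
  rewrite !mulmxBl -[RHS](subrr y) {2}ey opprB /y.
  by rewrite addrC addrACA [X in _ + X]addrC -addrACA.
exists v, s; rewrite -h' subrK; split=> //.
by rewrite -[v *m g2']opprK -h opprB subrK.
Qed.

Lemma pext_unrefl : pext g1 g2 g1' g2' -> pext f1 f2 f1' f2'.
Proof.
move=> E h1 h2; pose y := g1 *m h2 - g2 *m h1.
have [F1 [F2 hF]] := refl_split R'.
have [s [t [e1 e2]]] := E (y *m F2) (- (y *m F1)).
have ey : y = g1 *m t *m f2' - g2 *m t *m f1'.
  rewrite -[LHS]mulmx1 -hF mulmxDr !mulmxA -[y *m F1]opprK e1 e2.
  rewrite mulNmx !mulmxDl opprD -!(mulmxA s) (refl_comm R').
  by rewrite addrC addrACA subrr add0r.
have [|t' [h h']] := refl_coker R (x1 := h1 - t *m f1') (x2 := h2 - t *m f2').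
  apply/eqP; rewrite -subr_eq0 !mulmxBr opprB !mulmxA; apply/eqP.
  rewrite -[RHS](subrr y) {2}ey opprB /y.
  by rewrite addrACA [X in _ + X]addrC -addrACA.
by exists t, t'; rewrite -h -h' ![t *m _ + _]addrC !subrK.
Qed.

End ReflectionPairs.

(** Otherwise the pencil would have a nontrivial extension by itself, concentrated on
    a kernel vector and a cokernel vector. *)
Lemma prigid_full b a (f1 f2 : 'M[k]_(b, a)) : prigid f1 f2 ->
  row_free (col_mx f1 f2) \/ row_full (col_mx f1 f2).
Proof.
move=> E; set F := col_mx f1 f2; case: (boolP (row_free F)) => [|nf]; [by left | right].
rewrite -cokermx_eq0; apply/negPn/negP => /matrix0Pn[r [c Yrc]].
move: nf; rewrite -kermx_eq0 => /matrix0Pn[i [j Uij]].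
set Y := cokermx F in Yrc; set U := kermx F in Uij.
have UF : lsubmx U *m f1 + rsubmx U *m f2 = 0.
  by rewrite -mul_row_col hsubmxK mulmx_ker.
have FY : f1 *m Y = 0 /\ f2 *m Y = 0.
  by apply: eq_col_mx; rewrite -mul_col_mx mulmx_coker col_mx0.
have key h1 h2 : lsubmx U *m h1 *m Y + rsubmx U *m h2 *m Y = 0.
  have [s [t [-> ->]]] := E h1 h2.
  rewrite !mulmxDr !mulmxDl -!mulmxA FY.1 FY.2 !mulmx0 !add0r !mulmxA -!mulmxDl.
  by rewrite UF !mul0mx.
have entry n (V : 'M[k]_(n, b)) (i' : 'I_n) l : (V *m delta_mx l r *m Y) i' c = V i' l * Y r c.
  rewrite mxE (bigD1 r) //= mxE (bigD1 l) //= mxE !eqxx mulr1.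
  rewrite big1 ?addr0 => [|l' /negbTE nl]; last by rewrite mxE nl mulr0.
  rewrite big1 ?addr0 // => r' /negbTE nr; rewrite mxE big1 ?mul0r // => l' _.
  by rewrite mxE nr andbF mulr0.
case: (split_ordP j) Uij => l -> Uil.
  have /matrixP/(_ i c) := key (delta_mx l r) 0.
  have lE : lsubmx U i l = U i (lshift b l) by rewrite mxE.
  rewrite mulmx0 mul0mx addr0 entry lE [RHS]mxE => /eqP.
  by rewrite mulf_eq0 (negbTE Uil) (negbTE Yrc).
have /matrixP/(_ i c) := key 0 (delta_mx l r).
have rE : rsubmx U i l = U i (rshift b l) by rewrite mxE.
rewrite mulmx0 mul0mx add0r entry rE [RHS]mxE => /eqP.
by rewrite mulf_eq0 (negbTE Uil) (negbTE Yrc).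
Qed.

(** The kernel of a surjective matrix, with the contraction given by a right inverse
    of it. *)
Lemma reflection_exists b a (f1 f2 : 'M[k]_(b, a)) : row_full (col_mx f1 f2) ->
  exists d (g1 g2 : 'M[k]_(d, b)), (d + a = b + b)%N /\ reflection f1 f2 g1 g2.
Proof.
set F := col_mx f1 f2 => Ff; pose K := row_base (kermx F); pose F' := pinvmx F.
have F'F : F' *m F = 1%:M by exact: mulVpmx.
have KF : K *m F = 0 by apply/sub_kermxP; rewrite eq_row_base.
have [K' eK'] : exists K', 1%:M - F *m F' = K' *m K.
  apply/submxP; rewrite eq_row_base; apply/sub_kermxP.
  by rewrite mulmxBl mul1mx -mulmxA F'F mulmx1 subrr.
have KK' : K *m K' = 1%:M.
  have [K2 hK2] := row_freeP (row_base_free (kermx F)).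
  have : K *m K' *m K = K by rewrite -mulmxA -eK' mulmxBr mulmx1 mulmxA KF mul0mx subr0.
  by move/(congr1 (mulmx^~ K2)); rewrite -mulmxA hK2 mulmx1.
exists (\rank (kermx F)), (rsubmx K), (- lsubmx K); split.
  have rF : \rank F = a by apply/eqP.
  by rewrite mxrank_ker rF subnK // -rF rank_leq_row.
exists (usubmx K'), (dsubmx K'), (lsubmx F'), (rsubmx F').
set K1 := lsubmx K; set K2 := rsubmx K; set G1 := usubmx K'; set G2 := dsubmx K'.
set F1 := lsubmx F'; set F2 := rsubmx F'.
have e1 : K1 *m f1 + K2 *m f2 = 0 by rewrite -mul_row_col hsubmxK.
have e2 : K1 *m G1 + K2 *m G2 = 1%:M by rewrite -mul_row_col hsubmxK vsubmxK.
have e3 : F1 *m f1 + F2 *m f2 = 1%:M by rewrite -mul_row_col hsubmxK.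
have eK : K' *m K = block_mx (G1 *m K1) (G1 *m K2) (G2 *m K1) (G2 *m K2).
  by rewrite -mul_col_row vsubmxK hsubmxK.
have eF : F *m F' = block_mx (f1 *m F1) (f1 *m F2) (f2 *m F1) (f2 *m F2).
  by rewrite -mul_col_row hsubmxK.
move/eqP: eK'; rewrite subr_eq eK eF add_block_mx scalar_mx_block => /eqP.
case/eq_block_mx => h1 h2 h3 h4; split.
- by apply/eqP; rewrite mulNmx -addr_eq0 addrC e1.
- by rewrite mulNmx opprK addrC.
- by [].
- by split; rewrite ?mulmxN ?opprK // addrC.
Qed.

(** The map [(s, t) |-> s f + f t] is then an onto endomorphism of a space, hence
    one-to-one, although the identity gives the element [(1, -1)] of its kernel. *)
Lemma prigid_square n (f1 f2 : 'M[k]_n) : prigid f1 f2 -> n = 0%N.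
Proof.
move=> E; pose V := ('M[k]_n * 'M[k]_n)%type.
pose phi (z : V) : V := (z.1 *m f1 + f1 *m z.2, z.1 *m f2 + f2 *m z.2).
have phiL : linear phi.
  move=> c [s t] [s' t']; rewrite /phi /=.
  by congr pair; rewrite mulmxDl mulmxDr -scalemxAl -scalemxAr addrACA -scalerDr.
have [Phi PhiE] := linear_lfun phiL.
have im : limg Phi = fullv.
  apply/eqP; rewrite eqEsubv subvf; apply/subvP => -[h1 h2] _.
  have [s [t [e1 e2]]] := E h1 h2; apply/memv_imgP; exists (s, t); rewrite ?memvf //.
  by rewrite PhiE /phi /= -e1 -e2.
have ker0 : lker Phi = 0%VS.
  apply/eqP; rewrite -dimv_eq0.
  by have := limg_ker_dim Phi fullv; rewrite im capfv => /eqP; rewrite -[X in _ == X]add0n eqn_add2r.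
have : ((1%:M, - 1%:M) : V) \in lker Phi.
  by rewrite memv_ker PhiE /phi /= !mulmxN !mul1mx !mulmx1 !subrr.
rewrite ker0 memv0 => /eqP [] /matrixP e1 _.
case: (posnP n) => // n0; have := e1 (Ordinal n0) (Ordinal n0).
by rewrite !mxE eqxx => /eqP; rewrite oner_eq0.
Qed.

(** ** The preprojective pencils *)

(** Multiplication by the two variables, from binary forms of degree [m - 1] to
    binary forms of degree [m]. *)
Definition L1 m : 'M[k]_(m, m.+1) := \matrix_(i, j) (i == j :> nat)%:R.
Definition L2 m : 'M[k]_(m, m.+1) := \matrix_(i, j) (i.+1 == j :> nat)%:R.

(** The matrix of the map [x] of indices, restricted to where [c] holds.  Products
    compose the maps, so identities between shift matrices become arithmetic. *)
Definition selmx n p (c : pred nat) (x : nat -> nat) : 'M[k]_(n, p) :=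
  \matrix_(i, j) (c i && (x i == j :> nat))%:R.

Lemma selmxM n p q c x c' x' : selmx n p c x *m selmx p q c' x' =
  selmx n q (fun i => [&& c i, (x i < p)%N & c' (x i)]) (fun i => x' (x i)).
Proof.
apply/matrixP => i j; rewrite !mxE; case: (ltnP (x i) p) => xp; last first.
  rewrite big1 ?andbF // => l _; rewrite !mxE; case: eqP => [e|_].
    by have := ltn_ord l; rewrite -e ltnNge xp.
  by rewrite andbF mul0r.
rewrite (bigD1 (Ordinal xp)) //= !mxE eqxx andbT big1 ?addr0 => [|l nl].
  by rewrite -natrM mulnb andbA.
rewrite !mxE; case: eqP => [e|_]; last by rewrite andbF mul0r.
by case/eqP: nl; apply: val_inj.
Qed.

Lemma L1E m : L1 m = selmx m m.+1 xpredT id. Proof. by []. Qed.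
Lemma L2E m : L2 m = selmx m m.+1 xpredT succn. Proof. by []. Qed.
Lemma scalar1E m : 1%:M = selmx m m xpredT id.
Proof. by apply/matrixP => i j; rewrite !mxE. Qed.

(** The Koszul complex of the two variables. *)
Lemma reflection_L m : reflection (L1 m.+1) (L2 m.+1) (L1 m) (L2 m).
Proof.
exists 0, (selmx m.+1 m xpredT id), (selmx m.+2 m.+1 xpredT id),
  (selmx m.+2 m.+1 (fun j => j == m.+1) (fun _ => m)).
rewrite !mulmx0 !mul0mx !subr0 !add0r !L1E !L2E !selmxM !scalar1E.
have sel_eq n p (c c' : pred nat) x x' :
    (forall i j, (i < n)%N -> (j < p)%N -> (c i && (x i == j)) = (c' i && (x' i == j))) ->
    selmx n p c x = selmx n p c' x'.
  by move=> h; apply/matrixP => i j; rewrite !mxE h.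
split; last split.
- by apply: sel_eq => i j hi hj /=; lia.
- by apply: sel_eq => i j hi hj /=; lia.
- apply/matrixP => i j; rewrite !mxE /= -natrD; congr (_%:R).
  by have := ltn_ord i; have := ltn_ord j; lia.
- by apply: sel_eq => i j hi hj /=; lia.
- apply/matrixP => i j; rewrite !mxE /=; set p := (X in X%:R).
  by have -> : p = false by rewrite /p; have := ltn_ord i; have := ltn_ord j; lia.
- apply/matrixP => i j; rewrite !mxE /=; set p := (X in X%:R - _); set q := (X in _ - X%:R).
  have -> : p = q by rewrite /p /q; have := ltn_ord i; have := ltn_ord j; lia.
  by rewrite subrr.
- apply/matrixP => i j; rewrite !mxE /= -natrD; congr (_%:R).
  by have := ltn_ord i; have := ltn_ord j; lia.
Qed.

End Pencils.

Section PencilClassification.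
Variable k : fieldType.
Local Notation L1 := (@L1 k).
Local Notation L2 := (@L2 k).

(** ** Morphisms and extensions of the preprojective pencils *)

Lemma L_row_inj m : row_inj (L1 m) (L2 m).
Proof. exact: refl_row_inj (reflection_L k m). Qed.

(** Reflections reduce to [q = 0], where the source of the second pencil is 0 and the
    matrices of the first are jointly onto. *)
Lemma phom_L_down p q s t : (q < p)%N -> phom (L1 p) (L2 p) (L1 q) (L2 q) s t ->
  s = 0 /\ t = 0.
Proof.
elim: q p s t => [|q IH] [|p] s t //.
  move=> _ [e1 e2]; split; first exact: thinmx0.
  by apply: (refl_eq (reflection_L k p)); rewrite mulmx0 ?e1 ?e2 [s]thinmx0 mul0mx.
move=> qp; apply: (refl_phom0 (reflection_L k p) (reflection_L k q)) => s' t'.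
by case/(IH p s' t' qp).
Qed.

Lemma phom_L_scalar m s t : phom (L1 m) (L2 m) (L1 m) (L2 m) s t ->
  exists c, s = c%:M /\ t = c%:M.
Proof.
elim: m s t => [|m IH] s t st.
  by exists (t ord0 ord0); split; [rewrite [s]thinmx0 [RHS]thinmx0 | exact: mx11_scalar].
have [s' /IH[c [_ sc]]] := unrefl_phom (reflection_L k m) (reflection_L k m) st.
exists c; split=> //; case: st; rewrite sc => e1 e2.
apply: (refl_eq (reflection_L k m)); by rewrite ?e1 ?e2 !(mul_scalar_mx, mul_mx_scalar).
Qed.

(** Transposition reverses morphisms and takes the preprojective pencils to the
    preinjective ones. *)
Lemma phom_trK b a b' a' (f1 f2 : 'M[k]_(b, a)) (g1 g2 : 'M[k]_(b', a')) s t :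
  phom f1^T f2^T g1^T g2^T s t -> phom g1 g2 f1 f2 t^T s^T.
Proof. by move/phom_tr; rewrite !trmxK. Qed.

Lemma phom_K_scalar m s t : phom (L1 m)^T (L2 m)^T (L1 m)^T (L2 m)^T s t ->
  exists c, t = c%:M.
Proof.
move/phom_trK/phom_L_scalar => [c [e _]]; exists c.
by rewrite -[t]trmxK e tr_scalar_mx.
Qed.

Lemma phom_K_up p q s t : (q < p)%N -> phom (L1 q)^T (L2 q)^T (L1 p)^T (L2 p)^T s t ->
  t = 0.
Proof.
by move=> qp /phom_trK /(phom_L_down qp)[e _]; rewrite -[t]trmxK e trmx0.
Qed.

Lemma pext_free b a b' a' (f1 f2 : 'M[k]_(b, a)) (g1 g2 : 'M[k]_(b', a')) :
  row_free (col_mx f1 f2) -> pext f1 f2 g1 g2.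
Proof.
case/row_freeP => G FG h1 h2; exists 0, (G *m col_mx h1 h2).
rewrite !mul0mx !add0r; apply: eq_col_mx.
by rewrite -mul_col_mx mulmxA FG mul1mx.
Qed.

(** Reflections reduce to [p = 0], where the source vanishes, and to [p = 1], [q = 0],
    where the first pencil is one-to-one. *)
Lemma pext_L p q : (p <= q.+1)%N -> pext (L1 p) (L2 p) (L1 q) (L2 q).
Proof.
have pext0 b' a' (g1 g2 : 'M[k]_(b', a')) : pext (L1 0) (L2 0) g1 g2.
  by move=> h1 h2; exists 0, 0; rewrite [h1]flatmx0 [h2]flatmx0 [L1 0]flatmx0 [L2 0]flatmx0 !mul0mx addr0.
elim: q p => [|q IH] [|p] pq; try exact: pext0; last first.
  exact: pext_unrefl (reflection_L k p) (reflection_L k q) (IH p pq).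
have {p pq}-> : p = 0%N by lia.
apply: pext_free; apply/row_freeP.
have [F1 [F2 h]] := refl_split (reflection_L k 0).
exists (row_mx F1 F2); apply: (@mulmx1C _ 2); exact: etrans (mul_row_col F1 F2 _ _) h.
Qed.

(** ** Decomposition of rigid pencils *)

Definition tfactor b a b' a' (f1 f2 : 'M[k]_(b, a)) (g1 g2 : 'M[k]_(b', a')) (S : 'M[k]_b) (T : 'M[k]_a) : Prop :=
  exists s t s' t', [/\ phom f1 f2 g1 g2 s t, phom g1 g2 f1 f2 s' t', S = s *m s' & T = t *m t'].

(** [f] is a direct summand of copies of [L m] and of [L m.+1].  Factorizations of the
    identity replace direct sum decompositions: they pass through reflections, which
    are additive functors, and they suffice to identify indecomposable summands. *)
Definition padd m b a (f1 f2 : 'M[k]_(b, a)) : Prop :=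
  exists n (ms : 'I_n -> nat) (S : 'I_n -> 'M[k]_b) (T : 'I_n -> 'M[k]_a),
  [/\ forall l, ms l = m \/ ms l = m.+1,
      forall l, tfactor f1 f2 (L1 (ms l)) (L2 (ms l)) (S l) (T l),
      \sum_l S l = 1%:M & \sum_l T l = 1%:M].

Lemma tfactor_phom b a b' a' (f1 f2 : 'M[k]_(b, a)) (g1 g2 : 'M[k]_(b', a')) S T :
  tfactor f1 f2 g1 g2 S T -> phom f1 f2 f1 f2 S T.
Proof.
case=> s [t [s' [t' [[e1 e2] [e3 e4] -> ->]]]].
by split; rewrite !mulmxA ?e1 ?e2 -!mulmxA ?e3 ?e4.
Qed.

Lemma tfactor_tr b a b' a' (f1 f2 : 'M[k]_(b, a)) (g1 g2 : 'M[k]_(b', a')) S T :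
  tfactor f1 f2 g1 g2 S T -> tfactor f1^T f2^T g1^T g2^T T^T S^T.
Proof.
case=> s [t [s' [t' [st st' -> ->]]]].
exists t'^T, s'^T, t^T, s^T; rewrite !trmx_mul; split=> //; exact: phom_tr.
Qed.

Lemma padd_refl m b a d (f1 f2 : 'M[k]_(b, a)) (g1 g2 : 'M[k]_(d, b)) :
  reflection f1 f2 g1 g2 -> padd m g1 g2 -> padd m.+1 f1 f2.
Proof.
move=> R [n [ms [S [T [hms hf eS eT]]]]].
have lift l : exists T', tfactor f1 f2 (L1 (ms l).+1) (L2 (ms l).+1) (T l) T'.
  have [s [t [s' [t' [st st' _ ->]]]]] := hf l.
  have [u hu] := refl_phom R (reflection_L k (ms l)) st.
  have [u' hu'] := refl_phom (reflection_L k (ms l)) R st'.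
  by exists (u *m u'), t, u, t', u'.
have [T' hT'] := fin_all_exists lift.
exists n, (fun l => (ms l).+1), T, T'; split=> // [l|].
  by case: (hms l) => ->; [left | right].
have e := fun l => tfactor_phom (hT' l).
apply: (refl_eq R); rewrite mulmx1 mulmx_sumr.
  by under eq_bigr => l _ do rewrite (e l).1; rewrite -mulmx_suml eT mul1mx.
by under eq_bigr => l _ do rewrite (e l).2; rewrite -mulmx_suml eT mul1mx.
Qed.

Lemma delta_mx_diag n (q : 'I_n) :
  delta_mx q q = delta_mx q 0 *m (delta_mx 0 q : 'rV_n) :> 'M[k]_n.
Proof. by rewrite mul_delta_mx. Qed.

(** Each basis vector of the source spans a copy of [L 1] with its two images, which
    are independent; a complement of these in the target is a sum of copies of
    [L 0]. *)
Lemma padd_free b a (f1 f2 : 'M[k]_(b, a)) : row_free (col_mx f1 f2) -> padd 0 f1 f2.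
Proof.
case/row_freeP => G; rewrite -[G]hsubmxK; set G1 := lsubmx G; set G2 := rsubmx G.
rewrite mul_col_row scalar_mx_block => /eq_block_mx[e11 e12 e21 e22].
pose P := 1%:M - G1 *m f1 - G2 *m f2.
have fP : f1 *m P = 0 /\ f2 *m P = 0.
  by split; rewrite /P !mulmxBr mulmx1 !mulmxA ?e11 ?e12 ?e21 ?e22 mul1mx mul0mx ?subr0 subrr.
exists (a + b)%N, (fun l => if split l is inl _ then 0%N else 1%N),
  (fun l => if split l is inr q then delta_mx q q else 0),
  (fun l => match split l with inl r => P *m delta_mx r r
            | inr q => G1 *m delta_mx q q *m f1 + G2 *m delta_mx q q *m f2 end).
split.
- by move=> l; case: (split l); [left | right].
- move=> l; case: (split l) => q.
    exists 0, (P *m delta_mx q 0), 0, (delta_mx 0 q); split.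
    + by split; rewrite mulmxA ?fP.1 ?fP.2 !mul0mx.
    + by split; rewrite mul0mx [LHS]flatmx0.
    + by rewrite mulmx0.
    + by rewrite -mulmxA -delta_mx_diag.
  have l1 : L1 1 = row_mx 1%:M 0 :> 'M_(1, 1 + 1).
    by apply/matrixP => i j; rewrite !mxE; case: splitP => j' ->; rewrite !mxE !ord1.
  have l2 : L2 1 = row_mx 0 1%:M :> 'M_(1, 1 + 1).
    by apply/matrixP => i j; rewrite !mxE; case: splitP => j' ->; rewrite !mxE !ord1.
  have hrc n (X Y : 'M[k]_(n, 1)) (U V : 'M[k]_(1, a)) :
      row_mx X Y *m col_mx U V = X *m U + Y *m V by exact: mul_row_col.
  pose dc : 'cV[k]_b := delta_mx q 0; pose dr : 'rV[k]_b := delta_mx 0 q.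
  exists dc, (row_mx (G1 *m dc) (G2 *m dc)), dr, (col_mx (dr *m f1) (dr *m f2)); split.
  + have h (f : 'M[k]_(b, a)) (X' Y' : 'M_1) :
        f *m G1 *m dc = dc *m X' -> f *m G2 *m dc = dc *m Y' ->
        f *m row_mx (G1 *m dc) (G2 *m dc) = dc *m row_mx X' Y'.
      by move=> hX hY; rewrite !mul_mx_row !mulmxA hX hY.
    rewrite l1 l2; split; apply: h; by rewrite ?e11 ?e12 ?e21 ?e22 ?mul1mx ?mul0mx ?mulmx0 ?mulmx1.
  + rewrite l1 l2; split; apply: etrans (hrc _ _ _ _ _) _; by rewrite mul1mx mul0mx ?addr0 ?add0r.
  + exact: delta_mx_diag.
  + by apply: etrans _ (esym (hrc _ _ _ _ _)); rewrite delta_mx_diag !mulmxA.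
- rewrite big_split_ord /= big1 ?add0r => [|r _]; last first.
    by rewrite (unsplitK (inl r : 'I_a + 'I_b)).
  under eq_bigr => q _ do rewrite (unsplitK (inr q : 'I_a + 'I_b)).
  by rewrite -mx1_sum_delta.
- rewrite big_split_ord /=.
  under eq_bigr => r _ do rewrite (unsplitK (inl r : 'I_a + 'I_b)).
  under [X in _ + X]eq_bigr => q _ do rewrite (unsplitK (inr q : 'I_a + 'I_b)).
  rewrite big_split /= -!mulmx_suml -!mulmx_sumr -!mx1_sum_delta !mulmx1.
  by rewrite /P -(addrA 1%:M) -opprD subrK.
Qed.

(** By induction on the source: either the pencil is one-to-one, or by [prigid_full]
    it is onto and its reflection is a rigid pencil with a smaller source. *)
Lemma prigid_padd b a (f1 f2 : 'M[k]_(b, a)) : prigid f1 f2 -> (b < a)%N ->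
  exists m, padd m f1 f2.
Proof.
move: {2}b (leqnn b) => N; elim: N b a f1 f2 => [|N IH] b a f1 f2 bN fr ba;
  case: (prigid_full fr) => [/padd_free|/reflection_exists[d [g1 [g2 [dab R]]]]]; try by exists 0%N.
  by move: dab; lia.
have [||m gm] := IH d b g1 g2 _ (pext_refl R R fr); [by lia | by lia |].
by exists m.+1; apply: padd_refl gm.
Qed.

Lemma prigid_trichotomy b a (f1 f2 : 'M[k]_(b, a)) : prigid f1 f2 ->
  [\/ a = 0%N, exists m, padd m f1 f2 | exists m, padd m f1^T f2^T].
Proof.
move=> fr; case: (ltngtP b a) => [ba|ab|e].
- by apply: Or32; exact: prigid_padd.
- by apply: Or33; apply: prigid_padd => //; exact: pext_tr.
by apply: Or31; subst b; exact: prigid_square fr.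
Qed.

Lemma prigid_sum b a b' a' (f1 f2 : 'M[k]_(b, a)) (g1 g2 : 'M[k]_(b', a')) :
  prigid f1 f2 -> pext f1 f2 g1 g2 -> pext g1 g2 f1 f2 -> prigid g1 g2 ->
  prigid (block_mx f1 0 0 g1) (block_mx f2 0 0 g2).
Proof.
move=> ff fg gf gg h1 h2.
have [s11 [t11 [e11 e11']]] := ff (ulsubmx h1) (ulsubmx h2).
have [s12 [t12 [e12 e12']]] := fg (ursubmx h1) (ursubmx h2).
have [s21 [t21 [e21 e21']]] := gf (dlsubmx h1) (dlsubmx h2).
have [s22 [t22 [e22 e22']]] := gg (drsubmx h1) (drsubmx h2).
exists (block_mx s11 s12 s21 s22), (block_mx t11 t12 t21 t22).
rewrite -[h1]submxK -[h2]submxK !mulmx_block add_block_mx add_block_mx.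
rewrite e11 e12 e21 e22 e11' e12' e21' e22'.
by rewrite !mulmx0 !mul0mx !addr0 !add0r.
Qed.

Lemma row_inj_sum b a b' a' (f1 f2 : 'M[k]_(b, a)) (g1 g2 : 'M[k]_(b', a')) :
  row_inj f1 f2 -> row_inj g1 g2 ->
  row_inj (block_mx f1 0 0 g1) (block_mx f2 0 0 g2).
Proof.
move=> fi gi n u; rewrite -[u]hsubmxK !mul_row_block !mulmx0 !addr0 !add0r -row_mx0.
move=> /eq_row_mx[a1 b1] /eq_row_mx[a2 b2].
by rewrite (fi _ _ a1 a2) (gi _ _ b1 b2) row_mx0.
Qed.

Lemma row_inj_tr m : row_inj (L1 m.+1)^T (L2 m.+1)^T.
Proof.
have [F1 [F2 h]] := refl_split (reflection_L k m) => n u u1 u2.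
move/(congr1 trmx): h; rewrite trmx1 linearD /= !trmx_mul => h.
by rewrite -[u]mulmx1 -h mulmxDr !mulmxA u1 u2 !mul0mx addr0.
Qed.

End PencilClassification.

(** * Modules presented by pencils *)

Section PencilModules.
Variables (k : fieldType) (B : falgType k) (D : dk_structure B).
Local Notation e := (idem D).
Local Notation chi := (chi D).
Local Notation inJ := (inJ D).
Local Notation rad := (rad D).
Implicit Types M N P X Y Z : fdmod B.

Variables (i : bool) (al be : B).
Hypotheses (hal : corner D (~~ i) i al) (hbe : corner D (~~ i) i be).

Definition pmat b a (f1 f2 : 'M[k]_(b, a)) (l : 'I_b) (q : 'I_a) : B :=
  f1 l q *: al + f2 l q *: be.

(** [M] is the cokernel of the map, given by the pencil, between copies of the
    projective at the other vertex and copies of the projective at [i]. *)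
Definition cok b a (f1 f2 : 'M[k]_(b, a)) M (x : 'I_a -> M) : Prop :=
  presented D (fun _ => i) (pmat f1 f2) x.

Lemma cok_exists b a (f1 f2 : 'M[k]_(b, a)) : exists M (x : 'I_a -> M), cok f1 f2 x.
Proof. exact: presented_exists. Qed.

Lemma pmat_corner b a (f1 f2 : 'M[k]_(b, a)) l q : corner D (~~ i) i (pmat f1 f2 l q).
Proof. by apply: corner_lin => //; rewrite -[_ *: be]addr0; apply: corner_lin => //; exact: corner0. Qed.

Lemma pmat_rad b a (f1 f2 : 'M[k]_(b, a)) l q : rad (pmat f1 f2 l q).
Proof. exact: corner_rad (pmat_corner _ _ _ _). Qed.

Lemma pmat_mull b' b a (s : 'M[k]_(b', b)) (f1 f2 : 'M[k]_(b, a)) l q :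
  pmat (s *m f1) (s *m f2) l q = \sum_l' s l l' *: pmat f1 f2 l' q.
Proof.
rewrite /pmat !mxE !scaler_suml -big_split; apply: eq_bigr => l' _ /=.
by rewrite scalerDr !scalerA.
Qed.

Lemma pmat_mulr b a a' (t : 'M[k]_(a, a')) (f1 f2 : 'M[k]_(b, a)) l r :
  pmat (f1 *m t) (f2 *m t) l r = \sum_q t q r *: pmat f1 f2 l q.
Proof.
rewrite /pmat !mxE !scaler_suml -big_split; apply: eq_bigr => q _ /=.
by rewrite scalerDr !scalerA [t q r * _]mulrC [t q r * _]mulrC.
Qed.

Lemma pmatD b a (f1 f2 g1 g2 : 'M[k]_(b, a)) l q :
  pmat (f1 + g1) (f2 + g2) l q = pmat f1 f2 l q + pmat g1 g2 l q.
Proof. by rewrite /pmat !mxE !scalerDl addrACA. Qed.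

Lemma pmat_act b a a' (t : 'M[k]_(a, a')) (f1 f2 : 'M[k]_(b, a)) M (y : 'I_a' -> M) l :
  \sum_q act (pmat f1 f2 l q) (\sum_r t q r *: y r) =
  \sum_r act (pmat (f1 *m t) (f2 *m t) l r) (y r).
Proof.
under eq_bigr => q _ do rewrite act_sumr.
rewrite exchange_big; apply: eq_bigr => r _ /=.
rewrite pmat_mulr act_suml; apply: eq_bigr => q _.
by rewrite actZr actZl.
Qed.

Section Cok.
Variables (b a : nat) (f1 f2 : 'M[k]_(b, a)) (M : fdmod B) (x : 'I_a -> M).
Hypothesis Mf : cok f1 f2 x.

Lemma cok_idem q : act (e i) (x q) = x q.
Proof. exact: ((presented_gen Mf).1 q). Qed.

Lemma cok_rel l : \sum_q act (pmat f1 f2 l q) (x q) = 0.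
Proof. by case: Mf. Qed.

Lemma cok_coef (c : 'I_a -> k) : inJ (\sum_q c q *: x q) -> forall q, c q = 0.
Proof.
have -> : \sum_q c q *: x q = \sum_q act (c q *: 1) (x q).
  by apply: eq_bigr => q _; rewrite actZl act1.
move/(presented_inJ Mf) => h q; have := h (fun _ _ => pmat_rad _ _ _ _) q.
by rewrite chiZ chi1 mulr1.
Qed.

Lemma cok_nonzero : (0 < a)%N -> ~ is_zero M.
Proof.
move=> a0 /is_zeroP M0; have := @cok_coef (fun _ => 1) _ (Ordinal a0).
rewrite (M0 (\sum_q _)) => /(_ (inJ0 D M)) /eqP; by rewrite oner_eq0.
Qed.

(** The generators are at [i], and the paths from [i] to the other vertex are in the
    radical. *)
Lemma cok_topless (y : M) : inJ (act (e (~~ i)) y).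
Proof.
have [c ->] := (presented_gen Mf).2 y; rewrite act_sumr; apply: inJ_sum => q.
rewrite -cok_idem -!actM; apply: inJ_act; apply: (@corner_rad _ _ D i).
exact: cornerE.
Qed.

Lemma cok_rel_mull b' (s : 'M[k]_(b', b)) l :
  \sum_q act (pmat (s *m f1) (s *m f2) l q) (x q) = 0.
Proof.
under eq_bigr => q _ do rewrite pmat_mull act_suml.
rewrite exchange_big big1 // => l' _ /=.
under eq_bigr => q _ do rewrite actZl.
by rewrite -scaler_sumr cok_rel scaler0.
Qed.

Lemma cok_coords v (y : M) : act (e v) y = y ->
  exists E : 'I_a -> B, (forall q, corner D v i (E q)) /\ y = \sum_q act (E q) (x q).
Proof.
move=> ye; have [C hC] := (presented_gen Mf).2 y.
exists (fun q => e v * C q * e i); split=> [q|]; first exact: cornerE.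
rewrite -ye hC act_sumr; apply: eq_bigr => q _.
by rewrite -{1}cok_idem -!actM.
Qed.

End Cok.

Lemma cok_iso b a (f1 f2 : 'M[k]_(b, a)) M N (x : 'I_a -> M) (y : 'I_a -> N) :
  cok f1 f2 x -> cok f1 f2 y -> iso M N.
Proof. exact: presented_iso. Qed.

Lemma cok_map b a b' a' (f1 f2 : 'M[k]_(b, a)) (g1 g2 : 'M[k]_(b', a'))
    M N (x : 'I_a -> M) (y : 'I_a' -> N) s t :
  cok f1 f2 x -> cok g1 g2 y -> phom f1 f2 g1 g2 s t ->
  exists u : M -> N, mhom u /\ forall q, u (x q) = \sum_r t q r *: y r.
Proof.
move=> Mf Ng [e1 e2]; apply: (presented_univ Mf) => [q|l].
  by rewrite act_sumr; apply: eq_bigr => r _; rewrite actZr (cok_idem Ng).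
by rewrite pmat_act e1 e2 (cok_rel_mull Ng).
Qed.

(** The factorizations decompose the identity of [M] and thereby that of the summand
    [Z], whose endomorphism ring is local. *)
Lemma cok_tfactor b a (f1 f2 : 'M[k]_(b, a)) M (x : 'I_a -> M) n (bs as_ : 'I_n -> nat)
    (g1 g2 : forall l, 'M[k]_(bs l, as_ l)) S T Z : cok f1 f2 x ->
  (forall l, tfactor f1 f2 (g1 l) (g2 l) (S l) (T l)) -> \sum_l T l = 1%:M ->
  indecomposable Z -> retract Z M ->
  exists l, forall N (y : 'I_(as_ l) -> N), cok (g1 l) (g2 l) y -> retract Z N.
Proof.
move=> Mf hT eT Zi [io [r [ioH rH K]]].
have fac l : exists N (u : M -> N) (u' : N -> M), [/\ mhom u, mhom u',
    forall q, u' (u (x q)) = \sum_r T l q r *: x r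
    & exists y : 'I_(as_ l) -> N, cok (g1 l) (g2 l) y].
  have [N [y Ny]] := cok_exists (g1 l) (g2 l).
  have [s [t [s' [t' [st st' _ eT']]]]] := hT l.
  have [u [uH uE]] := cok_map Mf Ny st; have [u' [uH' uE']] := cok_map Ny Mf st'.
  exists N, u, u'; split=> //; last by exists y.
  move=> q; rewrite uE (mhom_sum uH').
  under eq_bigr => p _ do rewrite (mhomZ uH') uE' scaler_sumr.
  rewrite exchange_big eT'; apply: eq_bigr => q' _ /=; rewrite mxE scaler_suml.
  by apply: eq_bigr => p _; rewrite scalerA.
have [N hN] := fin_all_exists fac; have [u hu] := fin_all_exists hN.
have [u' hu'] := fin_all_exists hu.
have idM y : \sum_l u' l (u l y) = y.
  have H : mhom (fun y => \sum_l u' l (u l y)).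
    by apply: mhom_big => l; case: (hu' l) => uH uH' _ _; exact: mhom_comp uH uH'.
  apply: (gen_eq Mf H (mhom_id M)) => q.
  under eq_bigr => l _ do (have [_ _ -> _] := hu' l).
  rewrite exchange_big /=; under eq_bigr => q' _ do rewrite -scaler_suml -summxE eT mxE.
  rewrite (bigD1 q) //= eqxx scale1r big1 ?addr0 // => q' nq.
  by rewrite eq_sym (negbTE nq) scale0r.
have [l|z|l lb] := @local_endo_sum _ _ Z n (fun l z => r (u' l (u l (io z)))) Zi.
- by case: (hu' l) => uH uH' _ _; exact: mhom_comp (mhom_comp ioH uH) (mhom_comp uH' rH).
- by rewrite -(mhom_sum rH) idM K.
exists l => N' y Ny; case: (hu' l) => uH uH' _ [y0 Ny0].
apply: retract_trans (iso_retract (cok_iso Ny0 Ny)).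
exact: (retract_of_bij (mhom_comp ioH uH) (mhom_comp uH' rH) lb).
Qed.

Lemma cok_dsum b a b' a' (f1 f2 : 'M[k]_(b, a)) (g1 g2 : 'M[k]_(b', a'))
    M N (x : 'I_a -> M) (y : 'I_a' -> N) : cok f1 f2 x -> cok g1 g2 y ->
  exists z : 'I_(a + a') -> dsum M N, cok (block_mx f1 0 0 g1) (block_mx f2 0 0 g2) z.
Proof.
move=> Mf Ng; pose z (q : 'I_(a + a')) : dsum M N :=
  match split q with inl q => (x q, 0) | inr q => (0, y q) end.
have zl q : z (lshift a' q) = (x q, 0) by rewrite /z (unsplitK (inl q : 'I_a + 'I_a')).
have zr q : z (rshift a q) = (0, y q) by rewrite /z (unsplitK (inr q : 'I_a + 'I_a')).
have zS (c : 'I_(a + a') -> B) : \sum_q act (c q) (z q) =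
    (\sum_q act (c (lshift a' q)) (x q), \sum_q act (c (rshift a q)) (y q)) :> dsum M N.
  rewrite big_split_ord /= [RHS](dsum_pairE (M := M) (N := N)) /=; congr (_ + _).
    rewrite (mhom_sum (@mhom_inl _ _ M N)); apply: eq_bigr => q _.
    by rewrite zl (mhom_act (@mhom_inl _ _ M N)).
  rewrite (mhom_sum (@mhom_inr _ _ M N)); apply: eq_bigr => q _.
  by rewrite zr (mhom_act (@mhom_inr _ _ M N)).
exists z; split; first split.
- move=> q; case: (split_ordP q) => q' ->; rewrite ?zl ?zr.
    by rewrite -(mhom_act (@mhom_inl _ _ M N)) (cok_idem Mf).
  by rewrite -(mhom_act (@mhom_inr _ _ M N)) (cok_idem Ng).
- case=> m n; have [c ->] := (presented_gen Mf).2 m; have [d ->] := (presented_gen Ng).2 n.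
  exists (fun q => match split q with inl q => c q | inr q => d q end); rewrite zS.
  congr pair; apply: eq_bigr => q _.
    by rewrite (unsplitK (inl q : 'I_a + 'I_a')).
  by rewrite (unsplitK (inr q : 'I_a + 'I_a')).
- move=> l; rewrite zS; case: (split_ordP l) => l' ->; congr pair.
  + rewrite -[RHS](cok_rel Mf l'); apply: eq_bigr => q _.
    by rewrite /pmat !block_mxEul.
  + by rewrite big1 // => q _; rewrite /pmat !block_mxEur !mxE !scale0r addr0 act0l.
  + by rewrite big1 // => q _; rewrite /pmat !block_mxEdl !mxE !scale0r addr0 act0l.
  + rewrite -[RHS](cok_rel Ng l'); apply: eq_bigr => q _.
    by rewrite /pmat !block_mxEdr.
move=> c; rewrite zS => -[h1 h2].
case: Mf => _ _ /(_ _ h1)[d hd]; case: Ng => _ _ /(_ _ h2)[d' hd'].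
exists (fun l => match split l with inl l => d l | inr l => d' l end) => q.
rewrite big_split_ord /=.
under eq_bigr => l _ do rewrite (unsplitK (inl l : 'I_b + 'I_b')).
under [X in _ + X]eq_bigr => l _ do rewrite (unsplitK (inr l : 'I_b + 'I_b')).
case: (split_ordP q) => q' ->.
  rewrite hd [X in _ + X]big1 ?addr0 => [|l _]; last first.
    by rewrite /pmat !block_mxEdl !mxE !scale0r addr0 mulr0 mul0r.
  by apply: eq_bigr => l _; rewrite /pmat !block_mxEul.
rewrite hd' [X in X + _]big1 ?add0r => [|l _]; last first.
  by rewrite /pmat !block_mxEur !mxE !scale0r addr0 mulr0 mul0r.
by apply: eq_bigr => l _; rewrite /pmat !block_mxEdr.
Qed.

Definition independent : Prop :=
  forall c1 c2 : k, c1 *: al + c2 *: be = 0 -> c1 = 0 /\ c2 = 0.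

(** This is where the two arrows being independent matters: a pencil can then be
    recovered from its matrix of elements. *)
Lemma pmat_inj b a (f1 f2 g1 g2 : 'M[k]_(b, a)) : independent ->
  (forall l q, pmat f1 f2 l q = pmat g1 g2 l q) -> f1 = g1 /\ f2 = g2.
Proof.
move=> ind h; have hh l q : f1 l q - g1 l q = 0 /\ f2 l q - g2 l q = 0.
  apply: ind; rewrite !scalerBl addrACA -opprD -/(pmat _ _ l q) -/(pmat g1 g2 l q) h.
  exact: subrr.
by split; apply/matrixP => l q; apply/eqP; rewrite -subr_eq0; have [h1 h2] := hh l q;
  apply/eqP.
Qed.

Lemma pmat_factor b b' a (h1 h2 : 'M[k]_(b, a)) (g1 g2 : 'M[k]_(b', a)) : independent ->
  (forall l, exists d : 'I_b' -> B, forall r,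
    pmat h1 h2 l r * e i = \sum_l' d l' * pmat g1 g2 l' r * e i) ->
  exists s, h1 = s *m g1 /\ h2 = s *m g2.
Proof.
move=> ind /fin_all_exists[d hd].
exists (\matrix_(l, l') chi (~~ i) (e (~~ i) * d l l' * e (~~ i))).
apply: (pmat_inj ind) => l r; have [p1 p2] := pmat_corner h1 h2 l r.
rewrite pmat_mull -p1 -p2 hd mulr_sumr; apply: eq_bigr => l' _.
have [q1 q2] := pmat_corner g1 g2 l' r.
rewrite mxE -(corner_mull (pmat_corner g1 g2 l' r)); last exact: cornerE.
by rewrite -!mulrA q2 -{1}q1.
Qed.

(** Homomorphisms between presented modules lift to the presentations, and modulo
    the radical the lift has scalar entries: a morphism of pencils. *)
Lemma cok_hom b a b' a' (f1 f2 : 'M[k]_(b, a)) (g1 g2 : 'M[k]_(b', a'))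
    M N (x : 'I_a -> M) (y : 'I_a' -> N) (u : M -> N) :
  cok f1 f2 x -> cok g1 g2 y -> mhom u ->
  exists t : 'M[k]_(a, a'), (forall q, inJ (u (x q) - \sum_r t q r *: y r)) /\
    (independent -> exists s, phom f1 f2 g1 g2 s t).
Proof.
move=> Mf Ng uH.
have uc q : act (e i) (u (x q)) = u (x q) by rewrite -(mhom_act uH) (cok_idem Mf).
have [E hE] := fin_all_exists (fun q => cok_coords Ng (uc q)).
have Ec q r := (hE q).1 r; have uE q := (hE q).2.
pose t := \matrix_(q, r) chi i (E q r); exists t; split=> [q|ind].
  rewrite uE -sumrB (eq_bigr (fun r => act (E q r - t q r *: 1) (y r))) => [|r _]; last first.
    by rewrite actBl actZl act1.
  by apply: (coef_inJ Ng) => r; rewrite chiB chiZ chi1 mulr1 mxE subrr.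
apply: pmat_factor => // l.
case: Ng => _ _; apply; rewrite -pmat_act -[RHS](mhom0 uH) -(cok_rel Mf l) (mhom_sum uH).
apply: eq_bigr => q _; rewrite (mhom_act uH) uE !act_sumr; apply: eq_bigr => r _.
rewrite -actM (corner_mulr (pmat_corner f1 f2 l q) (Ec q r)) actZl actZr.
by rewrite mxE.
Qed.

Lemma cok_inJ_hom b a b' a' (f1 f2 : 'M[k]_(b, a)) (g1 g2 : 'M[k]_(b', a'))
    M N (x : 'I_a -> M) (y : 'I_a' -> N) (u : M -> N) : independent ->
  (forall s t, phom f1 f2 g1 g2 s t -> t = 0) ->
  cok f1 f2 x -> cok g1 g2 y -> mhom u -> forall m, inJ (u m).
Proof.
move=> ind h0 Mf Ng uH m; have [t [tJ /(_ ind)[s /h0 t0]]] := cok_hom Mf Ng uH.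
have [c ->] := (presented_gen Mf).2 m; rewrite (mhom_sum uH); apply: inJ_sum => q.
rewrite (mhom_act uH); apply: inJM; have := tJ q.
by rewrite t0 big1 ?subr0 // => r _; rewrite mxE scale0r.
Qed.

Lemma cok_scalar_indecomposable b a (f1 f2 : 'M[k]_(b, a)) M (x : 'I_a -> M) :
  (0 < a)%N -> (forall (u : M -> M) (t : 'M[k]_a), mhom u -> (forall q, inJ (u (x q) - \sum_r t q r *: x r)) ->
    (independent -> exists s, phom f1 f2 f1 f2 s t) -> exists c, t = c%:M) ->
  cok f1 f2 x -> indecomposable M.
Proof.
move=> a0 sc Mf; apply: (scalar_mod_rad_indecomposable (D := D) (cok_nonzero Mf a0)) => u uH.
have [t [tJ ts]] := cok_hom Mf Mf uH; have [c tc] := sc u t uH tJ ts.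
exists c => m; have [d ->] := (presented_gen Mf).2 m.
rewrite (mhom_sum uH) scaler_sumr -sumrB; apply: inJ_sum => q.
rewrite (mhom_act uH) -actZr -actB; apply: inJM; have := tJ q.
rewrite tc (bigD1 q) //= big1 ?addr0 => [|r nr]; first by rewrite mxE eqxx.
by rewrite mxE eq_sym (negbTE nr) scale0r.
Qed.

Lemma cok1_indecomposable b (f1 f2 : 'M[k]_(b, 1)) M (x : 'I_1 -> M) :
  cok f1 f2 x -> indecomposable M.
Proof.
apply: cok_scalar_indecomposable => // u t _ _ _.
by exists (t 0 0); exact: mx11_scalar.
Qed.

Lemma cok_brick_indecomposable b a (f1 f2 : 'M[k]_(b, a)) M (x : 'I_a -> M) :
  independent -> (0 < a)%N ->
  (forall s t, phom f1 f2 f1 f2 s t -> exists c, t = c%:M) ->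
  cok f1 f2 x -> indecomposable M.
Proof.
move=> ind a0 br; apply: cok_scalar_indecomposable => // u t _ _ /(_ ind)[s].
exact: br.
Qed.

(** A tuple in [M] at the other vertex is given by a pencil [h]; to solve for it along
    the presentation is, modulo the relations, to solve [h = s f + f t]. *)
Lemma cok_tau_rigid b a (f1 f2 : 'M[k]_(b, a)) M (x : 'I_a -> M) : independent ->
  (forall c, corner D (~~ i) i c -> exists c1 c2, c = c1 *: al + c2 *: be) ->
  prigid f1 f2 -> row_inj f1 f2 -> cok f1 f2 x -> tau_rigid M.
Proof.
move=> ind spn fr fi Mf.
apply: (@tau_rigid_of_data _ _ D a (fun _ => i) b (fun _ => ~~ i) (pmat f1 f2) _ x).
split=> //.
- by move=> l q; split; [exact: pmat_corner | exact: pmat_rad].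
- move=> d hd l; pose u : 'rV_b := \row_l' chi (~~ i) (e (~~ i) * d l' * e (~~ i)).
  have u0 : forall l0 q, pmat (u *m f1) (u *m f2) l0 q = pmat (0 : 'M_(1, a)) 0 l0 q.
    move=> l0 q; have -> : pmat (0 : 'M_(1, a)) 0 l0 q = e (~~ i) * \sum_l d l * pmat f1 f2 l q.
      by rewrite hd mulr0 /pmat !mxE !scale0r addr0.
    rewrite pmat_mull mulr_sumr; apply: eq_bigr => l' _.
    have [q1 q2] := pmat_corner f1 f2 l' q.
    rewrite mxE -(corner_mull (pmat_corner f1 f2 l' q)); last exact: cornerE.
    by rewrite -!mulrA q1.
  have [u1 u2] := pmat_inj ind u0; have /matrixP/(_ 0 l) := fi _ _ u1 u2.
  by rewrite !mxE !chiM chi_idem eqxx mul1r mulr1.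
move=> z ze; have [E hE] := fin_all_exists (fun l => cok_coords Mf (ze l)).
have [h1 hh] := fin_all_exists (fun l => fin_all_exists (fun q => spn _ ((hE l).1 q))).
have [h2 {}hh] := fin_all_exists (fun l => fin_all_exists (hh l)).
have [s [t [e1 e2]]] := fr (\matrix_(l, q) h1 l q) (\matrix_(l, q) h2 l q).
exists (fun q => \sum_r t q r *: x r); split=> [q|l].
  by rewrite act_sumr; apply: eq_bigr => r _; rewrite actZr (cok_idem Mf).
rewrite (hE l).2 pmat_act.
transitivity (\sum_q act (pmat (\matrix_(l, q) h1 l q) (\matrix_(l, q) h2 l q) l q) (x q)).
  by apply: eq_bigr => q _; rewrite hh /pmat !mxE.
rewrite e1 e2; under eq_bigr => q _ do rewrite pmatD actDl.
by rewrite big_split /= (cok_rel_mull Mf) add0r.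
Qed.

(** A pencil [h] defines a tuple in [M]; the lift of a solution for it along the
    presentation has the residue [t], and the relations used give [s]. *)
Lemma prigid_of_tau_data b a (f1 f2 : 'M[k]_(b, a)) M (x : 'I_a -> M) : independent ->
  tau_data D (fun _ => i) (fun _ => ~~ i) (pmat f1 f2) x -> prigid f1 f2.
Proof.
move=> ind [Mf _ _ Flift] h1 h2.
have [|u [ue uz]] := Flift (fun l => \sum_q act (pmat h1 h2 l q) (x q)).
  move=> l; rewrite act_sumr; apply: eq_bigr => q _.
  by rewrite -actM (pmat_corner h1 h2 l q).1.
have [E hE] := fin_all_exists (fun q => cok_coords Mf (ue q)).
have Ec q r := (hE q).1 r; have uE q := (hE q).2.
pose t := \matrix_(q, r) chi i (E q r).
have [|s [e1 e2]] := pmat_factor (h1 := h1 - f1 *m t) (h2 := h2 - f2 *m t)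
    (g1 := f1) (g2 := f2) ind; last by exists s, t; rewrite -e1 -e2 !subrK.
move=> l; case: (Mf) => _ _; apply.
have -> : \sum_q act (pmat (h1 - f1 *m t) (h2 - f2 *m t) l q) (x q) =
    \sum_q act (pmat h1 h2 l q) (x q) - \sum_q act (pmat (f1 *m t) (f2 *m t) l q) (x q).
  rewrite -sumrB; apply: eq_bigr => q _; rewrite -actBl; congr act.
  by rewrite /pmat !mxE !scalerBl opprD addrACA.
rewrite uz -pmat_act -sumrB big1 // => q _; rewrite -actB uE -sumrB act_sumr big1 // => r _.
rewrite actB actZr -actM (corner_mulr (pmat_corner f1 f2 l q) (Ec q r)) actZl mxE.
exact: subrr.
Qed.

End PencilModules.

(** * Support [tau]-tilting pairs and their mutations *)

Section Pairs.
Variables (k : fieldType) (A : falgType k).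
Implicit Types M N P X Y Z W : fdmod A.

Lemma decomposition_zero M : is_zero M -> basic M /\ num_summands M 0.
Proof.
move=> M0; have d : decomposition M (fun _ : 'I_0 => M).
  by split=> [[]//|]; rewrite -/(bigsum _) bigsum0; exact: zero_iso.
by split; [apply: (decomposition_basic d) | apply: (decomposition_num d)] => -[].
Qed.

Lemma decomposition1 X : indecomposable X -> basic X /\ num_summands X 1.
Proof.
move=> Xi; have d : decomposition X (fun _ : 'I_1 => X).
  split=> //; rewrite -/(bigsum _) bigsum_recl bigsum0; apply: iso_sym.
  exact: dsum0r (zero_mod_zero A).
by split; [apply: (decomposition_basic d) | apply: (decomposition_num d)] => i j _;
  rewrite !ord1.
Qed.

Lemma decomposition2 X Y : indecomposable X -> indecomposable Y -> ~ iso X Y ->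
  basic (dsum X Y) /\ num_summands (dsum X Y) 2.
Proof.
move=> Xi Yi XY; pose s (q : 'I_2) := if q == ord0 then X else Y.
have d : decomposition (dsum X Y) s.
  split=> [q|]; first by rewrite /s; case: ifP.
  rewrite -/(bigsum _) !bigsum_recl bigsum0 /s /=; apply: dsum_iso; first exact: iso_refl.
  exact: iso_sym (dsum0r _ (zero_mod_zero A)).
have sI i j : iso (s i) (s j) -> i = j.
  case: (unliftP ord0 i) (unliftP ord0 j) => [i' ->|->] [j' ->|->] //; rewrite /s /= => h.
  - by rewrite !ord1.
  - by case: XY; exact: iso_sym.
by split; [apply: (decomposition_basic d) | apply: (decomposition_num d)].
Qed.

Lemma num_summands0 M : basic M -> num_summands M 0 -> is_zero M.
Proof.
move=> Mb /(basic_decomposition Mb)[s [[_]]]; rewrite -/(bigsum _) bigsum0 => e _.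
exact: is_zero_iso (iso_sym e) (zero_mod_zero A).
Qed.

Lemma num_summands1 M : basic M -> num_summands M 1 -> indecomposable M.
Proof.
move=> Mb /(basic_decomposition Mb)[s [[si]]]; rewrite -/(bigsum _) bigsum_recl bigsum0.
move=> e _; apply: indecomposable_iso (si ord0); apply: iso_sym.
exact: iso_trans e (dsum0r _ (zero_mod_zero A)).
Qed.

Lemma num_summands2 M : basic M -> num_summands M 2 ->
  exists X Y, [/\ indecomposable X, indecomposable Y, ~ iso X Y & iso M (dsum X Y)].
Proof.
move=> Mb /(basic_decomposition Mb)[s [[si]]]; rewrite -/(bigsum _) !bigsum_recl bigsum0.
move=> e sI; exists (s ord0), (s (lift ord0 ord0)); split=> //.
  by move/sI => /(congr1 val).
apply: iso_trans e _; apply: dsum_iso; first exact: iso_refl.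
exact: dsum0r (zero_mod_zero A).
Qed.

(** ** Factor categories *)

Lemma in_add_retract M N : in_add M N <->
  forall Z, indecomposable Z -> retract Z N -> retract Z M.
Proof.
split=> h Z Zi => [/retract_summand /(h Z Zi) /summand_retract //|].
by move/summand_retract/(h Z Zi)/retract_summand.
Qed.

Definition covered M X : Prop := exists (N : fdmod A) (f : N -> X),
  [/\ forall Z, indecomposable Z -> retract Z N -> retract Z M, mhom f
    & forall y, exists x, f x = y].

Lemma in_FacP M X : in_Fac M X <-> covered M X.
Proof.
split=> [[N [f [Na fH fS]]]|[N [f [Na /mhom_lfun[F [FH FE]] fS]]]].
  exists N, f; split; [exact/in_add_retract | exact: is_hom_mhom | exact/surjP].
exists N, F; split; [exact/in_add_retract | by [] |].
by apply/surjP => y; have [x <-] := fS y; exists x; rewrite FE.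
Qed.

Lemma covered_retract M X : retract X M -> covered M X.
Proof.
move=> XM; exists X, id; split=> // [Z _ ZX|y]; last by exists y.
exact: retract_trans ZX XM.
Qed.

Lemma covered_surj M X Y (f : X -> Y) : mhom f -> (forall y, exists x, f x = y) ->
  covered M X -> covered M Y.
Proof.
move=> fH fS [N [g [Na gH gS]]]; exists N, (fun x => f (g x)); split=> //.
  exact: mhom_comp gH fH.
by move=> y; have [x <-] := fS y; have [z <-] := gS x; exists z.
Qed.

Lemma covered_zero M X : is_zero X -> covered M X.
Proof.
move=> X0; exists X, id; split=> // [Z Zi /retract_zero /(_ X0) /Zi.1 //|y].
by exists y.
Qed.

Lemma covered_dsum M X Y : covered M X -> covered M Y -> covered M (dsum X Y).
Proof.
move=> [N [f [Na fH fS]]] [N' [f' [Na' fH' fS']]].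
exists (dsum N N'), (fun z => (f z.1, f' z.2)); split.
- by move=> Z Zi /(retract_dsum Zi)[]; auto.
- by apply: mhom_pair; [exact: mhom_comp (@mhom_fst _ _ _ _) fH | exact: mhom_comp (@mhom_snd _ _ _ _) fH'].
- by case=> x y; have [z <-] := fS x; have [z' <-] := fS' y; exists (z, z').
Qed.

(** The modules of [add M2] are built from the indecomposable summands of [M2] by
    direct sums, and being covered by [M1] passes to direct sums and quotients. *)
Lemma Fac_sub M1 M2 : (forall Z, indecomposable Z -> retract Z M2 -> covered M1 Z) ->
  forall X, in_Fac M2 X -> in_Fac M1 X.
Proof.
move=> h X /in_FacP[N [f [Na fH fS]]]; apply/in_FacP; apply: (covered_surj fH fS).
apply: (add_ind (Phi := covered M1)).
- move=> Y Z /isoP[g [g' [gH _ _ K]]]; apply: (covered_surj gH) => y.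
  by exists (g' y); rewrite K.
- exact: covered_zero (zero_mod_zero A).
- exact: covered_dsum.
- by move=> Z Zi /(Na Z Zi); exact: h.
Qed.

Lemma in_Fac_iso M N X : iso M N -> in_Fac M X -> in_Fac N X.
Proof.
move=> e /in_FacP[L [f [La fH fS]]]; apply/in_FacP; exists L, f; split=> // Z Zi ZL.
exact: retract_trans (La Z Zi ZL) (iso_retract e).
Qed.

Lemma left_mutation_of T1 T2 U X : support_tau_tilting T1 -> support_tau_tilting T2 ->
  almost_complete U -> pair_summand U T1 -> pair_summand U T2 ->
  (forall Z, indecomposable Z -> retract Z (pmod T2) -> covered (pmod T1) Z) ->
  in_Fac (pmod T1) X -> ~ in_Fac (pmod T2) X -> left_mutation T1 T2.
Proof.
move=> s1 s2 Ua U1 U2 h X1 X2; split; [split=> // | exact: Fac_sub |].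
- by case=> e _; apply: X2; exact: in_Fac_iso e X1.
- by exists U.
- by move/(_ X X1).
Qed.

(** Connectedness in terms of bare pairs, whatever the proofs that they are support
    [tau]-tilting. *)
Definition linked (T U : mod_pair A) : Prop :=
  forall (sT : support_tau_tilting T) (sU : support_tau_tilting U),
    connected (exist _ T sT) (exist _ U sU).

Lemma linked_trans T U V : support_tau_tilting U -> linked T U -> linked U V -> linked T V.
Proof. by move=> sU TU UV sT sV; apply: rst_trans (TU sT sU) (UV sU sV). Qed.

Lemma linked_sym T U : linked T U -> linked U T.
Proof. by move=> h sU sT; apply: rst_sym; exact: h. Qed.

Lemma linked_iso T U : pair_iso T U -> linked T U.
Proof. by move=> e sT sU; apply: rst_step; left. Qed.

Lemma linked_mutation T U : left_mutation T U -> linked T U.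
Proof. by move=> e sT sU; apply: rst_step; right. Qed.

End Pairs.

Section Components.
Variables (k : fieldType) (B : falgType k) (D : dk_structure B).
Local Notation e := (idem D).
Local Notation inJ := (inJ D).
Implicit Types M N P Q X Y Z W : fdmod B.

(** ** The indecomposable projectives *)

Definition proj_at v P (x : 'I_1 -> P) : Prop := free_on D (fun _ => v) x.

Lemma presented_ord0 n (v : 'I_n -> bool) (F F' : 'I_0 -> 'I_n -> B) M (x : 'I_n -> M) :
  presented D v F x -> presented D v F' x.
Proof.
case=> g _ h; split=> // [[]//|c /h[d hd]].
by exists d => q; rewrite hd !big_ord0.
Qed.

Lemma proj_at_exists v : exists P (x : 'I_1 -> P), proj_at v x.
Proof. exact: presented_exists. Qed.

Lemma proj_at_cok v P (x : 'I_1 -> P) al be : proj_at v x ->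
  cok D v al be (0 : 'M_(0, 1)) 0 x.
Proof. exact: presented_ord0. Qed.

Lemma proj_at_indecomposable v P (x : 'I_1 -> P) : proj_at v x -> indecomposable P.
Proof.
move=> Pv; apply: (@cok1_indecomposable _ _ D v 0 0 (corner0 _ _ _) (corner0 _ _ _) 0).
exact: proj_at_cok Pv.
Qed.

Lemma proj_at_topless v P (x : 'I_1 -> P) y : proj_at v x -> inJ (act (e (~~ v)) (y : P)).
Proof.
move=> Pv; exact: (cok_topless (proj_at_cok 0 0 Pv)).
Qed.

Lemma proj_at_gen_notin v P (x : 'I_1 -> P) : proj_at v x -> ~ inJ (x ord0).
Proof.
move=> Pv xJ; have := @cok_coef _ _ D v 0 0 (corner0 _ _ _) (corner0 _ _ _) 0 1 0 0 _ x
  (proj_at_cok 0 0 Pv) (fun _ => 1).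
rewrite big_ord1 scale1r => /(_ xJ ord0) /eqP; by rewrite oner_eq0.
Qed.

Lemma proj_at_inj v w P Q (x : 'I_1 -> P) (y : 'I_1 -> Q) : proj_at v x -> proj_at w y ->
  iso P Q -> v = w.
Proof.
move=> Pv Qw /isoP[f [g [fH gH _ gK]]]; case: (v =P w) => // vw.
have vw' : w = ~~ v by case: v w vw {Pv Qw} => [] [].
case: (proj_at_gen_notin Qw); rewrite -[y _]gK; apply: (inJ_mhom fH).
have <- : act (e w) (g (y ord0)) = g (y ord0).
  by rewrite -(mhom_act gH) (presented_gen Qw).1.
by rewrite vw'; exact: proj_at_topless Pv.
Qed.

Lemma free_coordinate n (v : 'I_n -> bool) P (x : 'I_n -> P) q N (y : 'I_1 -> N) :
  free_on D v x -> proj_at (v q) y -> exists (u : P -> N) (u' : N -> P),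
    [/\ mhom u, mhom u', forall r, u' (u (x r)) = if r == q then x r else 0
      & u (x q) = y ord0 /\ u' (y ord0) = x q].
Proof.
move=> Pf Nq; have [|u [uH uE]] := free_univ (z := fun r => if r == q then y ord0 else 0) Pf.
  move=> r; case: eqP => [->|_]; last exact: act0.
  exact: (presented_gen Nq).1.
have [|u' [uH' uE']] := free_univ (z := fun _ : 'I_1 => x q) Nq.
  by move=> _; exact: (presented_gen Pf).1.
exists u, u'; split=> //; last by rewrite uE eqxx uE'.
move=> r; rewrite uE; case: eqP => [->|_]; by rewrite ?uE' // (mhom0 uH').
Qed.

Lemma free_retract n (v : 'I_n -> bool) P (x : 'I_n -> P) q N (y : 'I_1 -> N) :
  free_on D v x -> proj_at (v q) y -> retract N P.
Proof.
move=> Pf Nq; have [u [u' [uH uH' _ [e1 e2]]]] := free_coordinate Pf Nq.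
exists u', u; split=> //; apply: (gen_eq Nq (mhom_comp uH' uH) (mhom_id N)) => r.
by rewrite !ord1 e2 e1.
Qed.

Lemma free_indecomposable n (v : 'I_n -> bool) P (x : 'I_n -> P) Z : free_on D v x ->
  indecomposable Z -> retract Z P ->
  exists q, forall N (y : 'I_1 -> N), proj_at (v q) y -> iso Z N.
Proof.
move=> Pf Zi [io [r [ioH rH K]]].
have [N hN] := fin_all_exists (fun q => proj_at_exists (v q)).
have [y hy] := fin_all_exists hN.
have [u hu] := fin_all_exists (fun q => free_coordinate Pf (hy q)).
have [u' {}hu] := fin_all_exists hu.
have idP p : \sum_q u' q (u q p) = p.
  have H : mhom (fun p => \sum_q u' q (u q p)).
    by apply: mhom_big => q; case: (hu q) => uH uH' _ _; exact: mhom_comp uH uH'.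
  apply: (gen_eq Pf H (mhom_id P)) => q; rewrite (bigD1 q) //=.
  have uu q1 q2 : u' q1 (u q1 (x q2)) = if q2 == q1 then x q2 else 0 by case: (hu q1).
  rewrite uu eqxx big1 ?addr0 // => q' nq.
  by rewrite uu eq_sym (negbTE nq).
have [q|z|q qb] := @local_endo_sum _ _ Z n (fun q z => r (u' q (u q (io z)))) Zi.
- by case: (hu q) => uH uH' _ _; exact: mhom_comp (mhom_comp ioH uH) (mhom_comp uH' rH).
- by rewrite -(mhom_sum rH) idP K.
exists q => N' y' Nq; case: (hu q) => uH uH' _ _.
apply: (retract_indecomposable (proj_at_indecomposable Nq) Zi.1).
apply: retract_trans (iso_retract (presented_iso (hy q) Nq)).
exact: (retract_of_bij (mhom_comp ioH uH) (mhom_comp uH' rH) qb).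
Qed.

Lemma projective_indecomposable P : projective P -> indecomposable P ->
  exists v (x : 'I_1 -> P), proj_at v x.
Proof.
move=> /(projective_free D)[n [v [x Pf]]] Pi.
have [q hq] := free_indecomposable Pf Pi (retract_refl P).
have [N [y Nq]] := proj_at_exists (v q).
case/isoP: (hq N y Nq) => f [g [fH gH fK gK]].
exists (v q), (fun l => g (y l)); apply: (presented_transport Nq gH).
by exists f.
Qed.

Lemma regular_free : free_on D (fun q : 'I_2 => q != ord0)
  ((fun q => e (q != ord0)) : 'I_2 -> regular B).
Proof.
split; first split.
- by move=> q; exact: idem2.
- move=> y; exists (fun _ => y : B); rewrite !big_ord_recl big_ord0 addr0 /=.
  by rewrite -[RHS]/(y * e false + y * e true) -mulrDr idem_sum mulr1.
- by case.
- move=> c; rewrite !big_ord_recl big_ord0 addr0 /= => h.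
  exists (fun _ => 0) => q; rewrite big_ord0.
  have {}h : (c ord0 * e false + c (lift ord0 ord0) * e true) * e (q != ord0) = 0.
    by rewrite -[X in X * _]/(act (c ord0) (e false : regular B) + act (c (lift ord0 ord0)) (e true : regular B)) h mul0r.
  move: h; rewrite mulrDl -!mulrA.
  case: (unliftP ord0 q) => [q' ->|->] /=; rewrite ?ord1.
    by rewrite idem2 idem_neq // mulr0 add0r.
  by rewrite idem2 idem_neq // mulr0 addr0.
Qed.

Lemma regular_iso P Q (x : 'I_1 -> P) (y : 'I_1 -> Q) : proj_at false x -> proj_at true y ->
  iso (regular B) (dsum P Q).
Proof.
move=> P0 Q1; have [u [u' [uH uH' _ [e1 e2]]]] := free_coordinate (q := ord0) regular_free P0.
have [w [w' [wH wH' _ [e3 e4]]]] := free_coordinate (q := lift ord0 ord0) regular_free Q1.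
have [|h [hH hE]] := free_univ (z := fun q : 'I_2 => if q == ord0 then (x ord0, 0) : dsum P Q else (0, y ord0)) regular_free.
  move=> q; case: (unliftP ord0 q) => [q' ->|->] /=.
    exact: (congr2 pair (act0 P _) ((presented_gen Q1).1 ord0)).
  exact: (congr2 pair ((presented_gen P0).1 ord0) (act0 Q _)).
have kH : mhom (fun z : dsum P Q => u' z.1 + w' z.2).
  by apply: mhom_add; [exact: mhom_comp (@mhom_fst _ _ _ _) uH' | exact: mhom_comp (@mhom_snd _ _ _ _) wH'].
apply: (iso_of hH (g := fun z : dsum P Q => u' z.1 + w' z.2)).
  apply: (gen_eq regular_free (mhom_comp hH kH) (mhom_id _)) => q; rewrite hE.
  case: (unliftP ord0 q) => [q' ->|->] /=; first by rewrite (mhom0 uH') add0r !ord1 e4.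
  by rewrite (mhom0 wH') addr0 e2.
case=> p r; rewrite (mhomD hH) /= [RHS](dsum_pairE (M := P) (N := Q)) /=.
congr (_ + _).
  apply: (gen_eq P0 (mhom_comp uH' hH) (@mhom_inl _ _ P Q)) => q.
  by rewrite !ord1 e2 hE.
apply: (gen_eq Q1 (mhom_comp wH' hH) (@mhom_inr _ _ P Q)) => q.
by rewrite !ord1 e4 hE.
Qed.

Lemma regular_num : basic (regular B) /\ num_summands (regular B) 2.
Proof.
have [P [x P0]] := proj_at_exists false; have [Q [y Q1]] := proj_at_exists true.
have [|Pb Pn] := decomposition2 (proj_at_indecomposable P0) (proj_at_indecomposable Q1).
  by move/(proj_at_inj P0 Q1).
have [s [[si es] sI]] := basic_decomposition Pb Pn.
have d : decomposition (regular B) s by split=> //; exact: iso_trans (regular_iso P0 Q1) es.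
by split; [exact: decomposition_basic d sI | exact: decomposition_num d sI].
Qed.

Lemma dsum_projective_iso X Y v w (x : 'I_1 -> X) (y : 'I_1 -> Y) :
  proj_at v x -> proj_at w y -> ~ iso X Y -> iso (dsum X Y) (regular B).
Proof.
case: v w => [] [] Xv Yw XY.
- by case: XY; exact: presented_iso Xv Yw.
- exact: iso_trans (dsumC _ _) (iso_sym (regular_iso Yw Xv)).
- exact: iso_sym (regular_iso Xv Yw).
- by case: XY; exact: presented_iso Xv Yw.
Qed.

Lemma proj_at_retract v P (x : 'I_1 -> P) : proj_at v x -> retract P (regular B).
Proof.
move=> Pv; apply: (free_retract (q := if v then lift ord0 ord0 else ord0) regular_free (y := x)).
by case: v Pv.
Qed.

(** ** The two hubs, and pairs with a nonzero projective part *)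

Lemma free_zero : free_on D (fun _ : 'I_0 => true) (fun _ => 0 : zero_mod B).
Proof.
split; first split.
- by case.
- by move=> y; exists (fun _ => 0); rewrite big_ord0 [y]thinmx0.
- by case.
- by move=> c _; exists (fun _ => 0) => -[].
Qed.

Lemma zero_hom_trivial M N : is_zero M \/ is_zero N -> hom_trivial M N.
Proof.
move=> h f _; apply/lfunP => x; rewrite zero_lfunE.
case: h => /is_zeroP h; last exact: h.
by rewrite (h x) linear0.
Qed.

Let Z0 := zero_mod_zero B.

Lemma zero_tau_rigid : tau_rigid (zero_mod B).
Proof. exact: free_tau_rigid free_zero. Qed.

Definition hub (b : bool) : mod_pair B :=
  if b then ModPair (regular B) (zero_mod B) else ModPair (zero_mod B) (regular B).

Lemma hub_support b : support_tau_tilting (hub b).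
Proof.
have [zb zn] := decomposition_zero Z0; have [rb rn] := regular_num.
case: b; split.
- split=> //; [exact: free_tau_rigid regular_free | exact: projective_zero |].
  by apply: zero_hom_trivial; left.
- by exists 2%N, 0%N, 2%N.
- split=> //; [exact: zero_tau_rigid | exact: projective_regular |].
  by apply: zero_hom_trivial; right.
- by exists 0%N, 2%N, 2%N.
Qed.

Lemma almost_complete_module W : indecomposable W -> tau_rigid W ->
  almost_complete (ModPair W (zero_mod B)).
Proof.
move=> Wi Wt; have [zb zn] := decomposition_zero Z0; have [wb wn] := decomposition1 Wi.
split; last by exists 1%N, 0%N, 2%N; split=> //; exact: regular_num.2.
split=> //; first exact: projective_zero.
by apply: zero_hom_trivial; left.
Qed.

Lemma zero_summand M : summand (zero_mod B) M.
Proof.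
apply: retract_summand; exists (fun _ => 0), (fun _ => 0).
by split; [exact: mhom_zero | exact: mhom_zero | move=> x; rewrite [x]thinmx0].
Qed.

(** The homomorphisms from the modules of [add M] then also have their image in the
    radical, so that by Nakayama's lemma none of them is onto. *)
Lemma not_in_Fac M Z : ~ is_zero Z ->
  (forall u : M -> Z, mhom u -> forall x, inJ (u x)) -> ~ in_Fac M Z.
Proof.
move=> Zn h /in_FacP[N [f [Na fH fS]]].
have : forall u : N -> Z, mhom u -> forall x, inJ (u x).
  apply: (add_ind (Phi := fun N => forall u : N -> Z, mhom u -> forall x, inJ (u x))).
  - move=> X Y /isoP[g [g' [gH gH' _ K]]] hX u uH y.
    by rewrite -[y]K; exact: (hX _ (mhom_comp gH uH)).
  - by move=> u uH x; rewrite [x]thinmx0 (mhom0 uH); exact: inJ0.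
  - move=> X Y hX hY u uH z; rewrite (dsum_pairE z) (mhomD uH); apply: inJD.
      exact: (hX _ (mhom_comp (@mhom_inl _ _ X Y) uH)).
    exact: (hY _ (mhom_comp (@mhom_inr _ _ X Y) uH)).
  - move=> W Wi /(Na W Wi)[io [r [ioH rH K]]] u uH w; rewrite -[w]K.
    exact: h (mhom_comp rH uH) _.
move/(_ f fH) => fJ; apply: Zn; apply/is_zeroP.
apply: (nakayama (D := D) (S := fun z : Z => z = 0)).
- by [].
- by move=> x y -> ->; rewrite addr0.
- by move=> a x ->; rewrite act0.
- by move=> y; have [x <-] := fS y; exists 0, (f x); rewrite add0r.
Qed.

(** Deleting the module part is the mutation at it, and the zero module is the one
    with the smallest factor category. *)
Lemma linked_hub_proj M P : support_tau_tilting (ModPair M P) ->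
  indecomposable M -> indecomposable P -> linked (ModPair M P) (hub false).
Proof.
move=> s Mi Pi; apply: linked_mutation.
have [[[Mb Pb] _ Pp _] _] := s; rewrite /= in Mb Pb Pp.
have [v [x Pv]] := projective_indecomposable Pp Pi.
have [zb zn] := decomposition_zero Z0; have [_ pn] := decomposition1 Pi.
apply: (@left_mutation_of _ _ _ _ (ModPair (zero_mod B) P) M s (hub_support false)).
- split; last by exists 0%N, 1%N, 2%N; split=> //; exact: regular_num.2.
  by split=> //; [exact: zero_tau_rigid | apply: zero_hom_trivial; right].
- by split; [exact: zero_summand | exact: retract_summand (retract_refl _)].
- by split; [exact: zero_summand | apply: retract_summand; exact: proj_at_retract Pv].
- by move=> Z Zi /= /retract_zero /(_ Z0) /Zi.1.
- by apply/in_FacP; exact: covered_retract (retract_refl _).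
- apply: not_in_Fac Mi.1 _ => u uH w; rewrite [w]thinmx0 (mhom0 uH); exact: inJ0.
Qed.

(** The exchange of the complements of a common summand [W] is a left mutation when
    the first module part generates the second, but not conversely: a witness is a
    module [Z] to which the second maps only into the radical. *)
Lemma left_mutation_common M1 P1 M2 P2 W Z :
  support_tau_tilting (ModPair M1 P1) -> support_tau_tilting (ModPair M2 P2) ->
  indecomposable W -> tau_rigid W -> retract W M1 -> retract W M2 ->
  (forall X, indecomposable X -> retract X M2 -> covered M1 X) ->
  ~ is_zero Z -> covered M1 Z ->
  (forall u : M2 -> Z, mhom u -> forall x, inJ (u x)) ->
  left_mutation (ModPair M1 P1) (ModPair M2 P2).
Proof.
move=> s1 s2 Wi Wt W1 W2 F21 Zn Z1 Z2.
apply: (left_mutation_of s1 s2 (almost_complete_module Wi Wt) (X := Z)).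
- by split; [exact: retract_summand | exact: zero_summand].
- by split; [exact: retract_summand | exact: zero_summand].
- exact: F21.
- exact/in_FacP.
- exact: not_in_Fac.
Qed.

(** By a free cover, whose indecomposable summands are projective. *)
Lemma covered_regular X : covered (regular B) X.
Proof.
have [n [v [x [_ xg]]]] := gen_family_exists D X.
exists (free_mod B n), (free_map x); split.
- move=> Z Zi ZF.
  have [w [y Zw]] := projective_indecomposable (projective_retract (@projective_free_mod _ B n) ZF) Zi.
  exact: proj_at_retract Zw.
- exact: free_map_mhom.
- move=> y; have [c ->] := xg y; exists [ffun q => c q].
  by apply: eq_bigr => q _; rewrite ffunE.
Qed.

(** ** Pairs with zero projective part *)

Lemma support_dsum X Y : indecomposable X -> indecomposable Y -> ~ iso X Y ->
  tau_rigid (dsum X Y) -> support_tau_tilting (ModPair (dsum X Y) (zero_mod B)).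
Proof.
move=> Xi Yi XY t; have [zb zn] := decomposition_zero Z0.
have [b n] := decomposition2 Xi Yi XY; split; last first.
  by exists 2%N, 0%N, 2%N; split=> //; exact: regular_num.2.
by split=> //; [exact: projective_zero | apply: zero_hom_trivial; left].
Qed.

(** With the common summand [X], the pair is a left mutation of the regular module:
    as [M] is generated at [i], all its homomorphisms to the projective at the other
    vertex have their image in the radical. *)
Lemma linked_hub_module i M P X n (x : 'I_n -> M) (y : 'I_1 -> X) :
  support_tau_tilting (ModPair M P) -> gen_family D (fun _ => i) x -> proj_at i y ->
  retract X M -> linked (ModPair M P) (hub true).
Proof.
move=> s xg Xi XM; apply: linked_sym; apply: linked_mutation.
have [Q [z Pz]] := proj_at_exists (~~ i).
apply: (left_mutation_common (hub_support true) s (proj_at_indecomposable Xi) (free_tau_rigid Xi)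
  (proj_at_retract Xi) XM _ (proj_at_indecomposable Pz).1).
- by move=> *; exact: covered_regular.
- exact: covered_regular.
- move=> u uH w; have [c ->] := xg.2 w; rewrite (mhom_sum uH); apply: inJ_sum => q.
  rewrite (mhom_act uH); apply: inJM.
  rewrite -(xg.1 q) (mhom_act uH) -[i]negbK; exact: proj_at_topless Pz.
Qed.

End Components.

(** * The two components *)

Section Chains.
Variables (k : fieldType) (B : falgType k) (D : dk_structure B).
Local Notation e := (idem D).
Local Notation inJ := (inJ D).
Implicit Types M N P Q X Y Z W : fdmod B.
Local Notation pair0 M := (ModPair M (zero_mod B)).

(** ** The preprojective and preinjective chains *)

Section Independent.
Variable i : bool.
Local Notation al := (arrow D (i, false)).
Local Notation be := (arrow D (i, true)).
Hypothesis ind : independent al be.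

Let hal : corner D (~~ i) i al. Proof. exact: (arrow_corner D (i, false)). Qed.
Let hbe : corner D (~~ i) i be. Proof. exact: (arrow_corner D (i, true)). Qed.

Local Notation cok := (cok D i al be).

Lemma cok_rigid b a (f1 f2 : 'M[k]_(b, a)) M (x : 'I_a -> M) :
  prigid f1 f2 -> row_inj f1 f2 -> cok f1 f2 x -> tau_rigid M.
Proof. by move=> fr fi; apply: cok_tau_rigid => // c /corner_span. Qed.

(** As the targets index the generators, two morphisms of pencils that are jointly
    onto there induce an epimorphism from two copies of [M]. *)
Lemma cok_covered b a b' a' (f1 f2 : 'M[k]_(b, a)) (g1 g2 : 'M[k]_(b', a'))
    M N (x : 'I_a -> M) (y : 'I_a' -> N) s1 t1 s2 t2 F1 F2 M1 :
  cok f1 f2 x -> cok g1 g2 y -> phom f1 f2 g1 g2 s1 t1 -> phom f1 f2 g1 g2 s2 t2 ->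
  F1 *m t1 + F2 *m t2 = 1%:M -> retract M M1 -> covered M1 N.
Proof.
move=> Mf Ng st1 st2 F MM.
have [u1 [u1H u1E]] := cok_map Mf Ng st1.
have [u2 [u2H u2E]] := cok_map Mf Ng st2.
pose u (z : dsum M M) := u1 z.1 + u2 z.2.
have uH : mhom u.
  apply: mhom_add; first exact: mhom_comp (@mhom_fst _ _ _ _) u1H.
  exact: mhom_comp (@mhom_snd _ _ _ _) u2H.
apply: (covered_surj uH _ (covered_dsum (covered_retract MM) (covered_retract MM))) => n.
have [w hw] : exists w : 'I_a' -> dsum M M, forall r, u (w r) = y r.
  exists (fun r => (\sum_q F1 r q *: x q, \sum_q F2 r q *: x q)) => r.
  rewrite /u /= (mhom_sum u1H) (mhom_sum u2H) -big_split /=.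
  transitivity (\sum_r' (F1 *m t1 + F2 *m t2) r r' *: y r').
    under [RHS]eq_bigr => r' _ do rewrite !mxE -big_split /= scaler_suml.
    rewrite exchange_big; apply: eq_bigr => q _ /=.
    rewrite (mhomZ u1H) (mhomZ u2H) u1E u2E !scaler_sumr -big_split; apply: eq_bigr => r' _ /=.
    by rewrite scalerDl !scalerA.
  rewrite F (bigD1 r) //= mxE eqxx scale1r big1 ?addr0 // => r' nr.
  by rewrite mxE eq_sym (negbTE nr) scale0r.
have [c ->] := (presented_gen Ng).2 n; exists (\sum_r act (c r) (w r)).
rewrite (mhom_sum uH); apply: eq_bigr => r _; by rewrite (mhom_act uH) hw.
Qed.

Lemma inJ_not_iso M N : ~ is_zero N -> (forall u : M -> N, mhom u -> forall x, inJ (u x)) ->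
  ~ iso M N.
Proof.
move=> Nn h e; apply: (not_in_Fac Nn h); apply: in_Fac_iso (iso_sym e) _.
by apply/in_FacP; apply: covered_retract; exact: retract_refl.
Qed.

Lemma cok_support b a b' a' (f1 f2 : 'M[k]_(b, a)) (g1 g2 : 'M[k]_(b', a'))
    X Y (x : 'I_a -> X) (y : 'I_a' -> Y) : cok f1 f2 x -> cok g1 g2 y ->
  indecomposable X -> indecomposable Y -> ~ iso X Y ->
  prigid (block_mx f1 0 0 g1) (block_mx f2 0 0 g2) -> row_inj f1 f2 -> row_inj g1 g2 ->
  support_tau_tilting (pair0 (dsum X Y)).
Proof.
move=> Xf Yg Xi Yi XY fg fi gi; apply: (support_dsum D) => //.
have [z hz] := cok_dsum Xf Yg; apply: (cok_rigid fg _ hz); exact: row_inj_sum.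
Qed.

(** Exchanging [Z] for a module [Z'] that is generated by the common summand [W],
    when there are no homomorphisms to [Z] outside the radical. *)
Lemma cok_mutation b a b' a' b2 a2 (f1 f2 : 'M[k]_(b, a)) (g1 g2 : 'M[k]_(b', a'))
    (h1 h2 : 'M[k]_(b2, a2)) Z W Z' (z : 'I_a -> Z) (w : 'I_a' -> W) (z' : 'I_a2 -> Z')
    M1 M2 s1 t1 s2 t2 F1 F2 :
  cok f1 f2 z -> cok g1 g2 w -> cok h1 h2 z' -> indecomposable Z -> indecomposable W ->
  indecomposable Z' -> prigid g1 g2 -> row_inj g1 g2 ->
  support_tau_tilting (pair0 M1) -> support_tau_tilting (pair0 M2) ->
  iso M1 (dsum Z W) -> iso M2 (dsum W Z') ->
  (forall s t, phom g1 g2 f1 f2 s t -> t = 0) ->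
  (forall s t, phom h1 h2 f1 f2 s t -> t = 0) ->
  phom g1 g2 h1 h2 s1 t1 -> phom g1 g2 h1 h2 s2 t2 -> F1 *m t1 + F2 *m t2 = 1%:M ->
  left_mutation (pair0 M1) (pair0 M2).
Proof.
move=> Zf Wg Zh Zi Wi Zi' gr gi S1 S2 e1 e2 WZ ZZ st1 st2 F.
have W1 : retract W M1 := retract_trans (retract_dsumr Z W) (iso_retract (iso_sym e1)).
have ZM : retract Z M1 := retract_trans (retract_dsuml Z W) (iso_retract (iso_sym e1)).
have W2 : retract W M2 := retract_trans (retract_dsuml W Z') (iso_retract (iso_sym e2)).
apply: (left_mutation_common S1 S2 Wi (cok_rigid gr gi Wg) W1 W2 _ Zi.1).
- move=> X Xi XM; case: (retract_dsum Xi (retract_trans XM (iso_retract e2))) => h.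
    exact: covered_retract (retract_trans h W1).
  have /iso_sym/isoP[f [f' [fH _ _ K]]] := retract_indecomposable Zi' Xi.1 h.
  apply: (covered_surj fH) (cok_covered Wg Zh st1 st2 F W1) => y.
  by exists (f' y); rewrite K.
- exact: covered_retract ZM.
- case/isoP: e2 => f [f' [fH fH' K _]] u uH x; rewrite -[x]K.
  rewrite (dsum_pairE (f x)) (mhomD fH') (mhomD uH); apply: inJD.
    exact: (cok_inJ_hom hal hbe ind WZ Wg Zf (mhom_comp (mhom_comp (@mhom_inl _ _ W Z') fH') uH)).
  exact: (cok_inJ_hom hal hbe ind ZZ Zh Zf (mhom_comp (mhom_comp (@mhom_inr _ _ W Z') fH') uH)).
Qed.

Lemma L_indecomposable m X (x : 'I_m.+1 -> X) : cok (L1 k m) (L2 k m) x -> indecomposable X.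
Proof.
apply: cok_brick_indecomposable => // s t /phom_L_scalar[c [_ ->]]; by exists c.
Qed.

Lemma K_indecomposable m X (x : 'I_m.+1 -> X) : cok (L1 k m.+1)^T (L2 k m.+1)^T x ->
  indecomposable X.
Proof. by apply: cok_brick_indecomposable => // s t /phom_K_scalar. Qed.

Lemma L_not_iso m X Y (x : 'I_m.+1 -> X) (y : 'I_m.+2 -> Y) :
  cok (L1 k m) (L2 k m) x -> cok (L1 k m.+1) (L2 k m.+1) y -> ~ iso X Y.
Proof.
move=> Xf Yf /iso_sym; apply: inJ_not_iso (L_indecomposable Xf).1 _ => u uH.
apply: (cok_inJ_hom hal hbe ind _ Yf Xf uH) => s t st.
by have [] := phom_L_down _ st.
Qed.

Lemma K_not_iso m X Y (x : 'I_m.+2 -> X) (y : 'I_m.+1 -> Y) :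
  cok (L1 k m.+2)^T (L2 k m.+2)^T x -> cok (L1 k m.+1)^T (L2 k m.+1)^T y -> ~ iso X Y.
Proof.
move=> Xf Yf /iso_sym; apply: inJ_not_iso (K_indecomposable Xf).1 _ => u uH.
by apply: (cok_inJ_hom hal hbe ind _ Yf Xf uH) => s t; apply: phom_K_up.
Qed.

Lemma L_support m X Y (x : 'I_m.+1 -> X) (y : 'I_m.+2 -> Y) :
  cok (L1 k m) (L2 k m) x -> cok (L1 k m.+1) (L2 k m.+1) y ->
  support_tau_tilting (pair0 (dsum X Y)).
Proof.
move=> Xf Yf; apply: (cok_support Xf Yf (L_indecomposable Xf) (L_indecomposable Yf) (L_not_iso Xf Yf)).
- by apply: prigid_sum; apply: pext_L; lia.
- exact: L_row_inj.
- exact: L_row_inj.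
Qed.

Lemma K_support m X Y (x : 'I_m.+2 -> X) (y : 'I_m.+1 -> Y) :
  cok (L1 k m.+2)^T (L2 k m.+2)^T x -> cok (L1 k m.+1)^T (L2 k m.+1)^T y ->
  support_tau_tilting (pair0 (dsum X Y)).
Proof.
move=> Xf Yf; apply: (cok_support Xf Yf (K_indecomposable Xf) (K_indecomposable Yf) (K_not_iso Xf Yf)).
- by apply: prigid_sum; apply: pext_tr; apply: pext_L; lia.
- exact: row_inj_tr.
- exact: row_inj_tr.
Qed.

(** The pair of [L m] and [L m.+1] is the left mutation of the one before that
    exchanges [L m.-1] for a quotient of two copies of [L m]; the chain starts with
    the left mutation of the regular module that keeps the projective [L 0]. *)
Lemma L_linked m X Y (x : 'I_m.+1 -> X) (y : 'I_m.+2 -> Y) :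
  cok (L1 k m) (L2 k m) x -> cok (L1 k m.+1) (L2 k m.+1) y ->
  linked (pair0 (dsum X Y)) (hub B true).
Proof.
elim: m X Y x y => [|m IH] X Y x y Xf Yf.
  have [z hz] := cok_dsum Xf Yf.
  apply: (linked_hub_module (L_support Xf Yf) (presented_gen hz) (y := x)).
    exact: presented_ord0 Xf.
  exact: retract_dsuml.
have [Z [z Zf]] := cok_exists D i al be (L1 k m) (L2 k m).
apply: (linked_trans (L_support Zf Xf)); last exact: IH Zf Xf.
apply: linked_sym; apply: linked_mutation.
have [F1 [F2 F]] := refl_split (reflection_L k m.+1).
apply: (cok_mutation Zf Xf Yf (L_indecomposable Zf) (L_indecomposable Xf) (L_indecomposable Yf)
  (pext_L (leqnSn _)) (@L_row_inj _ _) (L_support Zf Xf) (L_support Xf Yf) (iso_refl _) (iso_refl _) _ _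
  (refl_phom1 (reflection_L k m.+1)) (refl_phom2 (reflection_L k m.+1)) F) => //.
- by move=> s t st; have [] := phom_L_down _ st.
- by move=> s t st; have [] := phom_L_down _ st.
Qed.

(** The module with one generator and both arrows as relations is simple at [i], and
    the other projective has no homomorphisms to it. *)
Lemma K1_support Y P (y : 'I_1 -> Y) (p : 'I_1 -> P) : cok (L1 k 1)^T (L2 k 1)^T y ->
  proj_at D (~~ i) p -> support_tau_tilting (ModPair Y P).
Proof.
move=> Yf Pp; have Yi := K_indecomposable Yf; have Pi := proj_at_indecomposable Pp.
have Pproj := free_projective Pp.
have [Yb Yn] := decomposition1 Yi; have [Pb Pn] := decomposition1 Pi.
split; last by exists 1%N, 1%N, 2%N; split=> //; exact: (regular_num D).2.
split=> //.
  apply: (cok_rigid _ _ Yf); last exact: row_inj_tr.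
  by apply: pext_tr; apply: pext_L.
have al0 : act al (y ord0) = 0 /\ act be (y ord0) = 0.
  have r0 := cok_rel Yf ord0; have r1 := cok_rel Yf (lift ord0 ord0).
  move: r0 r1; rewrite !big_ord1 /pmat !mxE /= !scale1r !scale0r addr0 add0r.
  by split.
move=> u /is_hom_mhom uH; apply/lfunP => q; rewrite zero_lfunE.
apply: (gen_eq Pp uH (mhom_zero _ _)) => r; rewrite -(presented_gen Pp).1 (mhom_act uH).
have [c ->] := (presented_gen Yf).2 (u (p r)).
rewrite big_ord1 -(cok_idem Yf) -!actM.
have [c1 [c2 E]] := corner_span (cornerE D (~~ i) i (c ord0)).
have -> : e (~~ i) * (c ord0 * e i) = c1 *: al + c2 *: be by rewrite mulrA E.
by rewrite actDl !actZl al0.1 al0.2 !scaler0 addr0.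
Qed.

(** Left mutations exchange the larger summand for a smaller one, which the common
    summand generates, until the simple module at [i] is left beside the projective
    at the other vertex. *)
Lemma K_linked m X Y (x : 'I_m.+2 -> X) (y : 'I_m.+1 -> Y) :
  cok (L1 k m.+2)^T (L2 k m.+2)^T x -> cok (L1 k m.+1)^T (L2 k m.+1)^T y ->
  linked (pair0 (dsum X Y)) (hub B false).
Proof.
elim: m X Y x y => [|m IH] X Y x y Xf Yf.
  have [P [p Pp]] := proj_at_exists D (~~ i).
  apply: (linked_trans (K1_support Yf Pp)); last first.
    exact: (linked_hub_proj D (K1_support Yf Pp) (K_indecomposable Yf) (proj_at_indecomposable Pp)).
  apply: linked_mutation.
  apply: (left_mutation_common (K_support Xf Yf) (K1_support Yf Pp) (K_indecomposable Yf) _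
    (retract_dsumr X Y) (retract_refl Y) _ (K_indecomposable Xf).1).
  - apply: (cok_rigid _ _ Yf); last exact: row_inj_tr.
    by apply: pext_tr; apply: pext_L.
  - by move=> Z Zi ZY; apply: covered_retract; exact: retract_trans ZY (retract_dsumr X Y).
  - by apply: covered_retract; exact: retract_dsuml.
  - move=> u uH; apply: (cok_inJ_hom hal hbe ind _ Yf Xf uH) => s t.
    exact: phom_K_up.
have [Z [z Zf]] := cok_exists D i al be (L1 k m.+1)^T (L2 k m.+1)^T.
apply: (linked_trans (K_support Yf Zf)); last exact: IH Yf Zf.
apply: linked_mutation.
case: (reflection_L k m.+1) => [G1 [G2 [_ [_ [_ /(congr1 trmx) G _ _]]]]].
have F : G2^T *m (L1 k m.+1)^T + - G1^T *m (L2 k m.+1)^T = 1%:M.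
  by rewrite -[RHS]trmx1 -G linearB /= !trmx_mul mulNmx.
have R := reflection_L k m.+1.
apply: (cok_mutation Xf Yf Zf (K_indecomposable Xf) (K_indecomposable Yf) (K_indecomposable Zf)
  _ (@row_inj_tr _ _) (K_support Xf Yf) (K_support Yf Zf) (iso_refl _) (iso_refl _) _ _
  (phom_tr (refl_phom1 R)) (phom_tr (refl_phom2 R)) F).
- by apply: pext_tr; apply: pext_L.
- by move=> s t; apply: phom_K_up.
- by move=> s t; apply: phom_K_up.
Qed.

Lemma linked_dsum_iso T X Y X' Y' b : support_tau_tilting (pair0 (dsum X' Y')) ->
  is_zero (pproj T) -> iso (pmod T) (dsum X Y) -> iso X X' -> iso Y Y' ->
  linked (pair0 (dsum X' Y')) (hub B b) -> linked T (hub B b).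
Proof.
move=> s T0 eT eX eY; apply: (linked_trans s); apply: linked_iso.
by split; [exact: iso_trans eT (dsum_iso eX eY) | exact: zero_iso].
Qed.

(** By the classification of rigid pencils, the two summands are consecutive
    preprojective or consecutive preinjective modules, and so lie in one of the two
    chains. *)
Lemma rigid_linked T b a (f1 f2 : 'M[k]_(b, a)) X Y (x : 'I_a -> pmod T) :
  is_zero (pproj T) -> iso (pmod T) (dsum X Y) ->
  indecomposable X -> indecomposable Y -> ~ iso X Y -> cok f1 f2 x -> prigid f1 f2 ->
  exists c, linked T (hub B c).
Proof.
move=> T0 eT Xi Yi XY Mf fr.
have XM : retract X (pmod T) := retract_trans (retract_dsuml X Y) (iso_retract (iso_sym eT)).
have YM : retract Y (pmod T) := retract_trans (retract_dsumr X Y) (iso_retract (iso_sym eT)).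
have eT' := iso_trans eT (dsumC X Y).
case: (prigid_trichotomy fr) => [a0|[m]|[m]].
- by case: (Xi.1); apply: retract_zero XM _; exact: presented_zero Mf a0.
- case=> n [ms [S [E [hms hE _ eE]]]]; exists true.
  have cls Z : indecomposable Z -> retract Z (pmod T) -> exists p, (p = m \/ p = m.+1) /\
      forall N (y : 'I_p.+1 -> N), cok (L1 k p) (L2 k p) y -> iso Z N.
    move=> Zi ZM; have [l hl] := cok_tfactor Mf hE eE Zi ZM.
    exists (ms l); split=> // N y Ny; apply: retract_indecomposable Zi.1 (hl N y Ny).
    exact: L_indecomposable Ny.
  have [p [hp eX]] := cls X Xi XM; have [q [hq eY]] := cls Y Yi YM.
  have pq : p <> q.
    move=> e; subst q; have [N [y Ny]] := cok_exists D i al be (L1 k p) (L2 k p).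
    by apply: XY; exact: iso_trans (eX _ _ Ny) (iso_sym (eY _ _ Ny)).
  have [N [y Ny]] := cok_exists D i al be (L1 k m) (L2 k m).
  have [N' [y' Ny']] := cok_exists D i al be (L1 k m.+1) (L2 k m.+1).
  have sN := L_support Ny Ny'; have lN := L_linked Ny Ny'.
  case: hp hq => ep [] eq; subst p q => //.
    exact: linked_dsum_iso sN T0 eT (eX _ _ Ny) (eY _ _ Ny') lN.
  exact: linked_dsum_iso sN T0 eT' (eY _ _ Ny) (eX _ _ Ny') lN.
case=> n [ms [S [E [hms hE eS _]]]]; exists false.
have cls Z : indecomposable Z -> retract Z (pmod T) -> exists p, (p.+1 = m \/ p = m) /\
    forall N (y : 'I_p.+1 -> N), cok (L1 k p.+1)^T (L2 k p.+1)^T y -> iso Z N.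
  move=> Zi ZM.
  have hE' l : tfactor f1 f2 (L1 k (ms l))^T (L2 k (ms l))^T (E l)^T (S l)^T.
    by have := tfactor_tr (hE l); rewrite !trmxK.
  have eS' : \sum_l (S l)^T = 1%:M by rewrite -linear_sum /= eS trmx1.
  have [l hl] := cok_tfactor Mf hE' eS' Zi ZM.
  move: hl (hms l); case: (ms l) => [|p] hl hp.
    have [N [y Ny]] := cok_exists D i al be (L1 k 0)^T (L2 k 0)^T.
    by case: (Zi.1); apply: retract_zero (hl _ _ Ny) (presented_zero Ny erefl).
  exists p; split; first by case: hp => [->|[->]]; [left | right].
  move=> N y Ny; apply: retract_indecomposable Zi.1 (hl N y Ny).
  exact: K_indecomposable Ny.
have [p [hp eX]] := cls X Xi XM; have [q [hq eY]] := cls Y Yi YM.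
have pq : p <> q.
  move=> e; subst q; have [N [y Ny]] := cok_exists D i al be (L1 k p.+1)^T (L2 k p.+1)^T.
  by apply: XY; exact: iso_trans (eX _ _ Ny) (iso_sym (eY _ _ Ny)).
have [r hr] : exists r, (p = r.+1 /\ q = r) \/ (p = r /\ q = r.+1).
  by exists (minn p q); lia.
have [N [y Ny]] := cok_exists D i al be (L1 k r.+2)^T (L2 k r.+2)^T.
have [N' [y' Ny']] := cok_exists D i al be (L1 k r.+1)^T (L2 k r.+1)^T.
have sN := K_support Ny Ny'; have lN := K_linked Ny Ny'.
case: hr => -[ep eq]; subst p q.
  exact: linked_dsum_iso sN T0 eT (eX _ _ Ny) (eY _ _ Ny') lN.
exact: linked_dsum_iso sN T0 eT' (eY _ _ Ny) (eX _ _ Ny') lN.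
Qed.

End Independent.

(** ** One arrow up to scalars *)

Lemma dependent_generator i : ~ independent (arrow D (i, false)) (arrow D (i, true)) ->
  exists al, corner D (~~ i) i al /\ forall x, corner D (~~ i) i x -> exists c, x = c *: al.
Proof.
move=> nind; set a1 := arrow D (i, false); set a2 := arrow D (i, true).
have [c1 [c2 [rel nz]]] : exists c1 c2, c1 *: a1 + c2 *: a2 = 0 /\ ~ (c1 = 0 /\ c2 = 0).
  apply: NNPP => h; apply: nind => c1 c2 rel; apply: NNPP => nz.
  by apply: h; exists c1, c2.
have [c0|c0] := eqVneq c1 0.
  exists a1; split=> [|x /corner_span[d1 [d2 ->]]]; first exact: (arrow_corner D (i, false)).
  exists d1; suff -> : arrow D (i, true) = 0 by rewrite scaler0 addr0.
  move/eqP: rel; rewrite c0 scale0r add0r scaler_eq0 => /orP[/eqP c20|/eqP //].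
  by case: nz.
exists a2; split=> [|x /corner_span[d1 [d2 ->]]]; first exact: (arrow_corner D (i, true)).
exists (- (d1 * (c1^-1 * c2)) + d2); rewrite scalerDl; congr (_ + _).
have -> : arrow D (i, false) = - (c1^-1 * c2) *: a2.
  apply: (scalerI c0); rewrite scalerA mulrN mulrA mulfV // mul1r scaleNr.
  by apply/eqP; rewrite -addr_eq0 rel.
by rewrite scalerA mulrN.
Qed.

(** If the arrows from [i] are proportional, a minimal presentation is a matrix with
    independent rows, and the cokernel is a sum of copies of the projective at [i]
    and of its quotient by one relation. *)
Lemma degenerate_linked i al T b a (f : 'M[k]_(b, a)) X Y (x : 'I_a -> pmod T) :
  corner D (~~ i) i al -> support_tau_tilting T ->
  iso (pmod T) (dsum X Y) -> indecomposable X -> indecomposable Y -> ~ iso X Y ->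
  cok D i al 0 f 0 x -> row_free f -> linked T (hub B true).
Proof.
case: T x => M P /= x hal s eT Xi Yi XY Mf /row_freeP[G fG].
have XM : retract X M := retract_trans (retract_dsuml X Y) (iso_retract (iso_sym eT)).
have YM : retract Y M := retract_trans (retract_dsumr X Y) (iso_retract (iso_sym eT)).
pose R := 1%:M - G *m f.
have fR : f *m R = 0 by rewrite mulmxBr mulmx1 mulmxA fG mul1mx subrr.
pose bs (l : 'I_(a + b)) := if split l is inl _ then 0%N else 1%N.
pose g l : 'M[k]_(bs l, 1) := const_mx 1.
pose E (l : 'I_(a + b)) := match split l with inl r => R *m delta_mx r r
   | inr q => G *m delta_mx q q *m f end.
have hE l : exists S, tfactor f 0 (g l) 0 S (E l).
  rewrite /g /E /bs; case: (split l) => q.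
    exists 0; exists 0, (R *m delta_mx q 0), 0, (delta_mx 0 q); split.
    + by split; rewrite ?mulmxA ?fR !mul0mx.
    + by split; rewrite [LHS]flatmx0 [RHS]flatmx0.
    + by rewrite mulmx0.
    + by rewrite -mulmxA -delta_mx_diag.
  have -> : const_mx 1 = 1%:M :> 'M[k]_1 by apply/matrixP => i' j'; rewrite !mxE !ord1.
  exists (delta_mx q q), (delta_mx q 0), (G *m delta_mx q 0), (delta_mx 0 q), (delta_mx 0 q *m f).
  split.
  + by split; rewrite ?mulmxA ?fG ?mul1mx ?mulmx1 ?mul0mx ?mulmx0.
  + by split; rewrite ?mul1mx ?mul0mx ?mulmx0.
  + exact: delta_mx_diag.
  + by rewrite !mulmxA delta_mx_diag !mulmxA.
have eE : \sum_l E l = 1%:M.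
  rewrite big_split_ord /= /E.
  under eq_bigr => r _ do rewrite (unsplitK (inl r : 'I_a + 'I_b)).
  under [X in _ + X]eq_bigr => q _ do rewrite (unsplitK (inr q : 'I_a + 'I_b)).
  by rewrite -!mulmx_suml -!mulmx_sumr -!mx1_sum_delta !mulmx1 subrK.
have [S {}hE] := fin_all_exists hE.
have [N [y Ny]] := proj_at_exists D i.
have [N' [y' Ny']] := cok_exists D i al 0 (const_mx 1 : 'M_1) 0.
have cls Z : indecomposable Z -> retract Z M -> iso Z N \/ iso Z N'.
  move=> Zi ZM; have [l hl] := cok_tfactor Mf hE eE Zi ZM.
  move: hl; rewrite /g /bs; case: (split l) => _ hl; [left | right].
    apply: retract_indecomposable (proj_at_indecomposable Ny) Zi.1 (hl _ y _).
    exact: presented_ord0 Ny.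
  apply: retract_indecomposable Zi.1 (hl _ _ Ny').
  exact: (cok1_indecomposable hal (corner0 _ _ _) Ny').
have NM : retract N M.
  case: (cls X Xi XM) => eX; first exact: retract_trans (iso_retract (iso_sym eX)) XM.
  case: (cls Y Yi YM) => eY; first exact: retract_trans (iso_retract (iso_sym eY)) YM.
  by case: XY; exact: iso_trans eX (iso_sym eY).
exact: linked_hub_module s (presented_gen Mf) Ny NM.
Qed.

(** As [B] has two simple modules, the cases are the number of summands of the
    projective part; when it is 0 and the module part is not projective, a minimal
    presentation runs between copies of the two different projectives, by
    [tau_data_neq], and is a pencil in the arrows from one vertex to the other. *)
Lemma support_linked T : support_tau_tilting T -> exists c, linked T (hub B c).
Proof.
move=> s; case: (s) => [[[Mb Pb] Mt Pp _] [m [p [n [hm hp hn mpn]]]]].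
have n2 : n = 2%N := num_summands_uniq hn (regular_num D).2.
case: p hp mpn => [|[|[|p]]] hp mpn; last by lia.
- have P0 := num_summands0 Pb hp.
  have {hm} hm : num_summands (pmod T) 2 by move: hm; rewrite (_ : m = 2%N) //; lia.
  have [X [Y [Xi Yi XY eT]]] := num_summands2 Mb hm.
  have [n0 [v0 [n1 [v1 [F [x dat]]]]]] := tau_rigid_data D Mt.
  case: n1 v1 F dat => [|n1] v1 F dat.
    exists true; apply: linked_iso; split; last exact: zero_iso P0.
    have Mp : projective (pmod T).
      by case: dat => Mf _ _ _; apply: free_projective (presented_ord0 _ Mf).
    have XM : retract X (pmod T) := retract_trans (retract_dsuml X Y) (iso_retract (iso_sym eT)).
    have YM : retract Y (pmod T) := retract_trans (retract_dsumr X Y) (iso_retract (iso_sym eT)).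
    have [v [y Xv]] := projective_indecomposable D (projective_retract Mp XM) Xi.
    have [w [z Yw]] := projective_indecomposable D (projective_retract Mp YM) Yi.
    exact: iso_trans eT (dsum_projective_iso Xv Yw XY).
  have n0_gt0 : (0 < n0)%N.
    rewrite lt0n; apply/negP => /eqP n00; case: (Xi.1).
    apply: retract_zero (retract_trans (retract_dsuml X Y) (iso_retract (iso_sym eT))) _.
    by case: dat => Mf _ _ _; exact: presented_zero Mf n00.
  have vv := tau_data_neq dat; pose i := v0 (Ordinal n0_gt0).
  have v1E : v1 = fun _ => ~~ i by apply: functional_extensionality => l; exact: vv.
  have v0E : v0 = fun _ => i.
    apply: functional_extensionality => q; apply: negb_inj.
    by rewrite -(vv ord0 q) v1E.
  rewrite v1E v0E in dat; have [Mf Fc Fmin _] := dat.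
  case: (classic (independent (arrow D (i, false)) (arrow D (i, true)))) => [ind|].
    have [f1 h1] := fin_all_exists (fun l => fin_all_exists (fun q => corner_span (Fc l q).1)).
    have [f2 h2] := fin_all_exists (fun l => fin_all_exists (h1 l)).
    have FE : F = pmat (arrow D (i, false)) (arrow D (i, true))
        (\matrix_(l, q) f1 l q) (\matrix_(l, q) f2 l q).
      apply: functional_extensionality => l; apply: functional_extensionality => q.
      by rewrite /pmat !mxE h2.
    rewrite FE in dat; have [Mf' _ _ _] := dat.
    apply: (rigid_linked ind P0 eT Xi Yi XY Mf').
    exact: (prigid_of_tau_data (arrow_corner D (i, false)) (arrow_corner D (i, true)) ind dat).
  move/dependent_generator => [al [hal span]].
  have [f h] := fin_all_exists (fun l => fin_all_exists (fun q => span _ (Fc l q).1)).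
  have FE : F = pmat al 0 (\matrix_(l, q) f l q) 0.
    apply: functional_extensionality => l; apply: functional_extensionality => q.
    by rewrite /pmat !mxE scale0r addr0 h.
  exists true; rewrite FE in Mf Fmin.
  apply: (degenerate_linked hal s eT Xi Yi XY Mf).
  set f0 := \matrix_(l, q) f l q in Mf Fmin *.
  rewrite -kermx_eq0; apply/eqP/matrixP => r l; rewrite [RHS]mxE.
  have /matrixP K := mulmx_ker f0; move: (kermx f0) K => U K.
  have d0 q : \sum_l (U r l *: 1) * pmat al 0 f0 0 l q = 0.
    have := K r q; rewrite mxE [RHS]mxE => Krq.
    rewrite -[RHS](scale0r al) -Krq scaler_suml; apply: eq_bigr => l' _.
    by rewrite -scalerAl mul1r /pmat [X in X *: 0]mxE scaler0 addr0 scalerA.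
  by have := Fmin _ d0 l; rewrite chiZ chi1 mulr1.
- have {hm} hm : num_summands (pmod T) 1 by move: hm; rewrite (_ : m = 1%N) //; lia.
  exists false; case: T s Mb Pb hm hp {Mt Pp} => M P s Mb Pb hm hp.
  exact: (linked_hub_proj D s (num_summands1 Mb hm) (num_summands1 Pb hp)).
have {hm} hm : num_summands (pmod T) 0 by move: hm; rewrite (_ : m = 0%N) //; lia.
exists false; apply: linked_iso; split; first exact: zero_iso (num_summands0 Mb hm).
have [X [Y [Xi Yi XY eP]]] := num_summands2 Pb hp.
have XP : retract X (pproj T) := retract_trans (retract_dsuml X Y) (iso_retract (iso_sym eP)).
have YP : retract Y (pproj T) := retract_trans (retract_dsumr X Y) (iso_retract (iso_sym eP)).
have [v [y Xv]] := projective_indecomposable D (projective_retract Pp XP) Xi.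
have [w [z Yw]] := projective_indecomposable D (projective_retract Pp YP) Yi.
exact: iso_trans eP (dsum_projective_iso Xv Yw XY).
Qed.

Lemma at_most_two_components : at_most_components B 2.
Proof.
move=> T; have [c hc] := fin_all_exists (fun i => support_linked (proj2_sig (T i))).
have conn i j : c i = c j -> connected (T i) (T j).
  move=> e; have := hc j; rewrite -e => hj; have hi := hc i.
  move: hi hj; case: (T i) (T j) => [Ti si] [Tj sj] /= hi hj.
  apply: (rst_trans _ _ _ _ _ (hi si (hub_support D _))).
  by apply: rst_sym; exact: hj.
pose i0 : 'I_3 := ord0; pose i1 : 'I_3 := lift ord0 ord0; pose i2 : 'I_3 := ord_max.
have [e|e] := eqVneq (c i0) (c i1); first by exists i0, i1; split=> //; exact: conn.
have [e'|e'] := eqVneq (c i0) (c i2); first by exists i0, i2; split=> //; exact: conn.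
exists i1, i2; split=> //; apply: conn.
by move: e e'; case: (c i0) (c i1) (c i2) => [] [] [].
Qed.

End Chains.

(* A is kQ / r^3 and B is A / I, each given by its quotient map. *)
Theorem corollary3p7 (k : fieldType)
    (A : falgType k) (pA : {lrmorphism path_alg k double_kronecker -> A})
    (hA : let r := @arrow_ideal k double_kronecker in
          quotient_map (ideal_mul r (ideal_mul r r)) pA)
    (I : A -> Prop) (hI : two_sided_ideal I)
    (hrad : forall x, I x -> @radical k A x)
    (B : falgType k) (pB : {lrmorphism A -> B}) (hB : quotient_map I pB) :
  at_most_components B 2.
Proof.
have [D] := dk_structure_quotient hA hrad hB.
exact: at_most_two_components D.
Qed.
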